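(* Let $\lambda,\mu,\alpha,\rho>0$, and let $\{X_t\}_{t\ge 0}$ be the non-negative solution of the stochastic differential equation $$\mathrm{d}X_t=(\lambda-\mu-\alpha X_t)\,X_t\,\mathrm{d}t+\rho\,\sqrt{(\lambda+\mu+\alpha X_t)\,X_t}\;\mathrm{d}B_t .$$ Let $\tau_0=\inf\{t\ge 0 : X_t=0\}$. Then extinction occurs almost surely in finite time, that is, for all $x\ge 0$, $$\mathbb{P}_x(\tau_0<\infty)=1 ,$$ where $\mathbb{P}_x$ denotes the probability measure under which $X_0=x$.
   Context: $B_t$ is a standard one-dimensional Brownian motion, independent of $X_0$. The process $X_t$ has continuous paths, takes values in $[0,\infty)$, and satisfies $X_t=0$ for all $t\ge\tau_0$. The convention is $\inf\emptyset=+\infty$. *)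

(* Defs.v *)
From HB Require Import structures.
From mathcomp Require Import all_boot all_order all_algebra.
From mathcomp Require Import all_classical all_reals all_analysis.

Set Implicit Arguments.
Unset Strict Implicit.
Unset Printing Implicit Defensive.

Import Order.TTheory GRing.Theory Num.Theory.
Import numFieldNormedType.Exports.

Local Open Scope classical_set_scope.
Local Open Scope ring_scope.

(* Time is a real number t with 0 <= t; processes and filtrations are total
   functions of t : R, and their values at negative times are never used. *)

Section StochasticProcesses.
Context {R : realType} {d : measure_display} {T : measurableType d}.

Record filtration (F : R -> set (set T)) : Prop := Filtration {
  filtration_sigma : forall t : R, 0 <= t -> sigma_algebra setT (F t);
  filtration_sub : forall t : R, 0 <= t -> F t `<=` measurable;
  filtration_mono : forall s t : R, 0 <= s -> s <= t -> F s `<=` F t }.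

Definition measurable_wrt (G : set (set T)) (f : T -> R) : Prop :=
  preimage_set_system setT f measurable `<=` G.

Definition adapted (F : R -> set (set T)) (X : R -> T -> R) : Prop :=
  forall t : R, 0 <= t -> measurable_wrt (F t) (X t).

Definition continuous_path (X : R -> T -> R) (w : T) : Prop :=
  {within `[0, +oo[%classic, continuous (X ^~ w)}.

(* The second parameter of normal_prob is the standard deviation.
   Independence of the increments from F includes independence of B from F 0,
   hence from X 0 for every adapted process X. *)
Record brownian_motion (P : probability T R) (F : R -> set (set T))
    (B : R -> T -> R) : Prop := BrownianMotion {
  brownian_adapted : adapted F B;
  brownian_start : {ae P, forall w, B 0 w = 0};
  brownian_indep : forall s t : R, 0 <= s -> s < t ->
    forall (A : set T) (U : set R), F s A -> measurable U ->
    P (A `&` (B t \- B s) @^-1` U) = (P A * P ((B t \- B s)%R @^-1` U))%E;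
  brownian_normal : forall s t : R, 0 <= s -> s < t ->
    forall U : set R, measurable U ->
    P ((B t \- B s) @^-1` U) = normal_prob 0 (Num.sqrt (t - s)) U;
  brownian_continuous : {ae P, forall w, continuous_path B w} }.

(* The process sum_(i < n) xi_i 1_]t_i, t_{i+1}]; only the first n values and
   n + 1 times matter. *)
Record simple_process (F : R -> set (set T)) := SimpleProcess {
  simple_size : nat;
  simple_time : nat -> R;
  simple_coef : nat -> T -> R;
  simple_time_ge0 : 0 <= simple_time 0%N;
  simple_time_mono : forall i j, (i <= j)%N -> simple_time i <= simple_time j;
  simple_coef_measurable :
    forall i, measurable_wrt (F (simple_time i)) (simple_coef i);
  simple_coef_bounded :
    forall i, exists M : R, forall w, `|simple_coef i w| <= M }.

Definition simple_eval F (h : simple_process F) (s : R) (w : T) : R :=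
  \sum_(i < simple_size h)
    simple_coef h i w *
    \1_(`]simple_time h i, simple_time h i.+1]%classic : set R) s.

Definition simple_integral F (B : R -> T -> R) (h : simple_process F)
    (t : R) (w : T) : R :=
  \sum_(i < simple_size h)
    simple_coef h i w *
    (B (Num.min t (simple_time h i.+1)) w - B (Num.min t (simple_time h i)) w).

Definition cvg0_in_probability (P : probability T R) (Y : nat -> T -> \bar R)
    : Prop :=
  forall e : R, 0 < e ->
    P [set w | (e%:E <= `|Y n w|)%E] @[n --> \oo] --> 0%E.

(* J is (a version of) the Ito integral of H with respect to B over [0, t], in
   the usual extension of the integral from simple processes to the adapted H
   with \int_0^t H^2 < +oo almost surely. J is determined up to a.s. equality. *)
Definition is_ito_integral (P : probability T R) (F : R -> set (set T))
    (B H : R -> T -> R) (t : R) (J : T -> R) : Prop :=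
  measurable_fun setT J /\
  exists h : nat -> simple_process F,
    cvg0_in_probability P (fun n w =>
      \int[lebesgue_measure]_(s in `[0%R, t])
        (((simple_eval (h n) s w - H s w) ^+ 2)%R%:E))%E /\
    cvg0_in_probability P (fun n w => (simple_integral B (h n) t w - J w)%:E).

(* X solves dX_t = b(X_t) dt + sigma(X_t) dB_t. *)
Record sde_solution (P : probability T R) (F : R -> set (set T))
    (B : R -> T -> R) (b sigma : R -> R) (X : R -> T -> R) : Prop :=
  SdeSolution {
  sde_adapted : adapted F X;
  sde_continuous : forall w, continuous_path X w;
  sde_equation : forall t : R, 0 <= t ->
    exists J : T -> R,
      is_ito_integral P F B (fun s w => sigma (X s w)) t J /\
      {ae P, forall w,
        X t w = X 0 w + \int[lebesgue_measure]_(s in `[0, t]) b (X s w) + J w} }.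

(* ereal_inf set0 = +oo. *)
Definition hitting_time (X : R -> T -> R) (a : R) (w : T) : \bar R :=
  ereal_inf [set t%:E | t in [set t : R | 0 <= t /\ X t w = a]].

End StochasticProcesses.

(* Main.v *)
Require Import Defs.
From HB Require Import structures.
From mathcomp Require Import all_boot all_order all_algebra.
From mathcomp Require Import all_classical all_reals all_analysis.
From mathcomp Require Import measurable_realfun.
From mathcomp Require Import ring lra.
Import Order.TTheory GRing.Theory Num.Theory.
Import numFieldNormedType.Exports.
Local Open Scope classical_set_scope.
Local Open Scope ring_scope.
Set Implicit Arguments.
Unset Strict Implicit.
Unset Printing Implicit Defensive.

(** An Ito formula is out of reach because of how the integral is given: each time t has its own
    version [J] and its own approximating sequence of simple processes, so there is no integral
    process to stop or to compose with V. On a grid only finitely many times matter, and one simple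
    process can serve them all. The Euler sum takes its coefficients at X, not at Y. Closeness of Y
    to X then amounts to approximating two integrals, without a Gronwall estimate, for which the
    square root is not Lipschitz at 0. The price is that V' and V'' are taken at y and the
    coefficients at a nearby x; uniform continuity keeps half of c. Orders of magnitude, with z =
    sqrt y and sigma^2 of order z^2 at 0: there V' is of order 1/z and V'' of order -1/z^3, so
    sigma^2 V'' tends to -oo like -1/z while b V' vanishes like z. At +oo, V' is of order 1/z^3 and
    b of order -z^4, so the drift contributes about -z. The square root thus makes V singular enough
    at 0 and slow enough at +oo, while V stays bounded. *)

(* Let L be the generator of the diffusion.  For k large, the bounded function
   V(y) = - exp (k / (1 + sqrt y)) satisfies L V <= - c < 0 on all of (0, +oo):
   near 0 the singularity of V'' dominates, near +oo the logistic drift does,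
   and k takes care of the compact part in between.  Hence c t times the
   probability that X stays in [eta, N] up to time t is at most sup |V| = e^k,
   uniformly in eta and N, so P(X_t > 0) <= C / t; as 0 is absorbing, letting t
   tend to +oo concludes.
   No Ito formula is needed.  Along a uniform grid of [0, t] the solution is
   compared with the Euler sum Y driven by the coefficients of X cut off outside
   [eta, N]; E V(Y) is then controlled by a Taylor expansion on each cell and the
   moments of the Brownian increments, until Y separates from X or X leaves
   [eta, N].  That Y stays close to X follows from Lenglart's inequality
   P(max |int h dB| >= e, int h^2 ds <= theta) <= theta / e^2
   for simple processes h. *)

(** * Real analysis *)

Section RealAnalysis.
Context {R : realType}.

(** Heine's theorem, from the near-covering form of compactness: local radii for the bound e / 2 are
    merged into one radius for the segment. *)
Lemma within_continuous_uniformly (f : R -> R) (a b e : R) :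
  {within `[a, b], continuous f} -> 0 < e ->
  exists2 r : R, 0 < r & forall u v, u \in `[a, b] -> v \in `[a, b] ->
    `|u - v| <= r -> `|f u - f v| <= e.
Proof.
move=> cf e0.
have e20 : 0 < e / 2 by rewrite divr_gt0.
have local x : x \in `[a, b] -> exists2 r : R, 0 < r &
    forall u, u \in `[a, b] -> `|x - u| < r -> `|f x - f u| < e / 2.
  move=> xab.
  have : nbhs (x : subspace `[a, b]) (fun u => `|f x - f u| < e / 2).
    by have /cvgrPdist_lt := cf x; apply.
  rewrite /nbhs/= -nbhs_subspace_in// => /nbhs_ballP[r /= r0 hr]; exists r => // u uab xu.
  by apply: hr.
pose P (r : R) (u : R) := u \in `[a, b] -> forall v, v \in `[a, b] ->
  `|u - v| <= r -> `|f u - f v| <= e.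
have := @segment_compact R a b; rewrite compact_near_coveringP.
move=> /(_ R (0 : R)^'+ P _) H.
have H1 : \forall r \near (0 : R)^'+, `[a, b]%classic `<=` P r.
  apply: H => x /= xab.
  have [r r0 hr] := local x xab.
  (* Half the local radius: a point u of this ball and a v within r / 2 of u are both within r of
     x. *)
  exists (ball x (r / 2), [set d | d < r / 2]) => /=.
    split; first by apply: nbhsx_ballx; rewrite divr_gt0.
    by apply: nbhs_right_lt; rewrite divr_gt0.
  move=> [u d] /= [xu dr] uab v vab uv.
  have xv : `|x - v| < r.
    have -> : x - v = (x - u) + (u - v) by ring.
    rewrite /ball /= in xu.
    apply: le_lt_trans (ler_normD _ _) _.
    by rewrite [ltRHS]splitr ltrD// (le_lt_trans uv).
  have xu' : `|x - u| < r.
    by rewrite /ball /= in xu; apply: (lt_trans xu); lra.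
  have -> : f u - f v = - (f x - f u) + (f x - f v) by ring.
  rewrite (le_trans (ler_normD _ _))// normrN (splitr e).
  by rewrite lerD// ltW// hr.

have [r [Hr r0]] : exists r : R, `[a, b]%classic `<=` P r /\ 0 < r.
  have : \forall r \near (0 : R)^'+, `[a, b]%classic `<=` P r /\ 0 < r.
    by apply: filterI H1 _; exact: nbhs_right_gt.
  by move=> H2; have := @filter_ex _ _ (at_right_proper_filter (0:R)) _ H2.
exists r => // u v uab vab; exact: Hr.
Qed.

Lemma mvt_segment (F F1 : R -> R) (a b : R) : a <= b ->
   (forall u : R, a <= u <= b -> is_derive u 1 F (F1 u)) ->
   exists2 c : R, a <= c <= b & F b - F a = F1 c * (b - a).
Proof.
move=> ab dF.
have dFo : forall u : R, u \in `]a, b[ -> is_derive u 1 F (F1 u).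
  by move=> u; rewrite in_itv/= => /andP[au ub]; apply: dF; rewrite !ltW.
have cF : {within `[a, b], continuous F}.
  apply: derivable_within_continuous => u; rewrite in_itv/= => uab.
  by have dFu := dF _ uab; exact: ex_derive.
have [c + E] := MVT_segment ab dFo cF.
by rewrite in_itv/= => cab; exists c.
Qed.

(** By the mean value theorem for [f1], the derivative of g is nonpositive to the right of y and
    nonnegative to the left, so g is largest at y. *)
Lemma taylor2_le (f f1 f2 : R -> R) (y h M : R) :
  (forall u, `|u - y| <= `|h| -> is_derive u 1 f (f1 u)) ->
  (forall u, `|u - y| <= `|h| -> is_derive u 1 f1 (f2 u)) ->
  (forall u, `|u - y| <= `|h| -> f2 u <= M) ->
  f (y + h) <= f y + f1 y * h + M / 2 * h ^+ 2.
Proof.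
move=> df df1 f2M.
pose g u := f u - f1 y * (u - y) - M / 2 * (u - y) ^+ 2.
have dg u : `|u - y| <= `|h| ->
    is_derive u 1 g (f1 u - f1 y - M * (u - y)).
  move=> uy; have d := df u uy; rewrite /g.
  apply: is_derive_eq.
  by rewrite /GRing.scale /=; lra.
suff : g (y + h) <= g y by rewrite /g (addrC y) addrK subrr; lra.
have [h0|h0] := leP 0 h.
- have inh u : y <= u -> u <= y + h -> `|u - y| <= `|h|.
    by move=> *; rewrite (ger0_norm h0) ger0_norm; lra.
  have [|u|c] := @mvt_segment g (fun u => f1 u - f1 y - M * (u - y)) y (y + h).
  + lra.
  + by case/andP=> ? ?; exact/dg/inh.
  case/andP => [yc cyh] E.
  have [u|c'] := mvt_segment (F := f1) (F1 := f2) yc.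
    by case/andP=> ? ?; apply/df1/inh; lra.
  case/andP => [yc' cc'] E'.
  have f2c : f2 c' <= M by apply/f2M/inh; lra.
  rewrite -subr_le0 E mulr_le0_ge0//; last lra.
  by rewrite E' -mulrBl mulr_le0_ge0// ?subr_le0// subr_ge0.
- have inh u : y + h <= u -> u <= y -> `|u - y| <= `|h|.
    by move=> *; rewrite (ltr0_norm h0) ler0_norm; lra.
  have [|u|c] := @mvt_segment g (fun u => f1 u - f1 y - M * (u - y)) (y + h) y.
  + lra.
  + by case/andP=> ? ?; exact/dg/inh.
  case/andP => [yhc cy] E.
  have [u|c'] := mvt_segment (F := f1) (F1 := f2) cy.
    by case/andP=> ? ?; apply/df1/inh; lra.
  case/andP => [cc' yc'] E'.
  have f2c : f2 c' <= M by apply/f2M/inh; lra.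
  rewrite -subr_ge0 E mulr_ge0//; last lra.
  have : f2 c' * (y - c) <= M * (y - c) by rewrite ler_wpM2r// subr_ge0.
  by rewrite -E' => ?; lra.
Qed.
End RealAnalysis.

(** * The Lyapunov function *)

Section Lyapunov.
Context {R : realType}.

Lemma within_continuous_bounded (f : R -> R) (a b : R) : a <= b ->
  {within `[a, b], continuous f} ->
  exists2 M : R, 0 <= M & forall u, a <= u <= b -> `|f u| <= M.
Proof.
move=> ab cf.
have cnf : {within `[a, b], continuous (fun u => `|f u|)}.
  by move=> u; exact: (continuous_comp (cf u) (@norm_continuous _ _ _)).
have [c _ cM] := EVT_max ab cnf.
by exists `|f c| => // u uab; apply: cM; rewrite in_itv.
Qed.

Variable k : R.

Definition lyap (y : R) : R := - expR (k / (1 + Num.sqrt y)).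
Definition lyap1 (y : R) : R :=
  expR (k / (1 + Num.sqrt y)) * k / (2 * Num.sqrt y * (1 + Num.sqrt y) ^+ 2).
(** Written as [lyap1] times its logarithmic derivative. For positive k and y the bracket is
    positive, so V is concave, and [lyap1] becomes a common factor of the generator. *)
Definition lyap2 (y : R) : R :=
  - lyap1 y * ((2 / (1 + Num.sqrt y) + k / (1 + Num.sqrt y) ^+ 2)
                 / (2 * Num.sqrt y) + (2 * Num.sqrt y ^+ 2)^-1).

Lemma lyap_le0 y : lyap y <= 0.
Proof. by rewrite oppr_le0 expR_ge0. Qed.

(** Valid for negative y as well, where [Num.sqrt] is 0 and V equals - e^k; this matters because the
    Euler sum may jump below 0. *)
Lemma lyap_ge y : 0 <= k -> - expR k <= lyap y.
Proof.
move=> k0; rewrite lerN2 ler_expR ler_pdivrMr ?ltr_pwDl ?sqrtr_ge0//.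
by rewrite mulrDr mulr1 lerDl mulr_ge0// sqrtr_ge0.
Qed.

Let is_derive_arg (y : R) : 0 < y ->
  is_derive y 1 (fun u : R => expR (k / (1 + Num.sqrt u)))
    (- expR (k / (1 + Num.sqrt y)) * k
      / (2 * Num.sqrt y * (1 + Num.sqrt y) ^+ 2)).
Proof.
move=> y0; have z0 : 0 < Num.sqrt y by rewrite sqrtr_gt0.
have nz : 1 + Num.sqrt y != 0 by rewrite gt_eqF// ltr_pwDl// ltW.
have ds := is_derive1_sqrt y0.
have dd : is_derive y 1 (fun u : R => 1 + Num.sqrt u) (2 * Num.sqrt y)^-1.
  by apply: is_derive_eq; rewrite add0r mul1r.
have di := @is_deriveV _ (fun u : R => 1 + Num.sqrt u) y _ 1 nz dd.
have dk : is_derive y 1 (fun u : R => k / (1 + Num.sqrt u))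
   (- k * (2 * Num.sqrt y)^-1 / (1 + Num.sqrt y) ^+ 2).
  apply: (is_derive_eq (is_deriveM (is_derive_cst k y 1) di)).
  by rewrite /GRing.scale /= !mulr0 addr0; field; rewrite nz gt_eqF.
apply: (is_derive_eq (@is_derive1_comp _ expR _ y _ _ (is_derive_expR _) dk)).
by field; rewrite nz gt_eqF.
Qed.

Lemma is_derive_lyap (y : R) : 0 < y -> is_derive y 1 lyap (lyap1 y).
Proof.
move=> y0; apply: (is_derive_eq (is_deriveN (is_derive_arg y0))).
by rewrite /lyap1 !mulNr opprK.
Qed.

Lemma is_derive_lyap1 (y : R) : 0 < y -> is_derive y 1 lyap1 (lyap2 y).
Proof.
move=> y0; have z0 : 0 < Num.sqrt y by rewrite sqrtr_gt0.
have nz : 1 + Num.sqrt y != 0 by rewrite gt_eqF// ltr_pwDl// ltW.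
have ds := is_derive1_sqrt y0.
have dd : is_derive y 1 (fun u : R => 1 + Num.sqrt u) (2 * Num.sqrt y)^-1.
  by apply: is_derive_eq; rewrite add0r mul1r.
have dD : is_derive y 1 (fun u : R => 2 * Num.sqrt u * (1 + Num.sqrt u) ^+ 2)
    ((1 + Num.sqrt y) ^+ 2 / Num.sqrt y + 2 * (1 + Num.sqrt y)).
  apply: is_derive_eq.
  by rewrite /GRing.scale /=; field; rewrite gt_eqF.
have nD : 2 * Num.sqrt y * (1 + Num.sqrt y) ^+ 2 != 0.
  by rewrite !mulf_neq0// ?pnatr_eq0// ?expf_neq0// gt_eqF.
have di := @is_deriveV _ (fun u : R => 2 * Num.sqrt u * (1 + Num.sqrt u) ^+ 2)
  y _ 1 nD dD.
apply: (is_derive_eq (is_deriveM (is_deriveM (is_derive_arg y0)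
  (is_derive_cst k y 1)) di)).
by rewrite /GRing.scale /= !fctE /= /lyap2 /lyap1; field; rewrite nz gt_eqF.
Qed.

Lemma continuous_lyap1 (y : R) : 0 < y -> {for y, continuous lyap1}.
Proof.
move=> y0; have ? := is_derive_lyap1 y0.
by apply/differentiable_continuous/derivable1_diffP; exact: ex_derive.
Qed.

Lemma continuous_lyap2 (y : R) : 0 < y -> {for y, continuous lyap2}.
Proof.
move=> y0; have z0 : 0 < Num.sqrt y by rewrite sqrtr_gt0.
have nz : 1 + Num.sqrt y != 0 by rewrite gt_eqF// ltr_pwDl// ltW.
have cs : {for y, continuous (@Num.sqrt R)} by exact: sqrt_continuous.
have c1 : {for y, continuous (fun u : R => 1 + Num.sqrt u)}.
  by apply: continuousD => //; exact: cst_continuous.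
have c1V : {for y, continuous (fun u : R => (1 + Num.sqrt u)^-1)}.
  exact: continuousV.
have csV : {for y, continuous (fun u : R => (Num.sqrt u)^-1)}.
  by apply: continuousV => //; rewrite gt_eqF.
have -> : lyap2 = fun u => - lyap1 u * ((2 * (1 + Num.sqrt u)^-1
    + k * ((1 + Num.sqrt u)^-1 * (1 + Num.sqrt u)^-1)) * 2^-1 * (Num.sqrt u)^-1
    + 2^-1 * ((Num.sqrt u)^-1 * (Num.sqrt u)^-1)).
  by apply/funext => u; rewrite /lyap2 !expr2 !invfM !mulrA.
have cM (f g : R -> R) : {for y, continuous f} -> {for y, continuous g} ->
  {for y, continuous (fun u => f u * g u)} by move=> cf cg; exact: continuousM.
have cD (f g : R -> R) : {for y, continuous f} -> {for y, continuous g} ->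
  {for y, continuous (fun u => f u + g u)} by move=> cf cg; exact: continuousD.
have cc (a : R) : {for y, continuous (fun _ : R => a)} by exact: cst_continuous.
have cN : {for y, continuous (fun u => - lyap1 u)}.
  by apply: continuousN; exact: continuous_lyap1.
exact: (cM _ _ cN (cD _ _ (cM _ _ (cM _ _ (cD _ _ (cM _ _ (cc 2) c1V)
  (cM _ _ (cc k) (cM _ _ c1V c1V))) (cc 2^-1)) csV)
  (cM _ _ (cc 2^-1) (cM _ _ csV csV)))).
Qed.

(** The expansion must hold for every h, as Gaussian increments are unbounded. For |h| <= r it is
    Taylor's formula with V'' uniformly continuous; for |h| > r, boundedness of V lets a multiple of
    (|h| / r)^4 dominate every term. The quartic term will cost only dt^2 in expectation. *)
Lemma lyap_taylor (a b w : R) : 0 <= k -> 0 < a -> a <= b -> 0 < w ->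
  exists2 K : R, 0 <= K & forall y h, a <= y <= b ->
    lyap (y + h) <= lyap y + lyap1 y * h + lyap2 y / 2 * h ^+ 2
                    + w * h ^+ 2 + K * h ^+ 4.
Proof.
move=> k0 a0 ab w0.
have cw (f : R -> R) (u v : R) : 0 < u ->
    (forall y, 0 < y -> {for y, continuous f}) -> {within `[u, v], continuous f}.
  move=> u0 cf; apply: continuous_in_subspaceT => y.
  by rewrite inE/= in_itv/= => /andP[uy _]; apply: cf; exact: lt_le_trans uy.
have [M1 M10 hM1] := within_continuous_bounded ab (cw _ _ _ a0 continuous_lyap1).
have [M2 M20 hM2] := within_continuous_bounded ab (cw _ _ _ a0 continuous_lyap2).
have a20 : 0 < a / 2 by rewrite divr_gt0.
have w20 : 0 < 2 * w by rewrite mulr_gt0.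
have [r0 r00 hr0] := within_continuous_uniformly
  (cw _ _ (b + a / 2) a20 continuous_lyap2) w20.
(* The bound a / 2 keeps y + h away from the singularity at 0. *)
pose r := Num.min r0 (a / 2).
have r_gt0 : 0 < r by rewrite lt_min r00.
(* When |h| > r, the three terms pay respectively for V (y + h) - V y <= e^k, for - V' y h and for -
   V'' y h^2 / 2. *)
exists (expR k / r ^+ 4 + M1 / r ^+ 3 + M2 / 2 / r ^+ 2).
  by rewrite !addr_ge0// ?divr_ge0 ?expR_ge0 ?exprn_ge0// ?divr_ge0// ltW.
move=> y h /andP[ay yb].
have [hr|rh] := leP `|h| r.
- have bd u : `|u - y| <= `|h| -> a / 2 <= u <= b + a / 2.
    move=> uy; have : `|u - y| <= a / 2.
      by rewrite (le_trans uy)// (le_trans hr)// ge_min lexx orbT.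
    by rewrite ler_norml => /andP[? ?]; apply/andP; split; lra.
  have pos u : `|u - y| <= `|h| -> 0 < u.
    by move=> /bd /andP[+ _]; exact: lt_le_trans.
  have := @taylor2_le R lyap lyap1 lyap2 y h (lyap2 y + 2 * w)
    (fun u uy => is_derive_lyap (pos u uy))
    (fun u uy => is_derive_lyap1 (pos u uy)).
  have H u : `|u - y| <= `|h| -> lyap2 u <= lyap2 y + 2 * w.
    move=> uy; have /= := hr0 u y.
    rewrite !in_itv/= (bd u uy) (bd y) ?subrr ?normr0// => /(_ isT isT).
    rewrite (le_trans uy)// ?(le_trans hr)// ?ge_min ?lexx// => /(_ isT).
    by rewrite ler_norml => /andP[_]; lra.
  move=> /(_ H) /le_trans; apply.
  have : 0 <= (expR k / r ^+ 4 + M1 / r ^+ 3 + M2 / 2 / r ^+ 2) * h ^+ 4.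
    rewrite mulr_ge0 ?exprn_even_ge0//.
    by rewrite !addr_ge0// ?divr_ge0 ?expR_ge0 ?exprn_ge0// ?divr_ge0// ltW.
  by lra.
- have := lyap_le0 (y + h); have := lyap_ge y k0.
  have yab : a <= y <= b by rewrite ay.
  have [/ler_normlP[m1 _] /ler_normlP[m2 _]] := (hM1 y yab, hM2 y yab).
  have h1 : 1 <= `|h| / r by rewrite ler_pdivlMr// mul1r ltW.
  have hE : h ^+ 4 = `|h| ^+ 4 by rewrite -normrX ger0_norm// exprn_even_ge0.
  have rn : r != 0 by rewrite gt_eqF.
  have hn n : 1 <= (`|h| / r) ^+ n by exact: exprn_ege1.
  have e1 : expR k <= expR k / r ^+ 4 * h ^+ 4.
    rewrite hE (_ : _ / _ * _ = expR k * (`|h| / r) ^+ 4); last by field.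
    by rewrite ler_peMr ?expR_ge0.
  have e2 : - (lyap1 y * h) <= M1 / r ^+ 3 * h ^+ 4.
    apply: (@le_trans _ _ (M1 * `|h|)).
      by rewrite (le_trans (ler_norm _))// normrN normrM ler_wpM2r ?hM1.
    rewrite hE (_ : _ / _ * _ = M1 * `|h| * (`|h| / r) ^+ 3); last by field.
    by rewrite ler_peMr// mulr_ge0.
  have e3 : - (lyap2 y / 2 * h ^+ 2) <= M2 / 2 / r ^+ 2 * h ^+ 4.
    apply: (@le_trans _ _ (M2 / 2 * h ^+ 2)).
      by rewrite -mulNr ler_wpM2r ?sqr_ge0// -mulNr ler_wpM2r.
    rewrite -(real_normK (num_real h)) hE.
    rewrite (_ : _ / _ * `|h| ^+ 4 = M2 / 2 * `|h| ^+ 2 * (`|h| / r) ^+ 2);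
      last by field.
    by rewrite ler_peMr// mulr_ge0 ?divr_ge0// sqr_ge0.
  have : 0 <= w * h ^+ 2 by rewrite mulr_ge0 ?sqr_ge0// ltW.
  by lra.
Qed.

End Lyapunov.

(** In the variable z = sqrt y the generator is E k z / (2 (1 + z)^2) times the bracket [br], with E
    >= 1. The bound [br] <= - c0 (1 + z)^2 / z cancels the z-dependent prefactor and leaves - E k c0
    / 2, whence the value of c. *)
Lemma lyap_generator (R : realType) (lambda mu alpha rho : R) :
  0 < lambda -> 0 < mu -> 0 < alpha -> 0 < rho ->
  exists k c : R, [/\ 0 < k, 0 < c & forall y, 0 < y ->
    lyap1 k y * ((lambda - mu - alpha * y) * y)
    + lyap2 k y / 2 * (rho ^+ 2 * ((lambda + mu + alpha * y) * y)) <= - c].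
Proof.
move=> l0 m0 al0 r0.
(* [kap] is the factor carried by the second-order terms once [br] is multiplied by z^2 (1 +
   z)^2. *)
pose a := lambda + mu; pose kap := rho ^+ 2 * a / 4.
have a0 : 0 < a by rewrite addr_gt0.
have kap0 : 0 < kap by rewrite divr_gt0// mulr_gt0// exprn_gt0.
(* Beyond Z the logistic term wins, since alpha Z >= 2 a. The 8 combines (1 + z)^2 <= 4 z^2 with the
   half of the logistic term that is reserved for c0. *)
pose Z := 1 + 2 * a / alpha; pose c0 := alpha / 8.
have Z1 : 1 < Z by rewrite ltrDl divr_gt0// mulr_gt0.
have aZ : 2 * a <= alpha * Z.
  have -> : alpha * Z = alpha + 2 * a by rewrite /Z; field; rewrite gt_eqF.
  by lra.
have c00 : 0 < c0 by rewrite divr_gt0.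
(* Chosen so that kap k z alone covers both left-hand terms of [Q] for z <= Z. *)
pose k := (a * Z * (1 + Z) ^+ 2 + c0 * (1 + Z) ^+ 4) / kap.
have k0 : 0 < k.
  by rewrite divr_gt0// addr_gt0// ?mulr_gt0// ?exprn_gt0//; lra.
exists k, (k * c0 / 2); split => //; first by rewrite divr_gt0// mulr_gt0.
move=> y y0; set z := Num.sqrt y.
have z0 : 0 < z by rewrite sqrtr_gt0.
have yE : y = z ^+ 2 by rewrite sqr_sqrtr// ltW.
(* This is the bound on [br] multiplied by z^2 (1 + z)^2, with lambda - mu enlarged to a and terms
   of favourable sign dropped. For z > Z, each half of alpha z^4 (1 + z)^2 pays for one term on the
   left. *)
have Q : a * z ^+ 2 * (1 + z) ^+ 2 + c0 * z * (1 + z) ^+ 4 <=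
    alpha * z ^+ 4 * (1 + z) ^+ 2 + kap * (k * z + (1 + z) ^+ 2).
  have p : 0 <= kap * (1 + z) ^+ 2 by rewrite mulr_ge0 ?sqr_ge0// ltW.
  have q : 0 <= kap * k * z by apply: mulr_ge0; [apply: mulr_ge0|]; exact: ltW.
  have s2 : 0 <= (1 + z) ^+ 2 by exact: sqr_ge0.
  have [zZ|Zz] := leP z Z.
  - have kapk : kap * k = a * Z * (1 + Z) ^+ 2 + c0 * (1 + Z) ^+ 4.
      by rewrite /k mulrC divfK// gt_eqF.
    have t1 : a * z ^+ 2 * (1 + z) ^+ 2 <= a * Z * (1 + Z) ^+ 2 * z.
      rewrite (_ : a * z ^+ 2 * (1 + z) ^+ 2 = a * z * (1 + z) ^+ 2 * z); last ring.
      rewrite ler_wpM2r ?(ltW z0)//; apply: ler_pM => //.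
      + by rewrite mulr_ge0// ltW.
      + by rewrite ler_wpM2l// ltW.
      + by rewrite ler_pXn2r ?nnegrE//; lra.
    have t2 : c0 * z * (1 + z) ^+ 4 <= c0 * (1 + Z) ^+ 4 * z.
      rewrite mulrAC ler_wpM2r ?(ltW z0)// ler_wpM2l ?(ltW c00)//.
      by rewrite ler_pXn2r ?nnegrE//; lra.
    have : 0 <= alpha * z ^+ 4 * (1 + z) ^+ 2.
      by rewrite mulr_ge0// mulr_ge0 ?exprn_ge0// ltW.
    have : kap * (k * z) = a * Z * (1 + Z) ^+ 2 * z + c0 * (1 + Z) ^+ 4 * z.
      by rewrite mulrA kapk mulrDl.
    lra.
  - have z1 : 1 <= z by lra.
    have t1 : a * z ^+ 2 * (1 + z) ^+ 2 <= alpha / 2 * z ^+ 4 * (1 + z) ^+ 2.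
      rewrite ler_wpM2r// (_ : alpha / 2 * z ^+ 4 = alpha / 2 * z ^+ 2 * z ^+ 2).
        rewrite ler_wpM2r ?sqr_ge0//.
        have : alpha * Z <= alpha * z by rewrite ler_pM2l// ltW.
        have : alpha * z <= alpha * z ^+ 2.
          by rewrite ler_pM2l// expr2 ler_peMl// ltW.
        by lra.
      by ring.
    have t2 : c0 * z * (1 + z) ^+ 4 <= alpha / 2 * z ^+ 4 * (1 + z) ^+ 2.
      rewrite (_ : c0 * z * (1 + z) ^+ 4 = c0 * z * (1 + z) ^+ 2 * (1 + z) ^+ 2);
        last ring.
      rewrite ler_wpM2r//.
      have : (1 + z) ^+ 2 <= 4 * z ^+ 2.
        rewrite (_ : 4 * z ^+ 2 = (2 * z) ^+ 2); last ring.
        by rewrite ler_pXn2r ?nnegrE//; lra.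
      move=> /(ler_wpM2l (mulr_ge0 (ltW c00) (ltW z0))) /le_trans; apply.
      rewrite (_ : c0 * z * (4 * z ^+ 2) = alpha / 2 * z ^+ 3).
        rewrite ler_wpM2l ?divr_ge0 ?(ltW al0)//.
        by rewrite [in leRHS]exprS ler_peMl// exprn_ge0// ltW.
      by rewrite /c0; field.
    have qk : kap * (k * z) = kap * k * z by rewrite mulrA.
    rewrite (mulrDr kap) qk; lra.
set E := expR (k / (1 + z)).
have E1 : 1 <= E by rewrite -expR0 ler_expR divr_ge0 ?ltW// ltr_pwDl// ltW.
pose D := z ^+ 2 * (1 + z) ^+ 2.
pose br := (lambda - mu - alpha * z ^+ 2) - rho ^+ 2 / 2 * (a + alpha * z ^+ 2) *
  ((2 / (1 + z) + k / (1 + z) ^+ 2) / (2 * z) + (2 * z ^+ 2)^-1).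
have nz : 1 + z != 0 by rewrite gt_eqF// ltr_pwDl// ltW.
have nz' : z != 0 by rewrite gt_eqF.
have -> : lyap1 k y * ((lambda - mu - alpha * y) * y) +
    lyap2 k y / 2 * (rho ^+ 2 * ((lambda + mu + alpha * y) * y)) =
    E * (k * z / (2 * (1 + z) ^+ 2)) * br.
  by rewrite /lyap2 /lyap1 -/z -/E -/a /br yE /a; field; rewrite nz nz'.
have brle : br <= - c0 * (1 + z) ^+ 2 / z.
  have D0 : 0 < D by rewrite mulr_gt0 ?exprn_gt0// ltr_pwDl// ltW.
  have -> : - c0 * (1 + z) ^+ 2 / z = - (c0 * z * (1 + z) ^+ 4) / D.
    by rewrite /D; field; rewrite nz nz'.
  rewrite ler_pdivlMr//.
  have -> : br * D = (lambda - mu) * z ^+ 2 * (1 + z) ^+ 2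
    - alpha * z ^+ 4 * (1 + z) ^+ 2 - kap * (k * z + (1 + z) ^+ 2)
    - (kap * (2 * z * (1 + z))
       + rho ^+ 2 / 4 * alpha * z ^+ 2 * (2 * z * (1 + z) + k * z + (1 + z) ^+ 2)).
    by rewrite /br /D /kap; field; rewrite nz nz'.
  have p1 : 0 <= kap * (2 * z * (1 + z)).
    by apply: mulr_ge0; [exact: ltW|nra].
  have p2 : 0 <= rho ^+ 2 / 4 * alpha * z ^+ 2 *
      (2 * z * (1 + z) + k * z + (1 + z) ^+ 2).
    apply: mulr_ge0; first by rewrite !mulr_ge0 ?divr_ge0 ?sqr_ge0// ltW.
    have := mulr_gt0 k0 z0; nra.
  have : (lambda - mu) * z ^+ 2 * (1 + z) ^+ 2 <= a * z ^+ 2 * (1 + z) ^+ 2.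
    by rewrite ler_wpM2r ?sqr_ge0// ler_wpM2r ?sqr_ge0// /a; lra.
  lra.
have pz : 0 < k * z / (2 * (1 + z) ^+ 2).
  by apply: divr_gt0; [exact: mulr_gt0|rewrite mulr_gt0// exprn_gt0//; lra].
have Ep : 0 < E * (k * z / (2 * (1 + z) ^+ 2)) by rewrite mulr_gt0// expR_gt0.
apply: (le_trans (ler_wpM2l (ltW Ep) brle)).
have -> : E * (k * z / (2 * (1 + z) ^+ 2)) * (- c0 * (1 + z) ^+ 2 / z) =
  - (E * (k * c0 / 2)) by field; rewrite nz nz'.
by rewrite lerN2 ler_peMl// ltW// divr_gt0// mulr_gt0.
Qed.

(** * Expectations and Gaussian moments *)

Section NormalMoments.
Context {R : realType}.
Local Notation leb := (@lebesgue_measure R).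

(** The Radon-Nikodym derivative of [normal_prob] agrees almost everywhere with [normal_pdf], since
    both have the same integral over every measurable set. *)
Lemma ge0_integral_normal_prob (m s : R) (f : R -> \bar R) :
  measurable_fun setT f -> (forall x, 0 <= f x)%E ->
  (\int[normal_prob m s]_x f x = \int[leb]_x (f x * (normal_pdf m s x)%:E))%E.
Proof.
move=> mf f0.
have dom := @normal_prob_dominates R m s.
rewrite -(Radon_Nikodym_SigmaFinite.change_of_variables dom)//.
apply: ae_eq_integral => //.
- apply: emeasurable_funM => //; apply: (measurable_int leb).
  exact: Radon_Nikodym_SigmaFinite.f_integrable.
- apply: emeasurable_funM => //; apply/measurable_EFinP.
  exact: measurable_normal_pdf.
- apply: ae_eqe_mul2l; apply: integral_ae_eq => //=.
  + exact: Radon_Nikodym_SigmaFinite.f_integrable.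
  + by apply/measurable_EFinP; exact: measurable_normal_pdf.
  + by move=> E _ mE; rewrite -Radon_Nikodym_SigmaFinite.f_integral.
Qed.

(** Completing the square: e^(u x) times the density of N(0, s^2) is e^(u^2 s^2 / 2) times that of
    N(u s^2, s^2). *)
Lemma normal_prob_mgf (s u : R) : s != 0 ->
  (\int[normal_prob 0 s]_x (expR (u * x))%:E = (expR (u ^+ 2 * s ^+ 2 / 2))%:E)%E.
Proof.
move=> s0; rewrite ge0_integral_normal_prob; last 2 first.
- exact/measurable_EFinP/measurableT_comp.
- by move=> x; rewrite lee_fin expR_ge0.
transitivity (\int[leb]_x ((expR (u ^+ 2 * s ^+ 2 / 2))%:E *
    (normal_pdf (u * s ^+ 2) s x)%:E))%E.
  apply: eq_integral => x _; rewrite -!EFinM; congr EFin.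
  rewrite !normal_pdfE// /normal_fun !(mulrCA _ (normal_peak s)).
  by congr (_ * _); rewrite -!expRD; congr expR; field.
rewrite ge0_integralZl ?lee_fin ?expR_ge0//.
- by rewrite integral_normal_pdf mule1.
- by apply/measurable_EFinP; exact: measurable_normal_pdf.
- by move=> x _; rewrite lee_fin normal_pdf_ge0.
Qed.

End NormalMoments.

Section Independence.
Context {R : realType} {d : measure_display} {T : measurableType d}.
Variable P : probability T R.

Lemma bounded_integrable (f : T -> R) (M : R) :
  measurable_fun setT f -> (forall w, `|f w| <= M) ->
  P.-integrable setT (EFin \o f).
Proof.
move=> mf fM; apply: (@measurable_bounded_integrable _ T R P) => //.
  exact: le_lt_trans (probability_le1 P measurableT) (ltry _).
by exists M; split => [|x Mx w _]; [exact: num_real|exact: le_trans (fM w) (ltW _)].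
Qed.

Lemma bounded_integrableM (f g : T -> R) (M : R) :
  measurable_fun setT f -> (forall w, `|f w| <= M) ->
  P.-integrable setT (EFin \o g) -> P.-integrable setT (EFin \o (f \* g)).
Proof.
move=> mf fM ig.
have := @integrableMr _ T R P setT measurableT f (EFin \o g) mf _ ig; apply.
by exists M; split => [|x Mx w _]; [exact: num_real|exact: le_trans (fM w) (ltW _)].
Qed.

(** The joint law of (f, g) agrees with the product of the marginals on rectangles, hence
    everywhere, and Fubini splits the integral. The bound on f makes the product integrable. *)
Lemma indep_RintegralM (f g : T -> R) (M : R) :
  measurable_fun setT f -> (forall w, `|f w| <= M) ->
  measurable_fun setT g -> P.-integrable setT (EFin \o g) ->
  (forall U V : set R, measurable U -> measurable V ->
    P (f @^-1` U `&` g @^-1` V) = (P (f @^-1` U) * P (g @^-1` V))%E) ->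
  \int[P]_w (f w * g w) = (\int[P]_w f w) * (\int[P]_w g w).
Proof.
move=> mf fM mg ig ind.
pose F : {mfun T >-> R} :=
  HB.pack f (isMeasurableFun.Build _ _ _ _ _ mf).
pose G : {mfun T >-> R} :=
  HB.pack g (isMeasurableFun.Build _ _ _ _ _ mg).
have mphi : measurable_fun setT (fun w => (f w, g w)).
  exact: measurable_fun_pair.
pose H : {mfun T >-> (R * R)%type} :=
  HB.pack (fun w => (f w, g w)) (isMeasurableFun.Build _ _ _ _ _ mphi).
pose h (z : R * R) : \bar R := (z.1 * z.2)%:E.
have mh : measurable_fun setT h.
  by apply/measurable_EFinP; apply: measurable_funM.
have PE : forall A, measurable A ->
    (distribution P F \x distribution P G)%E A = pushforward P H A.
  apply: product_measure_unique => A B mA mB /=.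
  by rewrite /distribution /pushforward /= -ind//.
have iFG : P.-integrable setT (h \o (fun w => (f w, g w))).
  exact: bounded_integrableM mf fM ig.
have iH : (pushforward P H).-integrable setT h.
  exact: (@integrable_pushforward _ _ _ _ R _ mphi P setT h mh iFG measurableT).
have iPP : (distribution P F \x distribution P G)%E.-integrable setT h.
  apply/integrableP; split => //.
  have /integrableP[_] := iH; congr (_ < _)%E.
  by apply: eq_measure_integral => A mA _; first [exact: PE|exact/esym/PE].
have mE : measurable_fun setT (EFin : R -> \bar R) by exact/measurable_EFinP.
have iF : P.-integrable setT (EFin \o f) by exact: bounded_integrable mf fM.
have iF' : (distribution P F).-integrable setT (EFin : R -> \bar R).
  exact: (@integrable_pushforward _ _ _ _ R _ mf P setT _ mE iF measurableT).
have iG' : (distribution P G).-integrable setT (EFin : R -> \bar R).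
  exact: (@integrable_pushforward _ _ _ _ R _ mg P setT _ mE ig measurableT).
have EF : (\int[distribution P F]_x x%:E = \int[P]_w (f w)%:E)%E.
  exact: (@integral_pushforward _ _ _ _ R _ mf P setT _ mE iF measurableT).
have EG : (\int[distribution P G]_x x%:E = \int[P]_w (g w)%:E)%E.
  exact: (@integral_pushforward _ _ _ _ R _ mg P setT _ mE ig measurableT).
rewrite /Rintegral -fineM ?integrable_fin_num//; congr fine.
transitivity (\int[pushforward P H]_z h z)%E.
  by rewrite (@integral_pushforward _ _ _ _ R _ mphi P setT h mh iFG measurableT).
transitivity (\int[(distribution P F \x distribution P G)%E]_z h z)%E.
  by apply: eq_measure_integral => A mA _; first [exact: PE|exact/esym/PE].
rewrite -integral12_prod_meas1// /fubini_F.
transitivity (\int[distribution P F]_x (x%:E * \int[P]_w (g w)%:E))%E.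
  by apply: eq_integral => x _; rewrite -EG -integralZl.
rewrite -(fineK (integrable_fin_num measurableT ig)) integralZr//.
by rewrite EF.
Qed.
End Independence.

Section RealExpectation.
Context {R : realType} {d : measure_display} {T : measurableType d}.
Variable P : probability T R.
Implicit Types (f g : T -> R) (A : set T).

Lemma integrableDr f g : P.-integrable setT (EFin \o f) ->
  P.-integrable setT (EFin \o g) ->
  P.-integrable setT (EFin \o (fun w => f w + g w)).
Proof. exact: integrableD. Qed.

Lemma integrableZl_real (c : R) f : P.-integrable setT (EFin \o f) ->
  P.-integrable setT (EFin \o (fun w => c * f w)).
Proof. exact: integrableZl. Qed.

Lemma integrable_sumr (n : nat) (f : nat -> T -> R) :
  (forall i, (i < n)%N -> P.-integrable setT (EFin \o f i)) ->
  P.-integrable setT (EFin \o (fun w => \sum_(i < n) f i w)).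
Proof.
elim: n => [|n IH] H.
  by under eq_fun do rewrite big_ord0; exact: integrable0.
have -> : (fun w => \sum_(i < n.+1) f i w) = (fun w => \sum_(i < n) f i w + f n w).
  by apply/funext => w; rewrite big_ord_recr.
by apply: integrableDr; [apply: IH => i ni; apply/H/ltnW|exact: H].
Qed.

Lemma Rintegral_sumr (n : nat) (f : nat -> T -> R) :
  (forall i, (i < n)%N -> P.-integrable setT (EFin \o f i)) ->
  \int[P]_w (\sum_(i < n) f i w) = \sum_(i < n) \int[P]_w f i w.
Proof.
elim: n => [|n IH] H.
  rewrite big_ord0 (_ : (fun w => _) = cst 0) ?Rintegral_cst ?mul0r//.
  by apply/funext => w; rewrite big_ord0.
rewrite big_ord_recr /= -IH => [|i ni]; last exact/H/ltnW.
rewrite -RintegralD//; last exact: H.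
  by apply: eq_Rintegral => w _; rewrite big_ord_recr.
by apply: integrable_sumr => i ni; exact/H/ltnW.
Qed.

Lemma Rintegral_Pcst (c : R) : \int[P]_w c = c.
Proof.
rewrite Rintegral_cst// -[RHS]mulr1; congr (_ * _).
exact: (congr1 fine (probability_setT P)).
Qed.

Lemma fin_num_prob A : measurable A -> P A \is a fin_num.
Proof. by move=> mA; exact: fin_num_measure. Qed.

Lemma Rintegral_indicP A : measurable A -> \int[P]_w \1_A w = fine (P A).
Proof. by move=> mA; rewrite /Rintegral integral_indic// setIT. Qed.

Lemma markov_Rintegral A f (c : R) : measurable A ->
  P.-integrable setT (EFin \o f) -> (forall w, 0 <= f w) ->
  (forall w, A w -> c <= f w) -> c * fine (P A) <= \int[P]_w f w.
Proof.
move=> mA intf f0 cf; rewrite -Rintegral_indicP// -RintegralZl//; last first.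
  exact: integrable_indic.
apply: le_Rintegral => //.
  by apply: integrableZl_real; exact: integrable_indic.
move=> w _; rewrite indicE; case: (boolP (w \in A)) => [|_].
  by rewrite inE mulr1; exact: cf.
by rewrite mulr0.
Qed.

Lemma fine_prob_le A1 A2 : measurable A1 -> measurable A2 -> A1 `<=` A2 ->
  fine (P A1) <= fine (P A2).
Proof.
by move=> m1 m2 A12; rewrite fine_le ?fin_num_prob//; apply: le_measure; rewrite ?inE.
Qed.

Lemma fine_probU A1 A2 : measurable A1 -> measurable A2 ->
  fine (P (A1 `|` A2)) <= fine (P A1) + fine (P A2).
Proof.
move=> m1 m2; rewrite -fineD ?fin_num_prob// fine_le ?fin_numD ?fin_num_prob//.
  exact: measurableU.
exact: measureU2.
Qed.

End RealExpectation.

(** * Elementary inequalities for the hyperbolic cosine *)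

Section Dcosh.
Context {R : realType}.
Implicit Types x h : R.

(** Twice the hyperbolic cosine. Being even, it involves no odd moments, and its expectation is read
    off the moment generating function. *)
Definition dcosh x := expR x + expR (- x).

Lemma dcosh_ge2 x : 2 <= dcosh x.
Proof. by rewrite /dcosh; have := expR_ge1Dx x; have := expR_ge1Dx (- x); lra. Qed.

Lemma dcosh_norm x : dcosh `|x| = dcosh x.
Proof. by rewrite /dcosh; case: (ger0P x) => // _; rewrite opprK addrC. Qed.

Lemma dcosh_le x h : `|x| <= `|h| -> dcosh x <= dcosh h.
Proof.
rewrite -(dcosh_norm x) -(dcosh_norm h); move: (normr_ge0 x) (normr_ge0 h).
move: `|x| `|h| => a b a0 b0 ab; rewrite /dcosh.
have e1 : expR a * expR (- a) = 1 by rewrite -expRD subrr expR0.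
have e2 : expR b * expR (- b) = 1 by rewrite -expRD subrr expR0.
have : expR a <= expR b by rewrite ler_expR.
have : expR (- b) * expR (- a) <= 1.
  by rewrite -expRD -expR0 ler_expR; lra.
move=> p q.
(* This product of two nonnegative factors equals dcosh b - dcosh a. *)
have : 0 <= (expR b - expR a) * (1 - expR (- b) * expR (- a)).
  by rewrite mulr_ge0 ?subr_ge0.
have -> : (expR b - expR a) * (1 - expR (- b) * expR (- a)) =
  expR b - expR a - (expR b * expR (- b)) * expR (- a)
  + (expR a * expR (- a)) * expR (- b) by ring.
by rewrite e1 e2; lra.
Qed.

Let is_derive_dcosh x : is_derive x 1 dcosh (expR x - expR (- x)).
Proof. by apply: is_derive_eq; rewrite mulrN1. Qed.

Let is_derive_dsinh x :
  is_derive x 1 (fun u => expR u - expR (- u)) (dcosh x).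
Proof. by apply: is_derive_eq; rewrite /dcosh mulrN1 opprK. Qed.

Let dcosh0 : dcosh 0 = 2.
Proof. by rewrite /dcosh oppr0 expR0. Qed.

Let dsinh0 : expR (0 : R) - expR (- 0) = 0.
Proof. by rewrite oppr0 subrr. Qed.

Lemma dcosh_ge x : 2 + x ^+ 2 <= dcosh x.
Proof.
have := @taylor2_le R (fun u => - dcosh u) (fun u => - (expR u - expR (- u)))
  (fun u => - dcosh u) 0 x (- 2)
  (fun u _ => is_deriveN (is_derive_dcosh u))
  (fun u _ => is_deriveN (is_derive_dsinh u)).
rewrite add0r dcosh0 dsinh0.
have H u : `|u - 0| <= `|x| -> - dcosh u <= - 2 by rewrite lerN2 dcosh_ge2.
by move=> /(_ H); rewrite oppr0 mul0r; lra.
Qed.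

Let dcosh_le2 x M : (forall u, `|u| <= `|x| -> dcosh u <= M) ->
  dcosh x <= 2 + M / 2 * x ^+ 2.
Proof.
move=> H; have := @taylor2_le R dcosh (fun u => expR u - expR (- u))
  dcosh 0 x M (fun u _ => is_derive_dcosh u) (fun u _ => is_derive_dsinh u).
rewrite add0r dcosh0 dsinh0 mul0r addr0; apply=> u.
by rewrite subr0; exact: H.
Qed.

(** The second-order bound is used twice: as [dcosh] is its own second derivative, the first use
    bounds that derivative by 2 + dcosh x x^2 / 2 in the second. *)
Lemma dcosh_le4 x : dcosh x <= 2 + x ^+ 2 + x ^+ 4 / 4 * dcosh x.
Proof.
have H1 h : dcosh h <= 2 + dcosh h / 2 * h ^+ 2.
  by apply: dcosh_le2 => u; exact: dcosh_le.
apply: (le_trans (@dcosh_le2 x (2 + dcosh x / 2 * x ^+ 2) _)) => [u ux|]; last lra.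
apply: (le_trans (H1 u)); rewrite lerD2l.
apply: ler_pM; rewrite ?sqr_ge0 ?divr_ge0//.
- by have := dcosh_ge2 u; lra.
- by have := dcosh_le ux; lra.
- by rewrite -(real_normK (num_real u)) -(real_normK (num_real x)) ler_pXn2r ?nnegrE.
Qed.

Lemma expR_le2 x : 0 <= x -> expR x <= 1 + x + x ^+ 2 / 2 * expR x.
Proof.
move=> x0; have := @taylor2_le R expR expR expR 0 x (expR x)
  (fun u _ => is_derive_expR u) (fun u _ => is_derive_expR u).
have H u : `|u - 0| <= `|x| -> expR u <= expR x.
  by rewrite subr0 (ger0_norm x0) ler_expR; apply: le_trans; exact: ler_norm.
by move=> /(_ H); rewrite add0r expR0; lra.
Qed.

End Dcosh.

Lemma norm_le_mulr_eq0 (R : realFieldType) (x C : R) :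
  (forall e, 0 < e <= 1 -> `|x| <= e * C) -> x = 0.
Proof.
move=> H; apply/normr0_eq0/eqP; apply: contraT => x0.
have x_gt0 : 0 < `|x| by rewrite lt_neqAle eq_sym x0 normr_ge0.
have C0 : 0 <= C by have := H 1; rewrite ltr01 lexx mul1r => /(_ isT); lra.
have D0 : 0 < `|x| + C + 1 by lra.
have := H (`|x| / (`|x| + C + 1)).
rewrite divr_gt0// ler_pdivrMr// mul1r => /(_ ltac:(lra)).
rewrite mulrAC ler_pdivlMr// ler_pM2l// leNgt => /negP[]; lra.
Qed.

(** * Moments of a centred Gaussian variable of variance dt, without differentiating under the
    integral *)

Section GaussianMoments.
Context {R : realType} {d : measure_display} {T : measurableType d}.
Variables (P : probability T R) (D : T -> R) (dt : R).
Hypothesis dt0 : 0 < dt.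
Hypothesis mD : measurable_fun setT D.
Hypothesis lawD : forall U : set R, measurable U ->
  P (D @^-1` U) = normal_prob 0 (Num.sqrt dt) U.

Let mgf (u : R) :
  (\int[P]_w (expR (u * D w))%:E = (expR (u ^+ 2 * dt / 2))%:E)%E.
Proof.
have mg : measurable_fun [set: measurableTypeR R] (fun x => (expR (u * x))%:E).
  by apply/measurable_EFinP/measurableT_comp.
have mD' : measurable_fun [set: T] (D : T -> measurableTypeR R) by exact: mD.
have := @ge0_integral_pushforward _ _ _ _ R _ mD' P setT
  (fun x => (expR (u * x))%:E) measurableT mg.
rewrite preimage_setT => <-; last by move=> x _; rewrite lee_fin expR_ge0.
rewrite -[dt in RHS](@sqr_sqrtr _ dt) ?(ltW dt0)//.
apply: etrans (normal_prob_mgf u _); last by rewrite gt_eqF// sqrtr_gt0.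
by apply: eq_measure_integral => U mU _; exact: lawD.
Qed.

Lemma integrable_expRM u : P.-integrable setT (EFin \o (fun w => expR (u * D w))).
Proof.
apply/integrableP; split.
  by apply/measurable_EFinP; apply: measurableT_comp => //; exact: measurable_funM.
under eq_integral do rewrite /= ger0_norm ?expR_ge0//.
by rewrite mgf ltry.
Qed.

Lemma Rintegral_expRM u : \int[P]_w expR (u * D w) = expR (u ^+ 2 * dt / 2).
Proof. by rewrite /Rintegral mgf. Qed.

Lemma integrable_dcoshM u : P.-integrable setT (EFin \o (fun w => dcosh (u * D w))).
Proof.
have := integrableD measurableT (integrable_expRM u) (integrable_expRM (- u)).
by apply: eq_integrable => // w _; rewrite /= /dcosh mulNr EFinD.
Qed.

Lemma Rintegral_dcoshM u : \int[P]_w dcosh (u * D w) = 2 * expR (u ^+ 2 * dt / 2).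
Proof.
transitivity (\int[P]_w (expR (u * D w) + expR (- u * D w))).
  by apply: eq_Rintegral => w _; rewrite /dcosh mulNr.
rewrite RintegralD ?Rintegral_expRM ?sqrrN//; try exact: integrable_expRM.
by rewrite mulr_natl mulr2n.
Qed.

Let integrable_le_dcosh (g : R -> R) (c u : R) :
  measurable_fun [set: R] g -> (forall x, `|g x| <= c * dcosh (u * x)) ->
  P.-integrable setT (EFin \o (g \o D)).
Proof.
move=> mg gD.
apply: (@le_integrable _ T R P setT measurableT _
  (fun w => c%:E * (dcosh (u * D w))%:E)%E).
- by apply/measurable_EFinP; exact: measurableT_comp.
- move=> w _; rewrite -EFinM /= lee_fin (le_trans (gD (D w)))//; exact: ler_norm.
- exact: (integrableZl measurableT c (integrable_dcoshM u)).
Qed.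

Lemma integrable_increment : P.-integrable setT (EFin \o D).
Proof.
apply: (@integrable_le_dcosh id 1 1) => [|x]; first exact: measurable_id.
have := dcosh_ge x; rewrite !mul1r => xx; apply: le_trans xx.
have := sqr_ge0 x; have := sqr_ge0 (`|x| - 1).
by rewrite sqrrB1 real_normK ?num_real// -mulr_natr; lra.
Qed.

Lemma integrable_increment2 : P.-integrable setT (EFin \o (fun w => D w ^+ 2)).
Proof.
apply: (@integrable_le_dcosh (fun x => x ^+ 2) 1 1) => [|x].
  exact: measurable_funX.
by have := dcosh_ge x; rewrite !mul1r ger0_norm ?sqr_ge0//; lra.
Qed.

Let dcosh2 (x : R) : dcosh x ^+ 2 = dcosh (2 * x) + 2.
Proof.
rewrite /dcosh (_ : 2 * x = x + x); last by ring.
have e1 : expR x * expR (- x) = 1 by rewrite -expRD subrr expR0.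
by rewrite opprD !expRD; lra.
Qed.

Let expr4_dcosh (x : R) : x ^+ 4 <= 2 * dcosh (2 * x).
Proof.
have : x ^+ 4 <= dcosh x ^+ 2.
  rewrite (_ : x ^+ 4 = (x ^+ 2) ^+ 2); last by rewrite -exprM.
  by rewrite ler_pXn2r ?nnegrE ?sqr_ge0//; have := dcosh_ge x; have := sqr_ge0 x; lra.
by rewrite dcosh2; have := dcosh_ge2 (2 * x); lra.
Qed.

Lemma integrable_increment4 : P.-integrable setT (EFin \o (fun w => D w ^+ 4)).
Proof.
apply: (@integrable_le_dcosh (fun x => x ^+ 4) 2 2) => [|x].
  exact: measurable_funX.
by rewrite ger0_norm ?exprn_even_ge0.
Qed.

Let integrable_cst (c : R) : P.-integrable setT (EFin \o (fun _ => c)).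
Proof. exact: finite_measure_integrable_cst. Qed.

(** Integrating 1 + u D <= e^(u D) for u = e and u = - e gives e |E D| <= e^(e^2 dt / 2) - 1, which
    is O(e^2); dividing by e leaves a bound that tends to 0. *)
Lemma Rintegral_increment : \int[P]_w D w = 0.
Proof.
apply: (@norm_le_mulr_eq0 _ _ (dt / 2 * expR (dt / 2))) => e /andP[e0 e1].
have bnd u : u ^+ 2 = e ^+ 2 ->
    u * (\int[P]_w D w) <= e ^+ 2 * (dt / 2 * expR (dt / 2)).
  move=> ue; rewrite -RintegralZl//; last exact: integrable_increment.
  have iuD : P.-integrable setT (EFin \o (fun w => u * D w)).
    exact: (integrableZl measurableT u integrable_increment).
  have : \int[P]_w (1 + u * D w) <= \int[P]_w expR (u * D w).
    apply: le_Rintegral => //.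
    - exact: (integrableD measurableT (integrable_cst 1) iuD).
    - exact: integrable_expRM.
    - by move=> w _; exact: expR_ge1Dx.
  rewrite RintegralD// Rintegral_Pcst Rintegral_expRM ue.
  set v := e ^+ 2 * dt / 2 => H.
  have v0 : 0 <= v by rewrite divr_ge0// mulr_ge0 ?sqr_ge0// ltW.
  have : expR v - 1 <= v * expR v.
    have ev : expR (- v) * expR v = 1 by rewrite -expRD addNr expR0.
    by have := expR_ge1Dx (- v) => /(ler_wpM2r (expR_ge0 v)); rewrite ev; lra.
  have vd : v <= dt / 2.
    by rewrite /v -mulrA ler_piMl ?divr_ge0 ?(ltW dt0)// exprn_ile1// ltW.
  have : v * expR v <= v * expR (dt / 2) by rewrite ler_wpM2l// ler_expR.
  have -> : e ^+ 2 * (dt / 2 * expR (dt / 2)) = v * expR (dt / 2).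
    by rewrite /v; ring.
  by lra.
have := bnd e erefl; have := bnd (- e) (sqrrN e).
rewrite expr2 mulNr -!mulrA -mulrN !ler_pM2l// => p q.
by rewrite ler_norml; lra.
Qed.

(* As u -> 0, the second moment is squeezed between difference quotients of the
   moment generating function, by
   2 + x^2 <= dcosh x <= 2 + x^2 + x^4 / 4 * dcosh x. *)
Lemma Rintegral_increment2 : \int[P]_w D w ^+ 2 = dt.
Proof.
(* The product formula dcosh (2 x) dcosh x = dcosh (3 x) + dcosh x dominates the integrand by a
   multiple of dcosh (3 D). *)
have id4 : P.-integrable setT (EFin \o (fun w => D w ^+ 4 / 4 * dcosh (D w))).
  apply: (@integrable_le_dcosh (fun x => x ^+ 4 / 4 * dcosh x) 2 3) => [|x].
    apply: measurable_funM; first by apply: measurable_funM => //; exact: measurable_funX.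
    apply: measurable_funD; first exact: measurable_expR.
    by apply: measurableT_comp; [exact: measurable_expR|exact: measurable_funN].
  rewrite ger0_norm; last first.
    by rewrite mulr_ge0 ?divr_ge0 ?exprn_even_ge0//; have := dcosh_ge2 x; lra.
  have c2 := dcosh_ge2 x; have c4 : 0 <= dcosh x / 4 by lra.
  have /(ler_wpM2r c4) := expr4_dcosh x.
  have : dcosh (2 * x) * dcosh x = dcosh (3 * x) + dcosh x.
    rewrite /dcosh mulrDl !mulrDr -!expRD.
    have -> : 2 * x + x = 3 * x by ring.
    have -> : 2 * x + - x = x by ring.
    have -> : - (2 * x) + x = - x by ring.
    have -> : - (2 * x) + - x = - (3 * x) by ring.
    by ring.
  have : dcosh x <= dcosh (3 * x).
    by apply: dcosh_le; rewrite normrM ler_peMl// ger0_norm; lra.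
  by lra.
pose C4 := \int[P]_w (D w ^+ 4 / 4 * dcosh (D w)).
have C40 : 0 <= C4.
  apply: Rintegral_ge0 => w _; rewrite mulr_ge0 ?divr_ge0 ?exprn_even_ge0//.
  by have := dcosh_ge2 (D w); lra.
pose m2 := \int[P]_w (D w ^+ 2); apply: subr0_eq; rewrite -/m2.
apply: (@norm_le_mulr_eq0 _ _ (C4 + dt ^+ 2 / 4 * expR (dt / 2))) => u /andP[u0 u1].
have i2 := integrable_increment2.
have iu2 : P.-integrable setT (EFin \o (fun w => u ^+ 2 * D w ^+ 2)).
  exact: (integrableZl measurableT (u ^+ 2) i2).
have i22 : P.-integrable setT (EFin \o (fun w => 2 + u ^+ 2 * D w ^+ 2)).
  exact: (integrableD measurableT (integrable_cst 2) iu2).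
have iu4 : P.-integrable setT
    (EFin \o (fun w => u ^+ 4 * (D w ^+ 4 / 4 * dcosh (D w)))).
  exact: (integrableZl measurableT (u ^+ 4) id4).
have E2 : \int[P]_w (2 + u ^+ 2 * D w ^+ 2) = 2 + u ^+ 2 * m2.
  by rewrite RintegralD// Rintegral_Pcst RintegralZl.
have lo : 2 + u ^+ 2 * m2 <= 2 * expR (u ^+ 2 * dt / 2).
  rewrite -E2 -Rintegral_dcoshM; apply: le_Rintegral => //.
    exact: integrable_dcoshM.
  by move=> w _; rewrite -exprMn; exact: dcosh_ge.
have hi : 2 * expR (u ^+ 2 * dt / 2) <= 2 + u ^+ 2 * m2 + u ^+ 4 * C4.
  rewrite -E2 -Rintegral_dcoshM /C4 -RintegralZl// -RintegralD//.
  apply: le_Rintegral => //; first exact: integrable_dcoshM.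
    exact: (integrableD measurableT i22 iu4).
  move=> w _; apply: (le_trans (dcosh_le4 _)).
  (* Since 0 < u <= 1, this makes the remainder constant [C4] independent of u. *)
  have dm : dcosh (u * D w) <= dcosh (D w).
    by rewrite dcosh_le// normrM ler_piMl// ger0_norm// ltW.
  have k0 : 0 <= u ^+ 4 * D w ^+ 4 / 4.
    by apply: divr_ge0 => //; apply: mulr_ge0; exact: exprn_even_ge0.
  by have := ler_wpM2l k0 dm; rewrite !exprMn; lra.
set v := u ^+ 2 * dt / 2 in lo hi.
have v0 : 0 <= v by rewrite divr_ge0// mulr_ge0 ?sqr_ge0// ltW.
have := expR_ge1Dx v => e1; have e2 := expR_le2 v0.
have u20 : 0 < u ^+ 2 by rewrite exprn_gt0.
have uu : u ^+ 2 <= u by rewrite expr2 ler_piMl// ltW.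
have vE : 2 * v = u ^+ 2 * dt by rewrite /v; lra.
have low : dt - u ^+ 2 * C4 <= m2.
  rewrite -(ler_pM2l u20) mulrBr mulrA -exprD; lra.
have vd : v <= dt / 2.
  by rewrite /v -mulrA ler_piMl ?divr_ge0 ?(ltW dt0)// exprn_ile1// ltW.
have upp : m2 <= dt + u ^+ 2 * (dt ^+ 2 / 4 * expR (dt / 2)).
  rewrite -(ler_pM2l u20) mulrDr.
  have : v ^+ 2 * expR v <= v ^+ 2 * expR (dt / 2).
    by rewrite ler_wpM2l ?sqr_ge0// ler_expR.
  have : v ^+ 2 * expR (dt / 2) =
      u ^+ 2 * (u ^+ 2 * (dt ^+ 2 / 4 * expR (dt / 2))) by rewrite /v; field.
  lra.
have K0 : 0 <= dt ^+ 2 / 4 * expR (dt / 2).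
  by rewrite mulr_ge0 ?divr_ge0 ?sqr_ge0 ?expR_ge0.
have := ler_wpM2r C40 uu; have := ler_wpM2r K0 uu.
have := mulr_ge0 (ltW u0) C40; have := mulr_ge0 (ltW u0) K0.
by rewrite ler_norml mulrDr => *; apply/andP; split; lra.
Qed.

(** D^4 <= (dcosh D - 2)^2 = dcosh (2 D) + 6 - 4 dcosh D, whose expectation is 2 e^(2 dt) + 6 - 8
    e^(dt / 2). The terms of order 0 and 1 in dt cancel, which leaves O(dt^2). *)
Lemma Rintegral_increment4 : dt <= 1 ->
  \int[P]_w D w ^+ 4 <= 4 * expR 2 * dt ^+ 2.
Proof.
move=> dt1.
apply: (@le_trans _ _ (\int[P]_w (dcosh (2 * D w) + 6 - 4 * dcosh (1 * D w)))).
  apply: le_Rintegral => //; first exact: integrable_increment4.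
    exact: (integrableB measurableT
      (integrableD measurableT (integrable_dcoshM 2) (integrable_cst 6))
      (integrableZl measurableT 4 (integrable_dcoshM 1))).
  move=> w _; rewrite mul1r.
  have -> : D w ^+ 4 = (D w ^+ 2) ^+ 2 by rewrite -exprM.
  have := dcosh_ge (D w) => c2; have := sqr_ge0 (D w) => s2.
  have : (D w ^+ 2) ^+ 2 <= (dcosh (D w) - 2) ^+ 2.
    by rewrite ler_pXn2r ?nnegrE//; lra.
  by rewrite [X in _ <= X -> _]sqrrB dcosh2; lra.
rewrite RintegralB//; last first.
- exact: (integrableZl measurableT 4 (integrable_dcoshM 1)).
- exact: (integrableD measurableT (integrable_dcoshM 2) (integrable_cst 6)).
rewrite RintegralD//; last exact: integrable_dcoshM.
rewrite RintegralZl//; last exact: integrable_dcoshM.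
rewrite !Rintegral_dcoshM Rintegral_Pcst.
have := expR_ge1Dx (1 ^+ 2 * dt / 2).
have -> : 2 ^+ 2 * dt / 2 = 2 * dt by field.
have t0 : 0 <= 2 * dt by rewrite mulr_ge0// ltW.
have := expR_le2 t0.
have : (2 * dt) ^+ 2 / 2 * expR (2 * dt) <= (2 * dt) ^+ 2 / 2 * expR 2.
  by rewrite ler_wpM2l ?divr_ge0 ?sqr_ge0// ler_expR; lra.
by rewrite expr1n; lra.
Qed.

End GaussianMoments.

(** * Brownian increments and Lenglart's inequality *)

Section MeasurableWrt.
Context {R : realType} {d : measure_display} {T : measurableType d}.
Variable G : set (set T).
Hypothesis sG : sigma_algebra setT G.

(** Passing to the type generated by G makes the closure properties of [measurable_fun] available
    for [measurable_wrt]. *)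
Lemma measurable_wrtP (f : T -> R) :
  measurable_wrt G f <-> measurable_fun setT (f : g_sigma_algebraType G -> R).
Proof.
split=> [fG _ U mU|mf U [V mV <-]].
  have : G (setT `&` f @^-1` U) by apply: fG; exists U.
  by rewrite /measurable/=; exact: sub_sigma_algebra.
by have := mf measurableT V mV; rewrite /measurable/= sigma_algebra_id.
Qed.

End MeasurableWrt.

Section Stopping.
Context {R : realType}.

(** The indicators decrease, so they equal 1 up to an index tau and the sum telescopes to the value
    stopped at tau. It serves below for the squared martingale, for its quadratic variation and for
    V along the Euler sum. *)
Lemma stopped_sum (a : nat -> bool) (x : nat -> R) (n : nat) :
  (forall k, a k.+1 -> a k) ->
  exists tau, [/\ (tau <= n)%N, forall k, (k < tau)%N -> a k,
    (tau < n)%N -> ~~ a tau &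
    \sum_(k < n) (a k)%:R * (x k.+1 - x k) = x tau - x 0].
Proof.
move=> adec; elim: n => [|n [tau [taun atau ntau E]]].
  by exists 0%N; split => //; rewrite big_ord0 subrr.
have adecn j k : (j <= k)%N -> a k -> a j.
  move=> /subnK <-; elim: (k - j)%N => [//|i IH].
  by rewrite addSn => /adec.
rewrite big_ord_recr/= E.
have [tn|nt] := ltnP tau n.
  exists tau; split => //; first exact: leqW.
    by move=> _; exact: ntau.
  have /negbTE -> : ~~ a n by apply: contra (ntau tn); apply/adecn/ltnW.
  by rewrite mul0r addr0.
have {nt taun}taun : tau = n by apply/eqP; rewrite eqn_leq taun.
rewrite taun in atau E *.
have [an|an] := boolP (a n).
  exists n.+1; split => //; last by rewrite mul1r; ring.
    by move=> k; rewrite ltnS => kn; exact: adecn an.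
  by rewrite ltnn.
by exists n; split => //; rewrite mul0r addr0.
Qed.

End Stopping.

Section Brownian.
Context {R : realType} {d : measure_display} {T : measurableType d}.
Variables (P : probability T R) (F : R -> set (set T)) (B : R -> T -> R).
Hypotheses (hF : filtration F) (hB : brownian_motion P F B).

Lemma wrt_measurable (s : R) (f : T -> R) : 0 <= s -> measurable_wrt (F s) f -> measurable_fun setT f.
Proof. by move=> s0 mf _ U mU; apply: (filtration_sub hF s0); apply: mf; exists U. Qed.

Lemma wrt_mono (s t : R) (f : T -> R) : 0 <= s -> s <= t ->
  measurable_wrt (F s) f -> measurable_wrt (F t) f.
Proof. by move=> s0 st mf U /mf; exact: (filtration_mono hF s0 st). Qed.

Lemma measurable_brownian (t : R) : 0 <= t -> measurable_fun setT (B t).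
Proof. by move=> t0; apply: (wrt_measurable t0); exact: brownian_adapted hB _ t0. Qed.

Section Increment.
Variables (s t : R) (f : T -> R) (M : R).
Hypotheses (s0 : 0 <= s) (st : s < t).
Hypotheses (mf : measurable_wrt (F s) f) (fM : forall w, `|f w| <= M).
Let D w := B t w - B s w.

Let dt0 : 0 < t - s. Proof. by rewrite subr_gt0. Qed.

Lemma measurable_increment : measurable_fun setT D.
Proof.
by apply: measurable_funB; apply: measurable_brownian => //; apply: le_trans (ltW st).
Qed.

Let law (U : set R) : measurable U ->
  P (D @^-1` U) = normal_prob 0 (Num.sqrt (t - s)) U.
Proof. exact: (brownian_normal hB s0 st). Qed.

Let mfT : measurable_fun setT f. Proof. exact: wrt_measurable mf. Qed.

Let iD1 := integrable_increment dt0 measurable_increment law.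
Let iD2 := integrable_increment2 dt0 measurable_increment law.
Let iD4 := integrable_increment4 dt0 measurable_increment law.

Lemma integrable_mul_increment :
  P.-integrable setT (EFin \o (fun w => f w * D w)).
Proof. exact: bounded_integrableM mfT fM iD1. Qed.

Lemma integrable_mul_increment2 :
  P.-integrable setT (EFin \o (fun w => f w * D w ^+ 2)).
Proof. exact: bounded_integrableM mfT fM iD2. Qed.

Lemma integrable_mul_increment4 :
  P.-integrable setT (EFin \o (fun w => f w * D w ^+ 4)).
Proof. exact: bounded_integrableM mfT fM iD4. Qed.

Let indep (g : R -> R) (U V : set R) : measurable_fun [set: R] g ->
  measurable U -> measurable V ->
  P (f @^-1` U `&` (g \o D) @^-1` V)
  = (P (f @^-1` U) * P ((g \o D) @^-1` V))%E.
Proof.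
move=> mg mU mV; rewrite comp_preimage.
have FU : F s (f @^-1` U) by rewrite -[X in F s X]setTI; apply: mf; exists U.
have mgV : measurable (g @^-1` V) by rewrite -[X in measurable X]setTI; exact: mg.
exact: (brownian_indep hB s0 st FU mgV).
Qed.

Lemma Rintegral_mul_increment : \int[P]_w (f w * D w) = 0.
Proof.
rewrite (indep_RintegralM mfT fM measurable_increment iD1).
  by rewrite (Rintegral_increment dt0 measurable_increment law) mulr0.
by move=> U V; apply: (@indep id); exact: measurable_id.
Qed.

Lemma Rintegral_mul_increment2 :
  \int[P]_w (f w * D w ^+ 2) = (\int[P]_w f w) * (t - s).
Proof.
have mD2 : measurable_fun setT (fun w => D w ^+ 2).
  exact: measurable_funX measurable_increment.
rewrite (indep_RintegralM mfT fM mD2 iD2).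
  by rewrite (Rintegral_increment2 dt0 measurable_increment law).
by move=> U V; apply: (@indep (fun x => x ^+ 2)); exact: measurable_funX.
Qed.

Lemma Rintegral_mul_increment4 : t - s <= 1 ->
  \int[P]_w (f w * D w ^+ 4) <= M * (4 * expR 2 * (t - s) ^+ 2).
Proof.
move=> ts1; have M0 : 0 <= M by exact: le_trans (fM point).
apply: (@le_trans _ _ (\int[P]_w (M * D w ^+ 4))).
  apply: le_Rintegral => //; first exact: integrable_mul_increment4.
    exact: integrableZl_real iD4.
  move=> w _; rewrite ler_wpM2r ?exprn_even_ge0//.
  exact: le_trans (ler_norm _) (fM w).
rewrite RintegralZl// ler_wpM2l//.
exact: Rintegral_increment4 dt0 measurable_increment law ts1.
Qed.

End Increment.
End Brownian.

Section MeasurableBool.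
Context {R : realType} {d : measure_display} {T : measurableType d}.

Lemma measurable_natr_bool (b : T -> bool) : measurable_fun setT b ->
  measurable_fun setT (fun w => (b w)%:R : R).
Proof.
move=> mb; have -> : (fun w => (b w)%:R : R) = (fun w => if b w then 1 else 0).
  by apply/funext => w; case: (b w).
by apply: measurable_fun_ifT.
Qed.

Lemma measurable_true_set (b : T -> bool) : measurable_fun setT b ->
  measurable [set w | b w].
Proof. by move=> mb; rewrite -[X in measurable X]setTI; exact: (mb measurableT [set true]). Qed.

End MeasurableBool.

Section Lenglart.
Context {R : realType} {d : measure_display} {T : measurableType d}.
Variables (P : probability T R) (F : R -> set (set T)) (B : R -> T -> R).
Hypotheses (hF : filtration F) (hB : brownian_motion P F B).
Variables (u : nat -> R) (N : nat) (xi : nat -> T -> R) (C : nat -> R).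
Hypotheses (u0 : 0 <= u 0%N) (umono : forall i, u i < u i.+1).
Hypothesis mxi : forall i, measurable_wrt (F (u i)) (xi i).
Hypothesis xiC : forall i w, `|xi i w| <= C i.

Let M k w := \sum_(i < k) xi i w * (B (u i.+1) w - B (u i) w).
Let Q k w := \sum_(i < k) xi i w ^+ 2 * (u i.+1 - u i).

Let ule i j : (i <= j)%N -> u i <= u j.
Proof.
move=> /subnK <-; elim: (j - i)%N => [|k IH]; first by rewrite add0n.
by rewrite addSn (le_trans IH)// ltW.
Qed.

Let u_ge0 i : 0 <= u i. Proof. by rewrite (le_trans u0)// ule. Qed.

Local Notation FT k := (g_sigma_algebraType (F (u k))).

Let sF k := filtration_sigma hF (u_ge0 k).

Let mono_FT i k (f : T -> R) : (i <= k)%N -> measurable_wrt (F (u i)) f ->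
  measurable_fun setT (f : FT k -> R).
Proof.
move=> ik mf; apply/(measurable_wrtP (sF k)).
exact: (wrt_mono hF (u_ge0 i) (ule ik) mf).
Qed.

Let mM i k : (i <= k)%N -> measurable_fun setT (M i : FT k -> R).
Proof.
move=> ik; apply: measurable_sum => j; apply: measurable_funM.
  by apply: (@mono_FT j); [exact: leq_trans (ltnW _) ik|exact: mxi].
apply: measurable_funB; first by apply: (@mono_FT j.+1);
  [exact: leq_trans ik|exact: (brownian_adapted hB (u_ge0 _))].
by apply: (@mono_FT j);
  [exact: leq_trans (ltnW _) ik|exact: (brownian_adapted hB (u_ge0 _))].
Qed.

Let mQ i k : (i <= k)%N -> measurable_fun setT (Q i.+1 : FT k -> R).
Proof.
move=> ik; apply: measurable_sum => j; apply: measurable_funM => //.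
apply: measurable_funX; apply: (@mono_FT j); last exact: mxi.
by rewrite (leq_trans _ ik)// -ltnS.
Qed.

Let wrtT k (f : T -> R) : measurable_fun setT (f : FT k -> R) -> measurable_fun setT f.
Proof. by move=> /(measurable_wrtP (sF k)); exact: (wrt_measurable hF (u_ge0 k)). Qed.

Let Qle i j w : (i <= j)%N -> Q i w <= Q j w.
Proof.
move=> /subnK <-; elim: (j - i)%N => [|k IH]; first by rewrite add0n.
rewrite addSn (le_trans IH)// /Q big_ord_recr/= lerDl.
by rewrite mulr_ge0 ?sqr_ge0// subr_ge0 ltW.
Qed.

(* The martingale is stopped when it reaches level e or before its quadratic
   variation exceeds theta; the stopped one has second moment at most theta. *)
Lemma lenglart_discrete (e theta : R) : 0 < e -> 0 <= theta ->
  measurable [set w | [exists k : 'I_N.+1, e <= `|M k w|] && (Q N w <= theta)] /\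
  fine (P [set w | [exists k : 'I_N.+1, e <= `|M k w|] && (Q N w <= theta)])
  <= theta / e ^+ 2.
Proof.
move=> e0 th0.
(* [Q k.+1] involves only xi_0, ..., xi_k and is thus known at time u_k: the step that would exceed
   theta is refused in advance. *)
pose b k w := (`|M k w| < e) && (Q k.+1 w <= theta).
pose a := fix a k w := if k is k'.+1 then a k' w && b k w else b 0%N w.
have adec w k : a k.+1 w -> a k w by move=> /= /andP[].
have ab k w : a k w -> b k w by case: k => //= k /andP[].
have mb i k : (i <= k)%N -> measurable_fun setT (b i : FT k -> bool).
  move=> ik; apply: measurable_and; last by apply: measurable_fun_ler => //; exact: mQ.
  apply: measurable_fun_ltr => //.
  by apply: measurableT_comp; [exact: normr_measurable|exact: mM].
have ma i k : (i <= k)%N -> measurable_fun setT (a i : FT k -> bool).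
  elim: i => [|i IH] ik; first exact: mb.
  by apply: measurable_and; [apply: IH; exact: ltnW|exact: mb].
pose D k w := B (u k.+1) w - B (u k) w.
pose c1 k w := (a k w)%:R * (2 * M k w * xi k w).
pose c2 k w := (a k w)%:R * xi k w ^+ 2.
have ank k : measurable_fun setT (fun w : FT k => (a k w)%:R : R).
  by apply: measurable_natr_bool; exact: ma.
have mxik k : measurable_fun setT (xi k : FT k -> R).
  by apply: (@mono_FT k) => //; exact: mxi.
have mc1 k : measurable_wrt (F (u k)) (c1 k).
  apply/(measurable_wrtP (sF k)); apply: measurable_funM => //.
  apply: measurable_funM => //; apply: measurable_funM; first exact: measurable_cst.
  exact: mM.
have mc2 k : measurable_wrt (F (u k)) (c2 k).
  apply/(measurable_wrtP (sF k)); apply: measurable_funM => //.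
  exact: measurable_funX.
have c1C k w : `|c1 k w| <= 2 * e * C k.
  rewrite /c1; have := xiC k w; case: (boolP (a k w)) => [/ab/andP[Me _]|_] xC.
    rewrite mul1r !normrM (ger0_norm (_ : 0 <= 2))// ler_pM ?mulr_ge0//.
    by rewrite ler_wpM2l// ltW.
  by rewrite mul0r normr0 !mulr_ge0 ?(ltW e0)// (le_trans _ xC).
have c2C k w : `|c2 k w| <= C k ^+ 2.
  rewrite /c2; have xC := xiC k w; have C0 : 0 <= C k by exact: le_trans xC.
  case: (a k w); last by rewrite mul0r normr0 sqr_ge0.
  by rewrite mul1r normrX lerXn2r ?nnegrE.
have i1 k := integrable_mul_increment hF hB (u_ge0 k) (umono k) (mc1 k) (c1C k).
have i2 k := integrable_mul_increment2 hF hB (u_ge0 k) (umono k) (mc2 k) (c2C k).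
(* The stopped square of M. Each increment is 2 M xi D, of mean zero, plus xi^2 D^2, whose mean is
   that of the increment of Q. *)
pose S w := \sum_(k < N) (a k w)%:R * (M k.+1 w ^+ 2 - M k w ^+ 2).
have termE k w : (a k w)%:R * (M k.+1 w ^+ 2 - M k w ^+ 2) =
    c1 k w * D k w + c2 k w * D k w ^+ 2.
  by rewrite /c1 /c2 /M big_ord_recr/= -/(M k w) -/(D k w); ring.
have iterm k : P.-integrable setT
    (EFin \o (fun w => (a k w)%:R * (M k.+1 w ^+ 2 - M k w ^+ 2))).
  by under eq_fun do rewrite termE; exact: integrableDr (i1 k) (i2 k).
have iS : P.-integrable setT (EFin \o S).
  exact: (integrable_sumr (fun k (_ : (k < N)%N) => iterm k)).
have ic2 k : P.-integrable setT (EFin \o c2 k).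
  exact: bounded_integrable (wrt_measurable hF (u_ge0 k) (mc2 k)) (c2C k).
have idc2 k : P.-integrable setT (EFin \o (fun w => (u k.+1 - u k) * c2 k w)).
  exact: integrableZl_real.
have ES : \int[P]_w S w =
    \int[P]_w (\sum_(k < N) (u k.+1 - u k) * c2 k w).
  rewrite (Rintegral_sumr (fun k (_ : (k < N)%N) => iterm k)).
  rewrite (Rintegral_sumr (fun k (_ : (k < N)%N) => idc2 k)).
  apply: eq_bigr => k _; rewrite RintegralZl//.
  under eq_Rintegral do rewrite termE.
  rewrite RintegralD//.
  rewrite (Rintegral_mul_increment hF hB (u_ge0 k) (umono k) (mc1 k) (c1C k)) add0r.
  by rewrite (Rintegral_mul_increment2 hF hB (u_ge0 k) (umono k) (mc2 k) (c2C k)) mulrC.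
have Sth : \int[P]_w S w <= theta.
  rewrite ES -[leRHS](Rintegral_Pcst P); apply: le_Rintegral => //.
  - exact: (integrable_sumr (fun k (_ : (k < N)%N) => idc2 k)).
  - exact: finite_measure_integrable_cst.
  move=> w _.
  (* The stopped quadratic variation is Q at tau, and accepting the step tau - 1 required Q tau <=
     theta. *)
  have [tau [taun atau _ E]] := @stopped_sum R (a ^~ w) (Q ^~ w) N (adec w).
  have -> : \sum_(k < N) (u k.+1 - u k) * c2 k w = Q tau w.
    have Q0 : Q 0 w = 0 by rewrite /Q big_ord0.
    rewrite -[RHS]subr0 -[X in _ = _ - X]Q0 -E; apply: eq_bigr => k _.
    by rewrite {1}/Q big_ord_recr/= -/(Q k w) /c2; ring.
  case: tau taun atau {E} => [|k] kN ak; first by rewrite /Q big_ord0.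
  by have /ab/andP[] := ak k (ltnSn k).
have mN : measurable_fun setT (M N : T -> R) by apply: (@wrtT N); exact: mM.
set A := [set w | _ && _].
have mA : measurable A.
  apply: measurable_true_set; apply: measurable_and; last first.
    apply: measurable_fun_ler => //; apply: measurable_sum => i.
    apply: measurable_funM => //; apply: measurable_funX.
    exact: (wrt_measurable hF (u_ge0 i)).
  have -> : (fun w => [exists k : 'I_N.+1, e <= `|M k w|]) =
      (fun w => ~~ [forall k : 'I_N.+1, `|M k w| < e]).
    apply/funext => w; rewrite negb_forall; apply: eq_existsb => k.
    by rewrite -leNgt.
  apply: measurable_neg.
  have H n : (n <= N.+1)%N ->
     measurable_fun setT (fun w => all (fun k => `|M k w| < e) (iota 0 n)).
    elim: n => [_|n IH nN]; first exact: measurable_cst.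
    have -> : (fun w => all (fun k => `|M k w| < e) (iota 0 n.+1)) =
       (fun w => all (fun k => `|M k w| < e) (iota 0 n) && (`|M n w| < e)).
      by apply/funext => w; rewrite -addn1 iotaD all_cat/= andbT.
    apply: measurable_and; first by apply: IH; exact: ltnW.
    apply: measurable_fun_ltr => //; apply: measurableT_comp.
      exact: normr_measurable.
    by apply: (@wrtT n); exact: mM.
  have := H N.+1 (leqnn _); congr measurable_fun; apply/funext => w.
  apply/idP/forallP => [/allP h k|h].
    by apply: h; rewrite mem_iota add0n ltn_ord.
  by apply/allP => k; rewrite mem_iota add0n => kN; exact: (h (Ordinal kN)).
split=> //; rewrite ler_pdivlMr ?exprn_gt0// mulrC.
apply: le_trans Sth; apply: markov_Rintegral => // w.
  have [tau [_ _ _ E]] := @stopped_sum R (a ^~ w) (fun k => M k w ^+ 2) N (adec w).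
  by rewrite /S E {2}/M big_ord0 expr0n subr0 sqr_ge0.
(* |M k| >= e forces stopping at some tau <= k. If tau < N, theta cannot be the cause because Q N <=
   theta, so |M tau| >= e; if tau = N, then k = N. Either way the stopped square is at least e^2. *)
move=> /andP[/existsP[k ek] Qth].
have [tau [tN atau ntau E]] := @stopped_sum R (a ^~ w) (fun k => M k w ^+ 2) N (adec w).
rewrite /S E {2}/M big_ord0 expr0n subr0 -[leRHS]real_normK ?num_real//.
rewrite lerXn2r ?nnegrE// ?(ltW e0)//.
have bN j : (j < N)%N -> Q j.+1 w <= theta.
  by move=> jN; exact: le_trans (Qle w jN) Qth.
have ktau : (tau <= k)%N.
  by rewrite leqNgt; apply/negP => /atau/ab/andP[]; rewrite ltNge ek.
move: tN; rewrite leq_eqVlt => /predU1P[tN|tN].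
  have -> : tau = k by apply/eqP; rewrite eqn_leq ktau/= tN -ltnS ltn_ord.
  exact: ek.
rewrite leNgt; apply/negP => Mt; have := ntau tN; apply/negP/negPn.
have bt : b tau w by rewrite /b Mt bN.
case: tau atau bt {E ntau ktau Mt tN} => [//|j] atau bj.
by rewrite /= bj atau.
Qed.

End Lenglart.

(** * Simple processes *)

Section SortedGrid.
Context {R : realType}.

(** The list is sorted without repetitions; the end points 0 and t, being extremal members, come
    first and last. *)
Lemma strict_grid (l : seq R) (t : R) :
  0 \in l -> t \in l -> (forall a, a \in l -> 0 <= a <= t) ->
  exists (u : nat -> R) (N : nat), [/\ u 0%N = 0, u N = t,
    forall i, u i < u i.+1 & forall a, a \in l -> exists2 j, (j <= N)%N & a = u j].
Proof.
move=> l0 lt lb; pose s := sort <=%O (undup l).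
have ss : sorted <%O s by rewrite sort_lt_sorted undup_uniq.
have ms a : (a \in s) = (a \in l) by rewrite mem_sort mem_undup.
have s0 : (0 < size s)%N by case: s ms {ss} => // /(_ 0); rewrite l0.
pose N := (size s).-1.
have sN : size s = N.+1 by rewrite prednK.
(* Unit steps past N keep u strictly increasing at every index, as the discrete inequality
   requires. *)
pose u i := if (i <= N)%N then nth 0 s i else t + (i - N)%:R.
have us a : a \in l -> exists2 j, (j <= N)%N & a = u j.
  rewrite -ms => /(nthP 0)[j]; rewrite sN ltnS => jN <-.
  by exists j; rewrite // /u jN.
have lu j : (j <= N)%N -> u j \in l.
  by move=> jN; rewrite /u jN -ms mem_nth// sN.
have umon i : (i < N)%N -> u i < u i.+1.
  move=> iN; rewrite /u iN (ltnW iN).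
  by apply: (sorted_ltn_nth lt_trans 0 ss); rewrite ?inE ?sN// ltnW.
have ule i j : (i <= j <= N)%N -> u i <= u j.
  move=> /andP[]; elim: j => [|j IH]; first by rewrite leqn0 => /eqP ->.
  rewrite leq_eqVlt => /predU1P[-> //|ij jN].
  by rewrite (le_trans (IH _ (ltnW jN)))// ltW// umon.
have u0 : u 0%N = 0.
  have /us[j jN E] := l0; have /andP[h _] := lb _ (lu 0%N isT).
  by apply/eqP; rewrite eq_le h {1}E ule.
have uN : u N = t.
  have /us[j jN E] := lt; have /andP[_ h] := lb _ (lu N (leqnn _)).
  by apply/eqP; rewrite eq_le h E ule// jN leqnn.
exists u, N; split => // i; have [iN|Ni] := ltnP i N; first exact: umon.
move: Ni; rewrite leq_eqVlt => /predU1P[<-|Ni].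
  by rewrite uN /u ltnn ltrDl subSnn.
by rewrite /u leqNgt Ni leqNgt ltnS (ltnW Ni)/= ltrD2l ltr_nat ltn_sub2r// (ltn_trans Ni).
Qed.

End SortedGrid.

Section SimpleProcess.
Context {R : realType} {d : measure_display} {T : measurableType d}.
Variables (P : probability T R) (F : R -> set (set T)) (B : R -> T -> R).
Hypotheses (hF : filtration F) (hB : brownian_motion P F B).

Lemma simple_time_nonneg (h : simple_process F) i : 0 <= simple_time h i.
Proof. exact: le_trans (simple_time_ge0 h) (simple_time_mono h (leq0n i)). Qed.

Lemma simple_eval_bounded (h : simple_process F) s :
  exists C : R, forall w, `|simple_eval h s w| <= C.
Proof.
have [C HC] := choice (simple_coef_bounded h).
exists (\sum_(i < simple_size h) C i) => w.
rewrite /simple_eval (le_trans (ler_norm_sum _ _ _))// ler_sum// => i _.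
rewrite normrM (le_trans _ (HC i w))// ler_piMr//.
by rewrite indicE; case: (_ \in _); rewrite ?normr1 ?normr0.
Qed.

Lemma measurable_simple_eval (h : simple_process F) w :
  measurable_fun setT (fun s => simple_eval h s w).
Proof.
by apply: measurable_sum => i; apply: measurable_funM => //; exact: measurable_indic.
Qed.

Let indic_oc (a b x : R) : \1_(`]a, b]%classic : set R) x = ((a < x) && (x <= b))%:R :> R.
Proof. by rewrite indicE mem_setE in_itv. Qed.

Section Grid.
Variables (u : nat -> R) (N : nat) (t : R) (h : simple_process F).
Hypotheses (u0 : u 0%N = 0) (uN : u N = t) (umono : forall i, u i < u i.+1).
Hypothesis grid : forall i, (i <= simple_size h)%N ->
  exists2 j, (j <= N)%N & Num.min t (simple_time h i) = u j.

Let ule i j : (i <= j)%N -> u i <= u j.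
Proof.
move=> /subnK <-; elim: (j - i)%N => [|k IH]; first by rewrite add0n.
by rewrite addSn (le_trans IH)// ltW.
Qed.

Let ult i j : (u i < u j) = (i < j)%N.
Proof.
have [ij|ji] := ltnP i j; last by apply/negbTE; rewrite -leNgt ule.
by rewrite (lt_le_trans (umono i))// ule.
Qed.

Let uleE i j : (u i <= u j) = (i <= j)%N.
Proof. by rewrite leNgt ult -leqNgt. Qed.

(** No time of h up to t lies strictly inside a cell, so comparing it with s or with the left end
    point gives the same answer. Times beyond t, which the grid does not record, exceed both. *)
Let cell i j (s : R) : (i < N)%N -> (j <= simple_size h)%N ->
  u i < s -> s <= u i.+1 ->
  (simple_time h j < s) = (simple_time h j <= u i).
Proof.
move=> iN jh us su.
have st : s <= t by rewrite (le_trans su)// -uN ule.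
have [k kN E] := grid jh.
have [jt|tj] := leP (simple_time h j) t; last first.
  have -> : (simple_time h j < s) = false.
    by apply/negbTE; rewrite -leNgt (le_trans st)// ltW.
  by apply/esym/negbTE; rewrite -ltNge (lt_trans (lt_le_trans us st)).
move: E; rewrite min_r// => ->; rewrite uleE.
have [ki|ik] := leqP k i; first by rewrite (le_lt_trans _ us)// ule.
by apply/negbTE; rewrite -leNgt (le_trans su)// ule.
Qed.

Let cell_le i j (s : R) : (i < N)%N -> (j <= simple_size h)%N ->
  u i < s -> s <= u i.+1 ->
  (s <= simple_time h j) = (u i < simple_time h j).
Proof. by move=> iN jh us su; rewrite leNgt (cell iN jh us su) -ltNge. Qed.

Lemma simple_eval_cell i s w : (i < N)%N -> u i < s -> s <= u i.+1 ->
  simple_eval h s w = simple_eval h (u i.+1) w.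
Proof.
move=> iN us su; apply: eq_bigr => j _; congr (_ * _); rewrite !indic_oc.
rewrite (cell iN (ltnW (ltn_ord j)) us su) (cell iN (ltnW (ltn_ord j)) (umono i) (lexx _)).
by rewrite (cell_le iN (ltn_ord j) us su) (cell_le iN (ltn_ord j) (umono i) (lexx _)).
Qed.

(** Intervals open on the left make h predictable: a coefficient active on ]u_i, u_(i+1)] has its
    starting time at or before u_i. *)
Lemma simple_eval_wrt i : (i < N)%N ->
  measurable_wrt (F (u i)) (simple_eval h (u i.+1)).
Proof.
move=> iN; have ui0 : 0 <= u i by rewrite -u0 ule.
apply/(measurable_wrtP (filtration_sigma hF ui0)).
apply: measurable_sum => j; rewrite indic_oc.
rewrite (cell iN (ltnW (ltn_ord j)) (umono i) (lexx _)).
have [ju|_] := boolP (simple_time h j <= u i).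
  apply: measurable_funM => //.
  apply/(measurable_wrtP (filtration_sigma hF ui0)).
  exact: (wrt_mono hF (simple_time_nonneg h j) ju (@simple_coef_measurable _ _ _ _ h j)).
by under eq_fun do rewrite mulr0; exact: measurable_cst.
Qed.

(* Multiplying an increment by the indicator of ]a, b] amounts to clipping the
   endpoints to [a, b], and clipped increments telescope. *)
Let telescope (G : R -> R) (a b : R) k : (k <= N)%N -> a <= b -> b <= u k ->
  (exists2 j, (j <= N)%N & a = u j) -> (exists2 j, (j <= N)%N & b = u j) ->
  \sum_(i < k) ((a < u i.+1) && (u i.+1 <= b))%:R * (G (u i.+1) - G (u i))
  = G b - G a.
Proof.
move=> kN ab bk [ja jaN aE] [jb jbN bE].
pose clip x := Num.min (Num.max x a) b.
transitivity (\sum_(i < k) (G (clip (u i.+1)) - G (clip (u i)))).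
  apply: eq_bigr => i _; rewrite /clip aE bE ult uleE.
  have [ai|ia] := ltnP ja i.+1.
    rewrite ltnS in ai; rewrite (max_l (ule (leqW ai))) (max_l (ule ai)).
    have [ib|bi] := leqP i.+1 jb.
      by rewrite mul1r min_l ?ule// min_l// ule// ltnW.
    by rewrite mul0r min_r ?ule 1?ltnW// min_r ?subrr// ule.
  rewrite mul0r (max_r (ule ia)) (max_r (ule (ltnW ia))).
  by rewrite subrr.
rewrite -(big_mkord xpredT (fun i => G (clip (u i.+1)) - G (clip (u i)))).
rewrite telescope_sumr// /clip u0.
have a0 : 0 <= a by rewrite aE -u0 ule.
by rewrite (max_r a0) (min_l ab) max_l ?(le_trans ab)// min_r.
Qed.

(** After exchanging the sums, each coefficient of h meets the increments of B over the cells it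
    covers, and these telescope. *)
Lemma simple_integral_grid k w : (k <= N)%N ->
  simple_integral B h (u k) w =
  \sum_(i < k) simple_eval h (u i.+1) w * (B (u i.+1) w - B (u i) w).
Proof.
move=> kN; rewrite /simple_integral.
under [RHS]eq_bigr do rewrite /simple_eval mulr_suml.
rewrite exchange_big /=; apply: eq_bigr => j _.
under [RHS]eq_bigr do rewrite indic_oc -mulrA.
rewrite -mulr_sumr; congr (_ * _).
have ukt : u k <= t by rewrite -uN ule.
have ming i : (i <= simple_size h)%N ->
    exists2 j, (j <= N)%N & Num.min (u k) (simple_time h i) = u j.
  move=> ih; have [i' iN E] := grid ih.
  have [uks|suk] := leP (u k) (simple_time h i); first by exists k.
  by exists i' => //; rewrite -E min_r// (le_trans (ltW suk)).
rewrite -(@telescope (B ^~ w) (Num.min (u k) (simple_time h j))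
   (Num.min (u k) (simple_time h j.+1)) k kN).
- apply: eq_bigr => i _; congr (_%:R * _).
  have uik : u i.+1 <= u k by rewrite ule.
  by rewrite gt_min le_min uik/= ltNge uik.
- rewrite le_min ge_min lexx/= ge_min (simple_time_mono h (leqnSn j)) orbT.
  by [].
- by rewrite ge_min lexx.
- by apply: ming; exact: ltnW.
- exact: ming.
Qed.

End Grid.

(** On ]0, t] the two sides are equal, cell by cell; passing to the closed interval only uses that g
    is nonnegative. *)
Lemma le_integral_grid (u : nat -> R) (N : nat) (t : R) (g : R -> R) :
  u 0%N = 0 -> u N = t -> (forall i, u i < u i.+1) ->
  measurable_fun setT g -> (forall s, 0 <= g s) ->
  (forall i s, (i < N)%N -> u i < s -> s <= u i.+1 -> g s = g (u i.+1)) ->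
  ((\sum_(i < N) g (u i.+1) * (u i.+1 - u i))%:E <=
   \int[lebesgue_measure]_(s in `[0%R, t]) (g s)%:E)%E.
Proof.
move=> u0 uN umono mg g0 gc.
have mgE (D : set R) : measurable_fun D (EFin \o g).
  by apply/measurable_funTS/measurable_EFinP.
have ule i : 0 <= u i.
  by elim: i => [|i IH]; rewrite ?u0// (le_trans IH)// ltW.
suff H k : (k <= N)%N -> (\int[lebesgue_measure]_(s in `]0%R, u k]) (g s)%:E =
    (\sum_(i < k) g (u i.+1) * (u i.+1 - u i))%:E)%E.
  rewrite -(H N (leqnn N)) uN; apply: ge0_subset_integral => //.
  - exact: mgE.
  - by move=> s _; rewrite lee_fin.
  - by move=> s /=; rewrite !in_itv/= => /andP[/ltW -> ->].
elim: k => [_|k IH kN]; first by rewrite u0 set_itvoc0 integral_set0 big_ord0.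
have E : `]0, u k.+1]%classic = `]0, u k]%classic `|` `]u k, u k.+1]%classic.
  by rewrite (@itv_bndbnd_setU _ _ (BRight 0) (BRight (u k)))// bnd_simp ?ule ?ltW.
rewrite E ge0_integral_setU//=; last first.
- apply/disj_setPS => s [] /=; rewrite !in_itv/= => /andP[_ su] /andP[us _].
  by have := lt_le_trans us su; rewrite ltxx.
- by move=> s _; rewrite lee_fin.
- exact: mgE.
rewrite IH ?(ltnW kN)// big_ord_recr/= EFinD; congr (_ + _)%E.
transitivity (\int[lebesgue_measure]_(s in `]u k, u k.+1]) (cst (g (u k.+1))%:E s))%E.
  apply: eq_integral => s; rewrite inE/= in_itv/= => /andP[us su].
  by rewrite (gc k).
rewrite integral_cst// EFinM; congr (_ * _)%E.
apply: etrans (lebesgue_measure_itv `]u k, u k.+1]) _.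
by rewrite /= lte_fin umono EFinB.
Qed.

(* The two partitions are merged into one, on which both processes are constant
   in each cell.  Events that need not be measurable are replaced by a measurable
   superset A, here and in the approximation lemmas below. *)
Lemma lenglart_simple (h h' : simple_process F) (t e theta : R) (ts : seq R) :
  0 <= t -> 0 < e -> 0 <= theta -> (forall a, a \in ts -> 0 <= a <= t) ->
  exists A : set T, [/\ measurable A, fine (P A) <= theta / e ^+ 2 &
    forall w, (\int[lebesgue_measure]_(s in `[0%R, t])
        ((simple_eval h s w - simple_eval h' s w) ^+ 2)%:E <= theta%:E)%E ->
      forall a, a \in ts ->
      e <= `|simple_integral B h a w - simple_integral B h' a w| -> A w].
Proof.
move=> t0 e0 th0 tsb.
pose times (g : simple_process F) :=
  [seq Num.min t (simple_time g i) | i <- iota 0 (simple_size g).+1].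
have timesP (g : simple_process F) i : (i <= simple_size g)%N ->
    Num.min t (simple_time g i) \in times g.
  by move=> ig; apply/mapP; exists i; rewrite // mem_iota add0n ltnS.
have [||a|u [N [u0 uN umono ugrid]]] := @strict_grid R
  (0 :: t :: ts ++ times h ++ times h') t.
- by rewrite inE eqxx.
- by rewrite !inE eqxx orbT.
- rewrite !inE !mem_cat => /or3P[/eqP ->|/eqP ->|].
  + by rewrite t0 andbT.
  + by rewrite t0/=.
  + move=> /orP[/tsb//|/orP[]] /mapP[i _ ->];
      by rewrite le_min t0 simple_time_nonneg ge_min lexx.
have grid (g : simple_process F) : {subset times g <= times h ++ times h'} ->
    forall i, (i <= simple_size g)%N ->
    exists2 j, (j <= N)%N & Num.min t (simple_time g i) = u j.
  move=> sub i ig; apply: ugrid; rewrite !inE mem_cat.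
  by rewrite (sub _ (timesP g i ig)) !orbT.
have gh : forall i, (i <= simple_size h)%N ->
    exists2 j, (j <= N)%N & Num.min t (simple_time h i) = u j.
  by apply: grid => x xh; rewrite mem_cat xh.
have gh' : forall i, (i <= simple_size h')%N ->
    exists2 j, (j <= N)%N & Num.min t (simple_time h' i) = u j.
  by apply: grid => x xh; rewrite mem_cat xh orbT.
(* The value 0 past N keeps xi adapted at all indices, as predictability of h and h' on the grid is
   known only below N. *)
pose xi i w := if (i < N)%N then
  simple_eval h (u i.+1) w - simple_eval h' (u i.+1) w else 0.
have ule i : 0 <= u i.
  by elim: i => [|i IH]; rewrite ?u0// (le_trans IH)// ltW.
have mxi i : measurable_wrt (F (u i)) (xi i).
  apply/(measurable_wrtP (filtration_sigma hF (ule i))); rewrite /xi.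
  case: (boolP (i < N)%N) => iN; last exact: measurable_cst.
  apply: measurable_funB; apply/(measurable_wrtP (filtration_sigma hF (ule i))).
    exact: (simple_eval_wrt u0 uN umono gh iN).
  exact: (simple_eval_wrt u0 uN umono gh' iN).
have xiC i : exists C : R, forall w, `|xi i w| <= C.
  have [C HC] := simple_eval_bounded h (u i.+1).
  have [C' HC'] := simple_eval_bounded h' (u i.+1).
  exists (C + C') => w; rewrite /xi; case: ifP => _.
    by rewrite (le_trans (ler_normB _ _))// lerD.
  rewrite normr0 addr_ge0//; first exact: le_trans (HC w).
  exact: le_trans (HC' w).
have [C HC] := choice xiC.
have u00 : 0 <= u 0%N by rewrite u0.
have [mA PA] := lenglart_discrete hF hB N u00 umono mxi HC e0 th0.
eexists; split; [exact: mA|exact: PA|].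
move=> w Ith a ats ea /=; apply/andP; split; last first.
  rewrite -lee_fin (le_trans _ Ith)//.
  have := @le_integral_grid u N t
    (fun s => (simple_eval h s w - simple_eval h' s w) ^+ 2) u0 uN umono.
  rewrite (eq_bigr (fun i : 'I_N => xi i w ^+ 2 * (u i.+1 - u i))); last first.
    by move=> i _; rewrite /xi ltn_ord.
  apply.
  - by apply: measurable_funX; apply: measurable_funB; exact: measurable_simple_eval.
  - by move=> s; exact: sqr_ge0.
  - move=> i s iN us su.
    by rewrite (simple_eval_cell uN umono gh w iN us su)
      (simple_eval_cell uN umono gh' w iN us su).
have [k kN ak] : exists2 j, (j <= N)%N & a = u j.
  by apply: ugrid; rewrite !inE mem_cat ats !orbT.
apply/existsP; exists (inord k); rewrite inordK ?ltnS//.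
move: ea; rewrite ak (simple_integral_grid u0 uN umono gh w kN).
rewrite (simple_integral_grid u0 uN umono gh' w kN) -sumrB.
congr (_ <= `| _ |); apply: eq_bigr => i _.
by rewrite /xi (leq_trans (ltn_ord i) kN) mulrBl.
Qed.

End SimpleProcess.

(** * Uniform grids and continuous adapted processes *)

Section UniformGrid.
Context {R : realType}.
Variables (t : R) (n : nat).
Hypotheses (t0 : 0 <= t) (n0 : (0 < n)%N).

Definition gridt (k : nat) : R := t * k%:R / n%:R.

Let n0R : 0 < n%:R :> R. Proof. by rewrite ltr0n. Qed.

Lemma gridt0 : gridt 0 = 0. Proof. by rewrite /gridt mulr0 mul0r. Qed.

Lemma gridtn : gridt n = t. Proof. by rewrite /gridt mulfK// gt_eqF. Qed.

Lemma gridtS k : gridt k.+1 - gridt k = t / n%:R.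
Proof. by rewrite /gridt -mulrBl -mulrBr -natr1 addrC addKr mulr1. Qed.

Lemma gridt_le i j : (i <= j)%N -> gridt i <= gridt j.
Proof. by move=> ij; rewrite ler_wpM2r ?invr_ge0// ler_wpM2l// ler_nat. Qed.

Lemma gridt_ge0 i : 0 <= gridt i.
Proof. by rewrite divr_ge0 ?mulr_ge0. Qed.

Lemma gridt_itv i : (i <= n)%N -> 0 <= gridt i <= t.
Proof. by move=> ni; rewrite gridt_ge0 -[leRHS]gridtn gridt_le. Qed.

Lemma gridt_cell s : 0 < s <= t ->
  exists2 k, (k < n)%N & gridt k < s <= gridt k.+1.
Proof.
move=> /andP[s0 st].
have ex : exists k, s <= gridt k by exists n; rewrite gridtn.
case: (ex_minnP ex) => -[|k] sk kmin; first by move: sk; rewrite gridt0 leNgt s0.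
exists k; first by have := kmin n; rewrite gridtn => /(_ st).
by rewrite sk andbT ltNge; apply/negP => /kmin; rewrite ltnn.
Qed.

Lemma gridt_sum_indic (c : nat -> R) s k : (k < n)%N -> gridt k < s <= gridt k.+1 ->
  \sum_(i < n) c i * \1_(`]gridt i, gridt i.+1]%classic : set R) s = c k.
Proof.
move=> kn /andP[ks sk]; rewrite (bigD1 (Ordinal kn))//= big1 ?addr0 => [|i ik].
  by rewrite indicE mem_set ?mulr1//= in_itv/= ks.
rewrite indicE memNset ?mulr0//= in_itv/= => /andP[i1 i2].
have [ltik|ltki|eik] := ltngtP (i : nat) k.
- by have := le_lt_trans (le_trans i2 (gridt_le ltik)) ks; rewrite ltxx.
- by have := le_lt_trans (le_trans sk (gridt_le ltki)) i1; rewrite ltxx.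
- by move: ik; rewrite -val_eqE/= eik eqxx.
Qed.

Lemma gridt_near s : 0 <= s <= t ->
  exists2 k, (k <= n)%N & `|s - gridt k| <= t / n%:R.
Proof.
rewrite le_eqVlt => /andP[/predU1P[<- _|s0 st]].
  by exists 0%N; rewrite // gridt0 subrr normr0 divr_ge0.
have [|k kn /andP[ks sk]] := @gridt_cell s; first by rewrite s0.
exists k; first exact: ltnW.
by rewrite ger0_norm ?subr_ge0 ?(ltW ks)// -(gridtS k) lerD2r.
Qed.

End UniformGrid.

Lemma near_le_of_cvg0 (R : realType) (v : nat -> \bar R) (kappa : R) :
  v n @[n --> \oo] --> 0%E -> 0 < kappa ->
  \forall n \near \oo, (v n <= kappa%:E)%E.
Proof.
move=> cv k0.
have k0' : (0 < kappa%:E)%E by rewrite lte_fin.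
have H : nbhs (0%E : \bar R) (fun y => y <= kappa%:E)%E.
  apply: (@filterS _ (nbhs (0%E : \bar R)) _ (fun y => y < kappa%:E)%E).
    by move=> y; exact: ltW.
  exact: open_ereal_lt'.
exact: (cv _ H).
Qed.

Section Exhaustion.
Context {R : realType} {d : measure_display} {T : measurableType d}.
Variable P : probability T R.

Lemma prob_exhaust (E : nat -> set T) (kappa : R) :
  (forall m, measurable (E m)) -> (forall m, E m `<=` E m.+1) ->
  (forall w, exists m, E m w) -> 0 < kappa ->
  exists m, fine (P (~` E m)) <= kappa.
Proof.
move=> mE Eincr Eall k0.
have mC m : measurable (~` E m) by exact: measurableC.
have cap0 : \bigcap_m ~` E m = set0.
  by rewrite -subset0 => w H; have [m] := Eall w; exact: H.
have ndC : nonincreasing_seq (fun m => ~` E m).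
  apply/nonincreasing_seqP => m; apply/subsetPset.
  exact: subsetC (Eincr m).
have cv : (P \o (fun m => ~` E m)) m @[m --> \oo] --> 0%E.
  rewrite -(measure0 P) -cap0; apply: nonincreasing_cvg_mu => //.
  - by rewrite -ge0_fin_numE//; exact: fin_num_prob.
  - by rewrite cap0.
have [m _ H] := near_le_of_cvg0 cv k0; exists m; have := H m (leqnn m).
by rewrite -lee_fin fineK ?fin_num_prob.
Qed.

End Exhaustion.

Section ContinuousAdapted.
Context {R : realType} {d : measure_display} {T : measurableType d}.
Variables (P : probability T R) (F : R -> set (set T)).
Hypothesis hF : filtration F.
Variable Z : R -> T -> R.
Hypotheses (aZ : adapted F Z) (cZ : forall w, continuous_path Z w).
Variable t : R.
Hypothesis t0 : 0 <= t.

Lemma measurable_adapted s : 0 <= s -> measurable_fun setT (Z s).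
Proof. by move=> s0; apply: (wrt_measurable hF s0); exact: aZ. Qed.

Lemma within_path w : {within `[0, t], continuous (Z ^~ w)}.
Proof.
have sub : `[0, t]%classic `<=` `[0, +oo[%classic.
  by move=> s /=; rewrite !in_itv/= => /andP[->].
exact: (continuous_subspaceW sub (@cZ w)).
Qed.

Lemma path_uniform (w : T) (e : R) : 0 < e -> exists2 r : R, 0 < r &
  forall s s' : R, 0 <= s <= t -> 0 <= s' <= t -> `|s - s'| <= r -> `|Z s w - Z s' w| <= e.
Proof.
move=> e0; have [r r0 H] := within_continuous_uniformly (@within_path w) e0.
by exists r => // s s' st s't; apply: H; rewrite in_itv.
Qed.

Lemma mesh_small (r : R) : 0 < r -> exists n0, forall n, (n0 <= n)%N -> t / n.+1%:R <= r.
Proof.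
move=> r0; exists (Num.truncn (t / r)).+1 => n nn.
rewrite ler_pdivrMr ?ltr0n// mulrC -ler_pdivrMr//.
rewrite (le_trans (ltW (truncnS_gt _)))// ler_nat (leq_trans nn)//.
Qed.

Let Zn n (x : T * R) : R := \sum_(i < n.+1)
  Z (gridt t n.+1 i) x.1 * \1_(`]gridt t n.+1 i, gridt t n.+1 i.+1]%classic : set R) x.2.

(** Tonelli's theorem asks for joint measurability in (w, s). It holds because the continuous
    process is the pointwise limit on ]0, t] of the step processes [Zn], which take its value at the
    left end of each cell. *)
Lemma measurable_sq_dist (h : simple_process F) :
  measurable_fun setT (fun w => \int[lebesgue_measure]_(s in `[0%R, t])
     (((simple_eval h s w - Z s w) ^+ 2)%R%:E))%E.
Proof.
pose g (x : T * R) : R :=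
  (simple_eval h x.2 x.1 - Z x.2 x.1) ^+ 2 * \1_(`]0, t]%classic : set R) x.2.
pose gn n (x : T * R) : R :=
  (simple_eval h x.2 x.1 - Zn n x) ^+ 2 * \1_(`]0, t]%classic : set R) x.2.
have mstep (c : T -> R) (a b : R) : measurable_fun setT c ->
    measurable_fun setT (fun x : T * R => c x.1 * \1_(`]a, b]%classic : set R) x.2).
  move=> mc; apply: measurable_funM.
    exact: measurableT_comp mc measurable_fst.
  by apply: measurableT_comp measurable_snd; exact: measurable_indic.
have mgn n : measurable_fun setT (gn n).
  apply: measurable_funM; last first.
    by apply: measurableT_comp measurable_snd; exact: measurable_indic.
  apply: measurable_funX; apply: measurable_funB.
    apply: measurable_sum => i; apply: mstep.
    exact: (wrt_measurable hF (simple_time_nonneg h i) (@simple_coef_measurable _ _ _ _ h i)).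
  apply: measurable_sum => i; apply: mstep; apply: measurable_adapted.
  exact: gridt_ge0.
have mg : measurable_fun setT g.
  apply: (@measurable_fun_cvg _ (T * R)%type R setT gn g) => // -[w s] _.
  rewrite /g /gn /=; have [st|nst] := boolP (s \in `]0, t]%classic); last first.
    rewrite indicE (negbTE nst) mulr0; under eq_fun do rewrite mulr0; exact: cvg_cst.
  apply: cvgM; last exact: cvg_cst.
  have st' : 0 < s <= t by move: st; rewrite inE/= in_itv.
  suff cv : Zn n (w, s) @[n --> \oo] --> Z s w.
    by rewrite !expr2; apply: cvgM; apply: cvgB => //; exact: cvg_cst.
  apply/cvgrPdist_le => e e0; have [r r0 H] := path_uniform w e0.
  have [n0 Hn0] := mesh_small r0; exists n0 => // n /= n0n.
  have [k kn ks] := gridt_cell (ltn0Sn n) st'.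
  rewrite /Zn (gridt_sum_indic t0 (fun i => Z (gridt t n.+1 i) w) kn ks) /=.
  move: ks => /andP[ks sk].
  apply: H; first by move: st' => /andP[/ltW -> ->].
    by apply: gridt_itv => //; exact: ltnW.
  rewrite ger0_norm ?subr_ge0 ?(ltW ks)// (le_trans _ (Hn0 n n0n))//.
  by rewrite -(gridtS t n.+1 k) lerD2r.
have mgE : measurable_fun [set: T * measurableTypeR R] (EFin \o g).
  by apply/measurable_EFinP; exact: mg.
have gE0 x : (0 <= (EFin \o g) x)%E.
  by rewrite lee_fin mulr_ge0 ?sqr_ge0// indicE.
have := @measurable_fun_fubini_tonelli_F _ _ T (measurableTypeR R) R
  (@lebesgue_measure R) (EFin \o g) mgE gE0.
congr measurable_fun; apply/funext => w; rewrite /fubini_F /=.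
have mgw : measurable_fun setT (fun s : R => g (w, s)).
  by apply: measurableT_comp mg _; exact: measurable_pair1.
rewrite -integral_itv_obnd_cbnd; last first.
  apply/measurable_EFinP; apply: (@eq_measurable_fun _ _ _ _ _ (fun s => g (w, s))).
    by move=> s st; rewrite /g /= indicE st mulr1.
  exact: measurable_funTS mgw.
rewrite [RHS]integral_mkcond; apply: eq_integral => s _.
rewrite /patch /g /= indicE; case: ifP => st; rewrite ?mulr1 ?mulr0//.
Qed.

Let grid_dense (w : T) (e : R) : 0 < e -> exists n0, forall n (s : R), (n0 <= n)%N -> 0 <= s <= t ->
  exists2 k, (k <= n.+1)%N & `|s - gridt t n.+1 k| <= e /\
    `|Z s w - Z (gridt t n.+1 k) w| <= e.
Proof.
move=> e0; have [r r0 H] := path_uniform w e0.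
have m0 : 0 < Num.min r e by rewrite lt_min r0.
have [n0 Hn0] := mesh_small m0; exists n0 => n s n0n st.
have [k kn sk] := gridt_near t0 (ltn0Sn n) st.
have /andP[sr se] : (`|s - gridt t n.+1 k| <= r) && (`|s - gridt t n.+1 k| <= e).
  by rewrite -le_min (le_trans sk)// Hn0.
by exists k => //; split => //; apply: H => //; exact: gridt_itv.
Qed.

(* A continuous path stays in [a, b] as soon as it does so at all grid points. *)
Lemma measurable_range_event (a b : R) :
  measurable [set w | forall s, 0 <= s <= t -> a <= Z s w <= b].
Proof.
pose A n k := if (k <= n.+1)%N then
  [set w | (a <= Z (gridt t n.+1 k) w) && (Z (gridt t n.+1 k) w <= b)] else setT.
have -> : [set w | forall s, 0 <= s <= t -> a <= Z s w <= b] =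
    \bigcap_n \bigcap_k A n k.
  apply/seteqP; split => [w H n _ k _|w H s st].
    by rewrite /A; case: ifP => // kn; apply: H; exact: gridt_itv.
  have le2 (e : R) : 0 < e -> a - e <= Z s w <= b + e.
    move=> e0; have [n0 /(_ n0 s (leqnn _) st)[k kn [_ kz]]] := grid_dense w e0.
    have := H n0 I k I; rewrite /A kn /= => /andP[az zb].
    by move: kz; rewrite ler_norml => /andP[? ?]; lra.
  apply/andP; split; rewrite leNgt; apply/negP => lt.
    have [|] := andP (le2 ((a - Z s w) / 2) _); first by rewrite divr_gt0// subr_gt0.
    by move=> ? ?; lra.
  have [|] := andP (le2 ((Z s w - b) / 2) _); first by rewrite divr_gt0// subr_gt0.
  by move=> ? ?; lra.
apply: bigcapT_measurable => n; apply: bigcapT_measurable => k.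
rewrite /A; case: ifP => // kn.
have mZ : measurable_fun setT (Z (gridt t n.+1 k)).
  by apply: measurable_adapted; exact: gridt_ge0.
by apply: measurable_true_set; apply: measurable_and; exact: measurable_fun_ler.
Qed.

(** Each path is uniformly continuous on [0, t], so the events that a modulus 1 / (m + 1) works at
    all grid points increase to the whole space. Countably many grid points keep them measurable. *)
Lemma modulus_event (e kappa : R) : 0 < e -> 0 < kappa ->
  exists (r : R) (E : set T), [/\ 0 < r, measurable E, fine (P (~` E)) <= kappa &
    forall w, E w -> forall s s' : R, 0 <= s <= t -> 0 <= s' <= t ->
      `|s - s'| <= r -> `|Z s w - Z s' w| <= e].
Proof.
move=> e0 kappa0.
have e30 : 0 < e / 3 by rewrite divr_gt0.
pose A m n k k' := if [&& (k <= n.+1)%N, (k' <= n.+1)%N &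
    `|gridt t n.+1 k - gridt t n.+1 k'| <= m.+1%:R^-1] then
  [set w | `|Z (gridt t n.+1 k) w - Z (gridt t n.+1 k') w| <= e / 3] else setT.
pose E m := \bigcap_n \bigcap_k \bigcap_k' A m n k k'.
have mE m : measurable (E m).
  apply: bigcapT_measurable => n; apply: bigcapT_measurable => k.
  apply: bigcapT_measurable => k'; rewrite /A; case: ifP => // _.
  have mZ i : measurable_fun setT (Z (gridt t n.+1 i)).
    by apply: measurable_adapted; exact: gridt_ge0.
  apply: measurable_true_set; apply: measurable_fun_ler => //.
  by apply: measurableT_comp; [exact: normr_measurable|exact: measurable_funB].
have Eincr m : E m `<=` E m.+1.
  move=> w H n _ k _ k' _; have := H n I k I k' I; rewrite /A.
  case: ifP => [_|/negP c _]; first by case: ifP.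
  case: ifP => // /and3P[k1 k2 k3]; exfalso; apply: c.
  by rewrite k1 k2 (le_trans k3)// lef_pV2 ?posrE// ler_nat.
have Eall w : exists m, E m w.
  have [r r0 H] := path_uniform w e30.
  exists (Num.truncn r^-1) => n _ k _ k' _; rewrite /A; case: ifP => // /and3P[k1 k2 k3].
  apply: H; rewrite ?gridt_itv// (le_trans k3)//.
  by rewrite invf_ple ?posrE// ltW// truncnS_gt.
have [m Pm] := prob_exhaust P mE Eincr Eall kappa0.
(* With s and s' within 1 / (2 (m + 1)) and each within 1 / (4 (m + 1)) of a grid point, the two
   grid points are within 1 / (m + 1). The three value errors are e / 3 each. *)
exists (m.+1%:R^-1 / 2), (E m); split => //.
move=> w Ew s s' st s't ss'.
have m0 : 0 < m.+1%:R^-1 :> R by rewrite invr_gt0.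
have e'0 : 0 < Num.min (e / 3) (m.+1%:R^-1 / 4) by rewrite lt_min e30 divr_gt0.
have [n0 H] := grid_dense w e'0.
have [k kn [sk zk]] := H n0 s (leqnn _) st.
have [k' k'n [sk' zk']] := H n0 s' (leqnn _) s't.
move: sk zk sk' zk'; rewrite !le_min => /andP[_ sk] /andP[zk _] /andP[_ sk'] /andP[zk' _].
have := Ew n0 I k I k' I; rewrite /A kn k'n /=.
move: m0 sk zk sk' zk' ss'; rewrite !ler_norml.
set mi := m.+1%:R^-1; clearbody mi => m0.
move=> /andP[? ?] /andP[? ?] /andP[? ?] /andP[? ?] /andP[? ?].
case: ifP => [_ /= |/negP c _].
  by rewrite ler_norml => /andP[? ?]; apply/andP; split; lra.
by exfalso; apply: c; apply/andP; split; lra.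
Qed.

End ContinuousAdapted.

(** * Ito integrals along a grid *)

Section ItoIntegral.
Context {R : realType} {d : measure_display} {T : measurableType d}.
Variables (P : probability T R) (F : R -> set (set T)) (B : R -> T -> R).
Hypotheses (hF : filtration F) (hB : brownian_motion P F B).
Variable H : R -> T -> R.
Hypotheses (aH : adapted F H) (cH : forall w, continuous_path H w).

Lemma integral_sqB_triangle (D : set R) (f g k : R -> R) : measurable D ->
  measurable_fun D f -> measurable_fun D g -> measurable_fun D k ->
  (\int[lebesgue_measure]_(s in D) ((f s - g s) ^+ 2)%:E <=
   2%:E * \int[lebesgue_measure]_(s in D) ((f s - k s) ^+ 2)%:E +
   2%:E * \int[lebesgue_measure]_(s in D) ((g s - k s) ^+ 2)%:E)%E.
Proof.
move=> mD mf mg mk.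
have msq (a b : R -> R) : measurable_fun D a -> measurable_fun D b ->
    measurable_fun D (fun s => ((a s - b s) ^+ 2)%:E).
  by move=> ma mb; apply/measurable_EFinP; apply: measurable_funX; exact: measurable_funB.
rewrite -!ge0_integralZl//; try by move=> s _; rewrite lee_fin sqr_ge0.
all: try exact: msq.
rewrite -ge0_integralD//; last 4 first.
- by move=> s _; rewrite -EFinM lee_fin mulr_ge0 ?sqr_ge0.
- by apply: emeasurable_funM => //; exact: msq.
- by move=> s _; rewrite -EFinM lee_fin mulr_ge0 ?sqr_ge0.
- by apply: emeasurable_funM => //; exact: msq.
apply: ge0_le_integral => //.
- by move=> s _; rewrite lee_fin sqr_ge0.
- exact: msq.
- by apply: emeasurable_funD; apply: emeasurable_funM => //; exact: msq.
- move=> s _; rewrite -!EFinM -EFinD lee_fin.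
  have := sqr_ge0 (f s - k s + (g s - k s)).
  nra.
Qed.

Lemma measurable_path (t : R) w : measurable_fun (`[0, t]%classic : set R) (H ^~ w).
Proof.
apply: subspace_continuous_measurable_fun; first exact: measurable_itv.
exact: (@within_path _ _ _ H (@cH) t w).
Qed.

Lemma measurable_simple_integral (h : simple_process F) (t : R) : 0 <= t ->
  measurable_fun setT (simple_integral B h t).
Proof.
move=> t0; apply: measurable_sum => i; apply: measurable_funM.
  exact: (wrt_measurable hF (simple_time_nonneg h i) (@simple_coef_measurable _ _ _ _ h i)).
by apply: measurable_funB; apply: (measurable_brownian hF hB);
  rewrite le_min t0 simple_time_nonneg.
Qed.

(** One index n far enough in both limits; the two bad events are measurable here, so that their
    union can be bounded. *)
Lemma ito_integral_approx (t : R) (J : T -> R) (e kappa : R) :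
  0 <= t -> is_ito_integral P F B H t J -> 0 < e -> 0 < kappa ->
  exists (h : simple_process F) (A : set T),
    [/\ measurable A, fine (P A) <= kappa & forall w, ~ A w ->
    (\int[lebesgue_measure]_(s in `[0%R, t])
        ((simple_eval h s w - H s w) ^+ 2)%:E <= e%:E)%E /\
    `|simple_integral B h t w - J w| <= e].
Proof.
move=> t0 [mJ [h [cv1 cv2]]] e0 kappa0.
have k20 : 0 < kappa / 2 by rewrite divr_gt0.
have [n1 _ H1] := near_le_of_cvg0 (cv1 e e0) k20.
have [n2 _ H2] := near_le_of_cvg0 (cv2 e e0) k20.
pose n := maxn n1 n2.
have := H1 n (leq_maxl _ _); have := H2 n (leq_maxr _ _).
set A2 := [set w | _]; set A1 := [set w | _] => P2 P1.
have mA1 : measurable A1.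
  have := measurable_sq_dist hF aH (@cH) t0 (h n) => mI.
  have mI' := measurableT_comp (@abse_measurable R setT) mI.
  by rewrite -[A1]setTI; exact: emeasurable_fun_c_infty.
have mA2 : measurable A2.
  have mI : measurable_fun setT (fun w => `|(simple_integral B (h n) t w - J w)%:E|%E).
    apply: measurableT_comp => //; apply/measurable_EFinP; apply: measurable_funB => //.
    exact: measurable_simple_integral.
  by rewrite -[A2]setTI; exact: emeasurable_fun_c_infty.
exists (h n), (A1 `|` A2); split.
- exact: measurableU.
- rewrite (le_trans (fine_probU P mA1 mA2))// (splitr kappa) lerD//.
    by rewrite -lee_fin fineK ?fin_num_prob.
  by rewrite -lee_fin fineK ?fin_num_prob.
- move=> w /not_orP[n1w n2w]; split.
    move/negP : n1w; rewrite -ltNge gee0_abs => [/ltW //|].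
    by apply: integral_ge0 => s _; rewrite lee_fin sqr_ge0.
  by move/negP : n2w; rewrite -ltNge /= lte_fin => /ltW.
Qed.

(** The definition supplies different approximants for different times. Here h comes from the final
    time t alone. At another time a, h and the approximant [ha] for a are both close to H in L^2 of
    [0, a], hence close to each other, and Lenglart's inequality makes their integrals close. *)
Lemma ito_integral_grid_approx (t : R) (J : R -> T -> R) (ts : seq R) (e kappa : R) :
  0 <= t -> (forall a, 0 <= a <= t -> is_ito_integral P F B H a (J a)) ->
  (forall a, a \in ts -> 0 <= a <= t) -> 0 < e -> 0 < kappa ->
  exists (h : simple_process F) (A : set T),
    [/\ measurable A, fine (P A) <= kappa & forall w, ~ A w ->
    (\int[lebesgue_measure]_(s in `[0%R, t])
        ((simple_eval h s w - H s w) ^+ 2)%:E <= e%:E)%E /\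
    forall a, a \in ts -> `|simple_integral B h a w - J a w| <= e].
Proof.
move=> t0 hJ htb e0 kappa0.
(* There are 2 n + 1 bad events: one for h, and two for each time, from its own approximant and from
   Lenglart's inequality. *)
pose n := size ts; pose k1 := kappa / n.*2.+1%:R.
have k10 : 0 < k1 by rewrite divr_gt0// ltr0n.
(* The second bound turns the Lenglart estimate 4 e1 / (e / 2)^2 into at most k1; the 4 is the cost
   of the squared triangle inequality. *)
pose e1 := Num.min (e / 2) (k1 * (e / 2) ^+ 2 / 4).
have e20 : 0 < e / 2 by rewrite divr_gt0.
have e10 : 0 < e1.
  by rewrite lt_min e20 divr_gt0// mulr_gt0// exprn_gt0.
have e1e : e1 <= e / 2 by rewrite ge_min lexx.
have e1k : 4 * e1 / (e / 2) ^+ 2 <= k1.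
  rewrite ler_pdivrMr ?exprn_gt0// mulrC -ler_pdivlMr//.
  by rewrite ge_min lexx orbT.
have tt : 0 <= t <= t by rewrite t0 lexx.
have [h [A0 [mA0 PA0 HA0]]] := ito_integral_approx t0 (hJ t tt) e10 k10.
have step (l : seq R) : (forall a, a \in l -> 0 <= a <= t) -> exists A : set T,
    [/\ measurable A, fine (P A) <= k1 + (size l)%:R * (2 * k1) & forall w, ~ A w ->
    (\int[lebesgue_measure]_(s in `[0%R, t])
        ((simple_eval h s w - H s w) ^+ 2)%:E <= e1%:E)%E /\
    forall a, a \in l -> `|simple_integral B h a w - J a w| <= e].
  elim: l => [_|a l IH lb].
    exists A0; split => // [|w /HA0[Hw _]]; first by rewrite mul0r addr0.
    by split.
  have [|A [mA PA HA]] := IH; first by move=> x xl; apply: lb; rewrite inE xl orbT.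
  have /andP[a0 at'] : 0 <= a <= t by apply: lb; rewrite mem_head.
  have ata : 0 <= a <= t by rewrite a0.
  have [ha [Aa [mAa PAa HAa]]] := ito_integral_approx a0 (hJ a ata) e10 k10.
  have th0 : 0 <= 4 * e1 by rewrite mulr_ge0// ltW.
  have [|Ba [mBa PBa HBa]] := lenglart_simple hF hB h ha (ts := [:: a]) a0 e20 th0.
    by move=> x; rewrite inE => /eqP ->; rewrite a0 lexx.
  exists (A `|` (Aa `|` Ba)); split.
  - by apply: measurableU => //; exact: measurableU.
  - rewrite (le_trans (fine_probU P mA (measurableU _ _ mAa mBa)))//.
    rewrite (le_trans (lerD PA (fine_probU P mAa mBa)))//.
    by have := le_trans PBa e1k; rewrite /= -natr1 => PBa'; lra.
  - move=> w /not_orP[/HA[Hw1 Hw2] /not_orP[/HAa[Hw3 Hw4] nBa]]; split => // x.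
    rewrite inE => /predU1P[->|]; last exact: Hw2.
    have sub : `[0, a]%classic `<=` `[0, t]%classic.
      by move=> s /=; rewrite !in_itv/= => /andP[-> /le_trans]; apply.
    have ia : (\int[lebesgue_measure]_(s in `[0%R, a])
        ((simple_eval h s w - H s w) ^+ 2)%:E <= e1%:E)%E.
      apply: le_trans Hw1; apply: ge0_subset_integral => //.
        apply/measurable_EFinP; apply: measurable_funX; apply: measurable_funB.
          exact: measurable_funTS (measurable_simple_eval h w).
        exact: measurable_path.
      by move=> s _; rewrite lee_fin sqr_ge0.
    have : (\int[lebesgue_measure]_(s in `[0%R, a])
        ((simple_eval h s w - simple_eval ha s w) ^+ 2)%:E <= (4 * e1)%:E)%E.
      apply: (le_trans (@integral_sqB_triangle _ _ _ (H ^~ w) _ _ _ _)) => //.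
      - exact: measurable_funTS (measurable_simple_eval h w).
      - exact: measurable_funTS (measurable_simple_eval ha w).
      - exact: measurable_path.
      have -> : ((4 * e1)%:E = 2%:E * e1%:E + 2%:E * e1%:E)%E.
        by rewrite -!EFinM -EFinD; congr EFin; ring.
      by rewrite leeD// lee_pmul2l// lte_fin.
    move=> /HBa /(_ a (mem_head _ _)) contr.
    have : `|simple_integral B h a w - simple_integral B ha a w| < e / 2.
      by rewrite ltNge; apply/negP => /contr.
    move=> lt1.
    rewrite (_ : _ - J a w = (simple_integral B h a w - simple_integral B ha a w) +
      (simple_integral B ha a w - J a w)); last by ring.
    rewrite (le_trans (ler_normD _ _))// (splitr e) lerD// ?(ltW lt1)//.
    exact: le_trans Hw4 e1e.
have [A [mA PA HA]] := step ts htb.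
exists h, A; split => //.
  apply: (le_trans PA); rewrite -/n.
  have -> : k1 + n%:R * (2 * k1) = (n.*2.+1)%:R * k1.
    have -> : (n.*2.+1)%:R = 2 * n%:R + 1 :> R.
      by rewrite -addn1 natrD -muln2 natrM mulrC.
    by ring.
  by rewrite /k1 mulrC divfK.
move=> w /HA[Hw1 Hw2]; split => //; apply: (le_trans Hw1).
by rewrite lee_fin (le_trans e1e)// ler_pdivrMr// ler_peMr ?(ltW e0)// ler1n.
Qed.

End ItoIntegral.

(** * The Euler scheme *)

Section EulerScheme.
Context {R : realType} {d : measure_display} {T : measurableType d}.
Variables (P : probability T R) (F : R -> set (set T)) (B : R -> T -> R).
Hypotheses (hF : filtration F) (hB : brownian_motion P F B).
Variables (b sg : R -> R) (X : R -> T -> R).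
Hypotheses (cb : continuous b) (csg : continuous sg).
Hypothesis hX : sde_solution P F B b sg X.
Variables (t eta N : R).
Hypothesis t0 : 0 < t.
Variables (Mb Ms : R).
Hypothesis bM : forall y, eta <= y <= N -> `|b y| <= Mb.
Hypothesis sM : forall y, eta <= y <= N -> `|sg y| <= Ms.

(** An indicator cut-off, not a projection onto [eta, N]: outside the interval the coefficient is 0.
    This makes it bounded, and measurability is preserved. *)
Definition clip (g : R -> R) (y : R) : R := ((eta <= y) && (y <= N))%:R * g y.

Definition euler (n k : nat) (w : T) : R := X 0 w + \sum_(i < k)
  (clip b (X (gridt t n i) w) * (t / n%:R) +
   clip sg (X (gridt t n i) w) *
     (B (gridt t n i.+1) w - B (gridt t n i) w)).

Lemma measurable_clip (g : R -> R) : continuous g -> measurable_fun setT (clip g).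
Proof.
move=> cg; apply: measurable_funM; last exact: continuous_measurable_fun.
by apply: measurable_natr_bool; apply: measurable_and; exact: measurable_fun_ler.
Qed.

Lemma clip_bounded (g : R -> R) M : (forall y, eta <= y <= N -> `|g y| <= M) ->
  0 <= M -> forall y, `|clip g y| <= M.
Proof.
move=> gM M0 y; rewrite /clip normrM; case: (boolP (_ && _)) => yy.
  by rewrite normr1 mul1r gM.
by rewrite normr0 mul0r.
Qed.

Lemma clip_in (g : R -> R) y : eta <= y <= N -> clip g y = g y.
Proof. by move=> yy; rewrite /clip yy mul1r. Qed.

Lemma adapted_comp (g : R -> R) : measurable_fun setT g ->
  adapted F (fun s w => g (X s w)).
Proof.
move=> mg s s0; apply/(measurable_wrtP (filtration_sigma hF s0)).
apply: measurableT_comp => //; apply/(measurable_wrtP (filtration_sigma hF s0)).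
exact: (sde_adapted hX s0).
Qed.

Lemma continuous_path_comp (g : R -> R) : continuous g ->
  forall w, continuous_path (fun s w => g (X s w)) w.
Proof.
move=> cg w s.
exact: (continuous_comp (@sde_continuous _ _ _ _ _ _ _ _ _ hX w s) (cg _)).
Qed.

(** Induction on the cells: on each one f stays within e of its value at the left end point. *)
Lemma riemann_sum_close (f : R -> R) (n : nat) (e : R) : (0 < n)%N ->
  {within `[0, t], continuous f} ->
  (forall s s', 0 <= s <= t -> 0 <= s' <= t -> `|s - s'| <= t / n%:R ->
     `|f s - f s'| <= e) ->
  forall k, (k <= n)%N ->
  `|\int[lebesgue_measure]_(s in `[0, gridt t n k]) f s
    - \sum_(i < k) f (gridt t n i) * (t / n%:R)| <= e * gridt t n k.
Proof.
move=> n0 cf fe; have t0' := ltW t0.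
have fint : lebesgue_measure.-integrable `[0, t] (EFin \o f).
  by apply: continuous_compact_integrable => //; exact: segment_compact.
have mitv (I : interval R) : @measurable _ (measurableTypeR R) [set` I].
  exact: measurable_itv.
have intS (i j : itv_bound R) : [set` Interval i j] `<=` `[0, t]%classic ->
    lebesgue_measure.-integrable [set` Interval i j] (EFin \o f).
  move=> sub.
  exact: (integrableS (mitv _) (mitv _) sub fint).
have t_n0 : 0 < t / n%:R by rewrite divr_gt0// ltr0n.
elim=> [_|k IH kn].
  by rewrite gridt0 big_ord0 set_itv1 Rintegral_set1 subrr normr0 mulr0.
set tk := gridt t n k; set tk1 := gridt t n k.+1.
have dk : tk1 - tk = t / n%:R by exact: gridtS.
have /andP[tk0 tkt] : 0 <= tk <= t by apply: gridt_itv => //; exact: ltnW.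
have /andP[tk10 tk1t] : 0 <= tk1 <= t by exact: gridt_itv.
have tkk : tk <= tk1 by rewrite -subr_ge0 dk ltW.
have i1 : lebesgue_measure.-integrable `[0, tk1] (EFin \o f).
  by apply: intS => s /=; rewrite !in_itv/= => /andP[-> /le_trans]; apply.
have i2 : lebesgue_measure.-integrable `]tk, tk1] (EFin \o f).
  apply: intS => s /=; rewrite !in_itv/= => /andP[/ltW /(le_trans tk0) ->].
  by move=> /le_trans; apply.
have E : \int[lebesgue_measure]_(s in `[0, tk1]) f s =
    \int[lebesgue_measure]_(s in `[0, tk]) f s +
    \int[lebesgue_measure]_(s in `]tk, tk1]) f s.
  by rewrite -(Rintegral_itvB i1) ?bnd_simp// addrC subrK.
rewrite E big_ord_recr/= -/tk.
have mes : fine (lebesgue_measure (`]tk, tk1]%classic : set R)) = t / n%:R.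
  rewrite (lebesgue_measure_itv `]tk, tk1]) /= lte_fin.
  by rewrite -subr_gt0 dk t_n0 -EFinD /= dk.
have cint (c : R) : lebesgue_measure.-integrable `]tk, tk1] (EFin \o (fun _ => c)).
  apply: (@integrableS _ (measurableTypeR R) _ _ `[0, t]%classic) => //.
    by move=> s /=; rewrite !in_itv/= => /andP[/ltW /(le_trans tk0) -> /le_trans]; apply.
  apply: continuous_compact_integrable; first exact: segment_compact.
  by move=> x; exact: cst_continuous.
have rest : `|\int[lebesgue_measure]_(s in `]tk, tk1]) f s - f tk * (t / n%:R)|
    <= e * (t / n%:R).
  rewrite -mes -!Rintegral_cst// -RintegralB//.
  apply: (le_trans (le_normr_Rintegral _ _)) => //.
    exact: (integrableB (mitv _) i2 (cint _)).
  apply: le_Rintegral => //.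
    exact: integrable_norm (integrableB (mitv _) i2 (cint _)).
  move=> s /=; rewrite in_itv/= => /andP[ks sk]; apply: fe.
  - by rewrite (le_trans tk0 (ltW ks)) (le_trans sk).
  - by rewrite tk0.
  - by rewrite ger0_norm ?subr_ge0 ?(ltW ks)// -dk lerD2r.
have -> : e * tk1 = e * tk + e * (t / n%:R) by rewrite -dk; ring.
rewrite (_ : _ - _ = (\int[lebesgue_measure]_(s in `[0, tk]) f s -
    \sum_(i < k) f (gridt t n i) * (t / n%:R)) +
   (\int[lebesgue_measure]_(s in `]tk, tk1]) f s - f tk * (t / n%:R))); last by ring.
by rewrite (le_trans (ler_normD _ _))// lerD// IH// ltnW.
Qed.

Hypothesis Ms0 : 0 <= Ms.

Lemma grid_coef_measurable n i :
  measurable_wrt (F (gridt t n i)) (fun w => clip sg (X (gridt t n i) w)).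
Proof.
apply: (adapted_comp (measurable_clip csg)).
by apply: gridt_ge0; exact: ltW.
Qed.

Lemma grid_coef_bounded n i :
  exists M : R, forall w, `|clip sg (X (gridt t n i) w)| <= M.
Proof. by exists Ms => w; exact: clip_bounded. Qed.

(** The noise part of [euler] as a simple process, so that Lenglart's inequality can compare it with
    approximants of the Ito integral. *)
Definition grid_process n : simple_process F := @SimpleProcess _ _ _ F n (gridt t n)
  (fun i w => clip sg (X (gridt t n i) w)) (gridt_ge0 n (ltW t0) 0)
  (fun i j => @gridt_le _ t n (ltW t0) i j) (@grid_coef_measurable n) (grid_coef_bounded n).

Lemma simple_integral_grid_process n k w : (k <= n)%N ->
  simple_integral B (grid_process n) (gridt t n k) w =
  \sum_(i < k) clip sg (X (gridt t n i) w) *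
     (B (gridt t n i.+1) w - B (gridt t n i) w).
Proof.
move=> kn; rewrite /simple_integral /=.
have gle i j : (i <= j)%N -> gridt t n i <= gridt t n j by apply: gridt_le; exact: ltW.
rewrite (big_ord_widen_cond n xpredT (fun i => clip sg (X (gridt t n i) w) *
  (B (gridt t n i.+1) w - B (gridt t n i) w)) kn).
rewrite (bigID (fun i : 'I_n => (i < k)%N))/= [X in _ + X]big1 ?addr0 => [|i].
  by apply: eq_bigr => i ik; rewrite !min_r ?gle// ltnW.
by rewrite -leqNgt => ki; rewrite !min_l ?gle ?leqW// subrr mulr0.
Qed.

Lemma grid_process_close n (e2 : R) w : (0 < n)%N ->
  (forall s, 0 <= s <= t -> eta <= X s w <= N) ->
  (forall s s', 0 <= s <= t -> 0 <= s' <= t -> `|s - s'| <= t / n%:R ->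
     `|sg (X s w) - sg (X s' w)| <= e2) ->
  (\int[lebesgue_measure]_(s in `[0%R, t])
    ((simple_eval (grid_process n) s w - sg (X s w)) ^+ 2)%:E
    <= (e2 ^+ 2 * t)%:E)%E.
Proof.
move=> n0 range md; have t0' := ltW t0.
have mH : measurable_fun (`[0, t]%classic : set R) (fun s => sg (X s w)).
  exact: (@measurable_path _ _ _ _ (continuous_path_comp csg)).
have mf : measurable_fun (`[0, t]%classic : set R)
    (fun s => (simple_eval (grid_process n) s w - sg (X s w)) ^+ 2).
  apply: measurable_funX; apply: measurable_funB => //.
  exact: measurable_funTS (measurable_simple_eval (grid_process n) w).
have sub : `]0, t]%classic `<=` (`[0, t]%classic : set R).
  by move=> s /=; rewrite !in_itv/= => /andP[/ltW -> ->].
rewrite -integral_itv_obnd_cbnd; last first.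
  by apply/measurable_EFinP; apply: measurable_funS sub mf; exact: measurable_itv.
apply: (@le_trans _ _ (\int[lebesgue_measure]_(s in `]0%R, t])
    (cst (e2 ^+ 2)%:E s))%E).
  apply: ge0_le_integral => //.
  - by move=> s _; rewrite lee_fin sqr_ge0.
  - by apply/measurable_EFinP; apply: measurable_funS sub mf; exact: measurable_itv.
  move=> s /=; rewrite in_itv/= => /andP[s0 st]; rewrite lee_fin.
  have sst : 0 < s <= t by rewrite s0.
  have [k kn ks] := gridt_cell n0 sst.
  rewrite /simple_eval /= (gridt_sum_indic t0'
    (fun i => clip sg (X (gridt t n i) w)) kn ks).
  have gk : 0 <= gridt t n k <= t by apply: gridt_itv => //; exact: ltnW.
  rewrite clip_in ?range//.
  have e20 : `|sg (X (gridt t n k) w) - sg (X s w)| <= e2.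
    apply: md => //; first by rewrite ltW.
    move: ks => /andP[ks sk].
    by rewrite distrC ger0_norm ?subr_ge0 ?(ltW ks)// -(gridtS t n k) lerD2r.
  rewrite -(real_normK (num_real (_ - _))) lerXn2r ?nnegrE//.
  exact: le_trans e20.
rewrite integral_cst// [leRHS]EFinM le_eqVlt; apply/orP; left; apply/eqP.
congr (_ * _)%E.
by apply: etrans (lebesgue_measure_itv `]0, t]) _; rewrite /= lte_fin t0 -EFinB subr0.
Qed.

(** Three errors of gam / 3: the Riemann sum of the drift, the noise of [euler] against the integral
    of an approximant h, and that integral against [J]. Both h and [grid_process] are close to
    sigma(X) in L^2, which is what Lenglart's inequality needs. *)
Lemma euler_close (gam kappa : R) : 0 < gam -> 0 < kappa ->
  exists n0, forall n, (n0 <= n)%N -> exists A : set T,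
    [/\ measurable A, fine (P A) <= kappa & forall w, ~ A w ->
      (forall s, 0 <= s <= t -> eta <= X s w <= N) ->
      forall k, (k <= n.+1)%N -> `|euler n.+1 k w - X (gridt t n.+1 k) w| <= gam].
Proof.
move=> gam0 kappa0; have t0' := ltW t0.
have g30 : 0 < gam / 3 by rewrite divr_gt0.
have k40 : 0 < kappa / 4 by rewrite divr_gt0.
(* Makes 4 theta / (gam / 3)^2 equal to kappa / 4; four bad events share kappa, namely the two
   moduli of continuity, the approximation by h and the Lenglart event. *)
pose theta := kappa / 4 * (gam / 3) ^+ 2 / 4.
have th0 : 0 < theta by rewrite divr_gt0// mulr_gt0// exprn_gt0.
pose e1 := gam / 3 / t.
have e10 : 0 < e1 by rewrite divr_gt0.
(* Oscillations of sigma(X) below e2 give a squared L^2 distance of at most e2^2 t = theta. *)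
pose e2 := Num.sqrt (theta / t).
have e20 : 0 < e2 by rewrite sqrtr_gt0 divr_gt0.
have e2t : e2 ^+ 2 * t = theta.
  by rewrite /e2 sqr_sqrtr; [rewrite divfK// gt_eqF|rewrite divr_ge0// ltW].
have ab := adapted_comp (continuous_measurable_fun cb).
have asg := adapted_comp (continuous_measurable_fun csg).
have pb := continuous_path_comp cb; have ps := continuous_path_comp csg.
have [r1 [E1 [r10 mE1 PE1 HE1]]] := modulus_event P hF ab (@pb) t0' e10 k40.
have [r2 [E2 [r20 mE2 PE2 HE2]]] := modulus_event P hF asg (@ps) t0' e20 k40.
have r0 : 0 < Num.min r1 r2 by rewrite lt_min r10.
have [n0 Hn0] := mesh_small t r0.
exists n0 => n /Hn0; rewrite le_min => /andP[nr1 nr2].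
have [J HJ] : {J : R -> T -> R & forall a, 0 <= a ->
    is_ito_integral P F B (fun s w => sg (X s w)) a (J a) /\
    {ae P, forall w, X a w = X 0 w + \int[lebesgue_measure]_(s in `[0, a]) b (X s w) + J a w}}.
  apply: (@choice _ _ (fun a J => 0 <= a -> is_ito_integral P F B
    (fun s w => sg (X s w)) a J /\ {ae P, forall w, X a w = X 0 w +
    \int[lebesgue_measure]_(s in `[0, a]) b (X s w) + J w})) => a.
  have [a0|a0] := boolP (0 <= a); last by exists (fun=> 0).
  by have [J HJ] := sde_equation hX a0; exists J.
have gk0 k : 0 <= gridt t n.+1 k by exact: gridt_ge0.
pose ts := [seq gridt t n.+1 k | k <- iota 0 n.+2].
have tsb a : a \in ts -> 0 <= a <= t.
  move=> /mapP[k]; rewrite mem_iota add0n ltnS => /= kn ->.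
  exact: gridt_itv.
have tsk k : (k <= n.+1)%N -> gridt t n.+1 k \in ts.
  by move=> kn; apply/mapP; exists k; rewrite // mem_iota add0n ltnS.
have em0 : 0 < Num.min theta (gam / 3) by rewrite lt_min th0.
have hJ a : 0 <= a <= t -> is_ito_integral P F B (fun s w => sg (X s w)) a (J a).
  by move=> /andP[a0 _]; exact: (HJ a a0).1.
have [h [A1 [mA1 PA1 HA1]]] :=
  ito_integral_grid_approx hF hB asg (@ps) t0' hJ tsb em0 k40.
have th40 : 0 <= 4 * theta by rewrite mulr_ge0// ltW.
have [A2 [mA2 PA2 HA2]] :=
  lenglart_simple hF hB h (grid_process n.+1) t0' g30 th40 tsb.
(* The equation holds almost surely at each fixed time; countably many grid times share one null
   set. *)
have [A3 [mA3 PA3 HA3]] : {ae P, forall w k, X (gridt t n.+1 k) w = X 0 w +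
    \int[lebesgue_measure]_(s in `[0, gridt t n.+1 k]) b (X s w) + J (gridt t n.+1 k) w}.
  by apply: ae_foralln => k; exact: (HJ _ (gk0 k)).2.
exists ((~` E1 `|` ~` E2) `|` ((A1 `|` A2) `|` A3)).
have mC1 := measurableC mE1; have mC2 := measurableC mE2.
split.
- by apply: measurableU; [exact: measurableU|apply: measurableU => //; exact: measurableU].
- have m12 := measurableU _ _ mC1 mC2; have mA12 := measurableU _ _ mA1 mA2.
  have mA123 := measurableU _ _ mA12 mA3.
  have := fine_probU P m12 mA123; have := fine_probU P mC1 mC2.
  have := fine_probU P mA12 mA3; have := fine_probU P mA1 mA2.
  have -> : fine (P A3) = 0 by rewrite PA3.
  have : 4 * theta / (gam / 3) ^+ 2 <= kappa / 4.
    by rewrite /theta ler_pdivrMr ?exprn_gt0//; lra.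
  by lra.
move=> w /not_orP[/not_orP[/contrapT w1 /contrapT w2] /not_orP[/not_orP[nA1 nA2] nA3]].
move=> range k kn.
have [Hw1 Hw2] := HA1 w nA1.
have Xk : X (gridt t n.+1 k) w = X 0 w +
    \int[lebesgue_measure]_(s in `[0, gridt t n.+1 k]) b (X s w) + J (gridt t n.+1 k) w.
  by move: k {kn}; apply: contrapT => c; apply: nA3; apply: HA3.
have md1 s s' : 0 <= s <= t -> 0 <= s' <= t -> `|s - s'| <= t / n.+1%:R ->
    `|b (X s w) - b (X s' w)| <= e1.
  by move=> st s't ss'; apply: (HE1 w w1) => //; exact: le_trans nr1.
have md2 s s' : 0 <= s <= t -> 0 <= s' <= t -> `|s - s'| <= t / n.+1%:R ->
    `|sg (X s w) - sg (X s' w)| <= e2.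
  by move=> st s't ss'; apply: (HE2 w w2) => //; exact: le_trans nr2.
have cbw : {within `[0, t], continuous (fun s => b (X s w))}.
  exact: (@within_path _ _ _ _ (@pb) t w).
have drift := riemann_sum_close (ltn0Sn n) cbw md1 kn.
have {}drift : `|\int[lebesgue_measure]_(s in `[0, gridt t n.+1 k]) b (X s w)
    - \sum_(i < k) b (X (gridt t n.+1 i) w) * (t / n.+1%:R)| <= gam / 3.
  apply: (le_trans drift); rewrite /e1 mulrAC ler_pdivrMr// ler_wpM2l ?(ltW g30)//.
  by have /andP[] := gridt_itv t0' (ltn0Sn n) kn.
have dist : (\int[lebesgue_measure]_(s in `[0%R, t])
    ((simple_eval h s w - simple_eval (grid_process n.+1) s w) ^+ 2)%:E
    <= (4 * theta)%:E)%E.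
  apply: (le_trans (@integral_sqB_triangle _ _ _ _ (fun s => sg (X s w)) _ _ _ _)) => //.
  - exact: measurable_funTS (measurable_simple_eval h w).
  - exact: measurable_funTS (measurable_simple_eval (grid_process n.+1) w).
  - exact: (@measurable_path _ _ _ _ (@ps)).
  have -> : ((4 * theta)%:E = 2%:E * theta%:E + 2%:E * theta%:E)%E.
    by rewrite -!EFinM -EFinD; congr EFin; ring.
  rewrite leeD// lee_pmul2l// ?lte_fin//.
    by rewrite (le_trans Hw1)// lee_fin ge_min lexx.
  by rewrite -e2t; exact: grid_process_close.
have noise : `|simple_integral B h (gridt t n.+1 k) w -
    simple_integral B (grid_process n.+1) (gridt t n.+1 k) w| < gam / 3.
  by rewrite ltNge; apply/negP => /(HA2 w dist _ (tsk k kn)).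
have ito : `|simple_integral B h (gridt t n.+1 k) w - J (gridt t n.+1 k) w| <= gam / 3.
  by rewrite (le_trans (Hw2 _ (tsk k kn)))// ge_min lexx orbT.
move: noise; rewrite (simple_integral_grid_process w kn) => noise.
have Yk : euler n.+1 k w = X 0 w +
    \sum_(i < k) b (X (gridt t n.+1 i) w) * (t / n.+1%:R) +
    \sum_(i < k) clip sg (X (gridt t n.+1 i) w) *
      (B (gridt t n.+1 i.+1) w - B (gridt t n.+1 i) w).
  rewrite /euler big_split/= addrA; congr (_ + _ + _).
  apply: eq_bigr => i _; rewrite clip_in// range//.
  by apply: gridt_itv => //; rewrite (leq_trans (ltnW (ltn_ord i))).
rewrite Yk Xk; clear -drift noise ito; move: drift noise ito.
by rewrite !ler_norml ltr_norml => /andP[? ?] /andP[? ?] /andP[? ?];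
  apply/andP; split; lra.
Qed.

End EulerScheme.

(** * Descent of the Lyapunov function *)

(** Here u is the drift part and v the noise part of an increment. Terms linear in v, including the
    cross term q u v, are kept exactly, as they will have mean zero; q v^2 / 2 is kept for the
    generator; the remaining powers are separated by convexity. *)
Lemma taylor_increment_bound (R : realFieldType) (g p q om K u v m2 U2 U4 V4 : R) :
  0 <= om -> 0 <= K -> 0 <= m2 -> q <= m2 ->
  u ^+ 2 <= U2 -> u ^+ 4 <= U4 -> v ^+ 4 <= V4 ->
  g <= p * (u + v) + q / 2 * (u + v) ^+ 2 + om * (u + v) ^+ 2 + K * (u + v) ^+ 4 ->
  g <= p * u + (p + q * u) * v + (q / 2 + 2 * om) * v ^+ 2 + 8 * K * V4
       + ((m2 / 2 + 2 * om) * U2 + 8 * K * U4).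
Proof.
move=> om0 K0 m20 qm u2 u4 v4 H.
have q2 : (u + v) ^+ 2 <= 2 * u ^+ 2 + 2 * v ^+ 2.
  by have := sqr_ge0 (u - v); lra.
have q4 : (u + v) ^+ 4 <= 8 * u ^+ 4 + 8 * v ^+ 4.
  have : ((u + v) ^+ 2) ^+ 2 <= (2 * u ^+ 2 + 2 * v ^+ 2) ^+ 2.
    by rewrite lerXn2r ?nnegrE ?sqr_ge0// addr_ge0// mulr_ge0 ?sqr_ge0.
  by have := sqr_ge0 (u ^+ 2 - v ^+ 2); lra.
have qu : q / 2 * u ^+ 2 <= m2 / 2 * U2.
  apply: (@le_trans _ _ (m2 / 2 * u ^+ 2)).
    by rewrite ler_wpM2r ?sqr_ge0// ler_wpM2r.
  by rewrite ler_wpM2l// divr_ge0.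
have := ler_wpM2l om0 q2; have := ler_wpM2l K0 q4.
have := ler_wpM2l K0 u4; have := ler_wpM2l K0 v4; have := ler_wpM2l om0 u2.
by lra.
Qed.

Section LyapunovDescent.
Context {R : realType} {d : measure_display} {T : measurableType d}.
Variables (P : probability T R) (F : R -> set (set T)) (B : R -> T -> R).
Hypotheses (hF : filtration F) (hB : brownian_motion P F B).
Variables (b sg : R -> R) (X : R -> T -> R).
Hypotheses (cb : continuous b) (csg : continuous sg).
Hypothesis hX : sde_solution P F B b sg X.
Variables (t eta N : R).
Hypothesis t0 : 0 < t.
Variables (Mb Ms : R).
Hypotheses (Mb0 : 0 <= Mb) (Ms0 : 0 <= Ms).
Hypothesis bM : forall y, eta <= y <= N -> `|b y| <= Mb.
Hypothesis sM : forall y, eta <= y <= N -> `|sg y| <= Ms.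
Variables (f f1 f2 : R -> R) (a0 b0 M1 M2 L gam c : R).
Hypotheses (mf : measurable_fun setT f) (mf1 : measurable_fun setT f1)
  (mf2 : measurable_fun setT f2).
Hypotheses (M10 : 0 <= M1) (M20 : 0 <= M2) (L0 : 0 <= L) (c0 : 0 <= c) (gam0 : 0 < gam).
Hypothesis f1M : forall y, a0 <= y <= b0 -> `|f1 y| <= M1.
Hypothesis f2M : forall y, a0 <= y <= b0 -> `|f2 y| <= M2.
Hypotheses (fle0 : forall y, f y <= 0) (fgeL : forall y, - L <= f y).
Hypothesis taylor : forall om, 0 < om -> exists2 K : R, 0 <= K &
  forall y h, a0 <= y <= b0 -> f (y + h) <=
    f y + f1 y * h + f2 y / 2 * h ^+ 2 + om * h ^+ 2 + K * h ^+ 4.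
Hypothesis nbh : forall x y, eta <= x <= N -> `|y - x| <= gam -> a0 <= y <= b0.
Hypothesis gen : forall x y, eta <= x <= N -> `|y - x| <= gam ->
  f1 y * b x + f2 y / 2 * sg x ^+ 2 <= - c.

Let fL y : `|f y| <= L.
Proof. by rewrite ler_norml fgeL (le_trans (fle0 y)). Qed.

Section Level.
Variable n : nat.
Local Notation tk k := (gridt t n.+1 k).
Local Notation dt := (t / n.+1%:R).
Local Notation Y k w := (euler B b sg X t eta N n.+1 k w).
Local Notation FT k := (g_sigma_algebraType (F (tk k))).

Let good k w := [&& eta <= X (tk k) w, X (tk k) w <= N &
  `|Y k w - X (tk k) w| <= gam].

(* The descent is only followed as long as X has stayed in [eta, N] and Y close
   to X, which is decided at time tk k. *)
Fixpoint alive k w := if k is k'.+1 then alive k' w && good k w else good 0%N w.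

Let alive_dec w k : alive k.+1 w -> alive k w. Proof. by case/andP. Qed.

Let alive_le i j w : (i <= j)%N -> alive j w -> alive i w.
Proof.
move=> /subnK <-; elim: (j - i)%N => [//|k IH].
by rewrite addSn => /alive_dec.
Qed.

Let alive_good k w : alive k w -> good k w.
Proof. by case: k => [//|k] /andP[]. Qed.

Let dt0 : 0 < dt. Proof. by rewrite divr_gt0// ltr0n. Qed.

Let tk0 k : 0 <= tk k. Proof. by apply: gridt_ge0; exact: ltW. Qed.

Let tk_le i j : (i <= j)%N -> tk i <= tk j. Proof. by apply: gridt_le; exact: ltW. Qed.

Let tk_lt k : tk k < tk k.+1. Proof. by rewrite -subr_gt0 gridtS. Qed.

Let sF k := filtration_sigma hF (tk0 k).

Let mono_FT i k (g : T -> R) : (i <= k)%N -> measurable_wrt (F (tk i)) g ->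
  measurable_fun setT (g : FT k -> R).
Proof.
move=> ik mg; apply/(measurable_wrtP (sF k)).
exact: (wrt_mono hF (tk0 i) (tk_le ik) mg).
Qed.

Let mX i k : (i <= k)%N -> measurable_fun setT (X (tk i) : FT k -> R).
Proof. by move=> ik; apply: (mono_FT ik); exact: (sde_adapted hX (tk0 i)). Qed.

Let mB i k : (i <= k)%N -> measurable_fun setT (B (tk i) : FT k -> R).
Proof. by move=> ik; apply: (mono_FT ik); exact: (brownian_adapted hB (tk0 i)). Qed.

Let mY i k : (i <= k)%N ->
  measurable_fun setT ((fun w => Y i w) : FT k -> R).
Proof.
move=> ik; apply: measurable_funD.
  by have := @mX 0 k (leq0n k); rewrite gridt0.
apply: measurable_sum => j.
have jk : (j <= k)%N by apply: leq_trans (ltnW (ltn_ord j)) ik.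
apply: measurable_funD; apply: measurable_funM => //.
- by apply: measurableT_comp (mX jk); exact: measurable_clip.
- by apply: measurableT_comp (mX jk); exact: measurable_clip.
- apply: measurable_funB; last exact: mB.
  by apply: mB; exact: leq_trans (ltn_ord j) ik.
Qed.

Let malive i k : (i <= k)%N -> measurable_fun setT (alive i : FT k -> bool).
Proof.
have mgood j : (j <= k)%N -> measurable_fun setT (good j : FT k -> bool).
  move=> jk; apply: measurable_and; first by apply: measurable_fun_ler => //; exact: mX.
  apply: measurable_and; apply: measurable_fun_ler => //; first exact: mX.
  apply: measurableT_comp; first exact: normr_measurable.
  by apply: measurable_funB; [exact: mY|exact: mX].
elim: i => [|i IH] ik; first exact: mgood.
by apply: measurable_and; [apply: IH; exact: ltnW|exact: mgood].
Qed.

Let wrtT k (g : T -> R) : measurable_fun setT (g : FT k -> R) -> measurable_fun setT g.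
Proof. by move=> /(measurable_wrtP (sF k)); exact: (wrt_measurable hF (tk0 k)). Qed.

Let ak k w : R := (alive k w)%:R.

Let mak k : measurable_fun setT (ak k : FT k -> R).
Proof. by apply: measurable_natr_bool; exact: malive. Qed.

Let ak1 k w : `|ak k w| <= 1.
Proof. by rewrite /ak; case: (alive k w); rewrite ?normr1 ?normr0. Qed.

Let iak k : P.-integrable setT (EFin \o ak k).
Proof. exact: bounded_integrable (@wrtT k _ (@mak k)) (ak1 k). Qed.

Lemma measurable_alive k : measurable [set w | alive k w].
Proof.
have -> : [set w | alive k w] = ak k @^-1` [set 1].
  apply/seteqP; split => w /=; rewrite /ak; first by move=> ->.
  by case: (alive k w) => // /eqP; rewrite eq_sym oner_eq0.
by rewrite -[X in measurable X]setTI; exact: (@wrtT k _ (@mak k) measurableT).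
Qed.

Let Eak k : \int[P]_w ak k w = fine (P [set w | alive k w]).
Proof.
rewrite -Rintegral_indicP; last exact: measurable_alive.
by apply: eq_Rintegral => w _; rewrite indicE mem_setE.
Qed.

Section Step.
Variables (om K : R) (k : nat).
Hypotheses (om0 : 0 < om) (K0 : 0 <= K) (dt1 : dt <= 1).
Hypothesis taylorK : forall y h, a0 <= y <= b0 -> f (y + h) <=
    f y + f1 y * h + f2 y / 2 * h ^+ 2 + om * h ^+ 2 + K * h ^+ 4.

Let D w := B (tk k.+1) w - B (tk k) w.
Let be w := clip eta N b (X (tk k) w).
Let s w := clip eta N sg (X (tk k) w).

Let beM w : `|be w| <= Mb. Proof. exact: clip_bounded. Qed.
Let sMs w : `|s w| <= Ms. Proof. exact: clip_bounded. Qed.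

(** The pieces of one Taylor step: [C0] collects the deterministic remainder in powers of dt, [c1]
    and [c2] multiply the Brownian increment and its square, and [e0] is the first-order drift. *)
Let C0 := (M2 / 2 + 2 * om) * Mb ^+ 2 * dt ^+ 2 + 8 * K * Mb ^+ 4 * dt ^+ 4.
Let c1 w := ak k w * (f1 (Y k w) * s w + f2 (Y k w) * (be w * dt) * s w).
Let c2 w := ak k w * ((f2 (Y k w) / 2 + 2 * om) * s w ^+ 2).
Let e0 w := ak k w * (f1 (Y k w) * (be w * dt)).

Let in_box w : alive k w -> a0 <= Y k w <= b0.
Proof. by move=> /alive_good /and3P[x1 x2 x3]; apply: nbh x3; rewrite x1. Qed.

Let f1Y w : alive k w -> `|f1 (Y k w)| <= M1.
Proof. by move=> /in_box; exact: f1M. Qed.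

Let f2Y w : alive k w -> `|f2 (Y k w)| <= M2.
Proof. by move=> /in_box; exact: f2M. Qed.

Let sqr_le (x M : R) : `|x| <= M -> x ^+ 2 <= M ^+ 2.
Proof.
move=> xM; rewrite -(real_normK (num_real x)) lerXn2r ?nnegrE//.
exact: le_trans xM.
Qed.

Let term_le w : ak k w * (f (Y k.+1 w) - f (Y k w)) <=
  e0 w + c1 w * D w + c2 w * D w ^+ 2 + 8 * K * Ms ^+ 4 * D w ^+ 4 + C0.
Proof.
have YS : Y k.+1 w = Y k w + (be w * dt + s w * D w).
  by rewrite /euler big_ord_recr/= addrA.
have K8 : 0 <= 8 * K by rewrite mulr_ge0.
have C00 : 0 <= C0.
  apply: addr_ge0; last by rewrite !mulr_ge0 ?exprn_ge0// ltW.
  apply: mulr_ge0; last by rewrite exprn_ge0// ltW.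
  by apply: mulr_ge0; [have := M20; have := om0; lra|exact: sqr_ge0].
have D40 : 0 <= 8 * K * Ms ^+ 4 * D w ^+ 4.
  by apply: mulr_ge0; [apply: mulr_ge0 => //|]; exact: exprn_even_ge0.
rewrite /e0 /c1 /c2 /ak; case: (boolP (alive k w)) => [al|_]; last first.
  by rewrite !mul0r !add0r addr_ge0.
rewrite !mul1r YS; set u := be w * dt; set v := s w * D w; set y := Y k w.
have := taylorK (u + v) (in_box al); rewrite -/y => TK.
have u2 : u ^+ 2 <= Mb ^+ 2 * dt ^+ 2.
  by rewrite /u exprMn ler_wpM2r ?sqr_ge0// sqr_le.
have u4 : u ^+ 4 <= Mb ^+ 4 * dt ^+ 4.
  have e4 (x : R) : x ^+ 4 = (x ^+ 2) ^+ 2 by rewrite -exprM.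
  by rewrite /u exprMn ler_wpM2r ?exprn_even_ge0// !e4 lerXn2r ?nnegrE ?sqr_ge0 ?sqr_le.
have v4 : v ^+ 4 <= Ms ^+ 4 * D w ^+ 4.
  have e4 (x : R) : x ^+ 4 = (x ^+ 2) ^+ 2 by rewrite -exprM.
  by rewrite /v exprMn ler_wpM2r ?exprn_even_ge0// !e4 lerXn2r ?nnegrE ?sqr_ge0 ?sqr_le.
have f2m : f2 y <= M2 by exact: le_trans (ler_norm _) (f2Y al).
have TK' : f (y + (u + v)) - f y <= f1 y * (u + v) + f2 y / 2 * (u + v) ^+ 2
    + om * (u + v) ^+ 2 + K * (u + v) ^+ 4.
  by rewrite lerBlDl (le_trans TK)// -!addrA.
have := taylor_increment_bound (ltW om0) K0 M20 f2m u2 u4 v4 TK'.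
move=> /le_trans; apply; rewrite le_eqVlt; apply/orP; left; apply/eqP.
by rewrite /C0 /v; ring.
Qed.

Let meas_be : measurable_fun setT (be : FT k -> R).
Proof. by apply: measurableT_comp (mX (leqnn k)); exact: measurable_clip. Qed.

Let meas_s : measurable_fun setT (s : FT k -> R).
Proof. by apply: measurableT_comp (mX (leqnn k)); exact: measurable_clip. Qed.

Let meas_f1 : measurable_fun setT ((fun w => f1 (Y k w)) : FT k -> R).
Proof. by apply: measurableT_comp (@mY k k (leqnn k)). Qed.

Let meas_f2 : measurable_fun setT ((fun w => f2 (Y k w)) : FT k -> R).
Proof. by apply: measurableT_comp (@mY k k (leqnn k)). Qed.

Let mc1 : measurable_wrt (F (tk k)) c1.
Proof.
apply/(measurable_wrtP (sF k)); apply: measurable_funM; first exact: mak.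
apply: measurable_funD; first exact: measurable_funM.
apply: measurable_funM => //; apply: measurable_funM => //.
exact: measurable_funM.
Qed.

Let mc2 : measurable_wrt (F (tk k)) c2.
Proof.
apply/(measurable_wrtP (sF k)); apply: measurable_funM; first exact: mak.
apply: measurable_funM; last exact: measurable_funX.
by apply: measurable_funD => //; exact: measurable_funM.
Qed.

Let me0 : measurable_fun setT (e0 : FT k -> R).
Proof.
apply: measurable_funM; first exact: mak.
by apply: measurable_funM => //; exact: measurable_funM.
Qed.

Let ak_norm (M g : R) w : 0 <= M -> (alive k w -> `|g| <= M) -> `|ak k w * g| <= M.
Proof.
rewrite /ak; case: (alive k w) => M0 gM; first by rewrite mul1r gM.
by rewrite mul0r normr0.
Qed.

Let beD w : `|be w * dt| <= Mb * dt.
Proof. by rewrite normrM (gtr0_norm dt0) ler_wpM2r// ltW. Qed.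

Let c1M w : `|c1 w| <= M1 * Ms + M2 * (Mb * dt) * Ms.
Proof.
have MD : 0 <= Mb * dt by rewrite mulr_ge0// ltW.
apply: ak_norm => [|al].
  by apply: addr_ge0; [exact: mulr_ge0|apply: mulr_ge0 => //; exact: mulr_ge0].
rewrite (le_trans (ler_normD _ _))// lerD//.
  by rewrite normrM; apply: ler_pM => //; exact: f1Y.
rewrite normrM; apply: ler_pM => //.
by rewrite normrM; apply: ler_pM => //; exact: f2Y.
Qed.

Let c2M w : `|c2 w| <= (M2 / 2 + 2 * om) * Ms ^+ 2.
Proof.
have MD : 0 <= M2 / 2 + 2 * om by have := M20; have := om0; lra.
apply: ak_norm => [|al]; first by rewrite mulr_ge0// sqr_ge0.
rewrite normrM ler_pM//.
  rewrite (le_trans (ler_normD _ _))// lerD//.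
    by rewrite normrM (ger0_norm (_ : 0 <= 2^-1))// ler_wpM2r// f2Y.
  by rewrite ger0_norm// mulr_ge0// ltW.
by rewrite normrX lerXn2r ?nnegrE ?sMs.
Qed.

Let e0M w : `|e0 w| <= M1 * (Mb * dt).
Proof.
have MD : 0 <= Mb * dt by rewrite mulr_ge0// ltW.
apply: ak_norm => [|al]; first by rewrite mulr_ge0.
by rewrite normrM; apply: ler_pM => //; exact: f1Y.
Qed.

Let i1 := integrable_mul_increment hF hB (tk0 k) (tk_lt k) mc1 c1M.
Let i2 := integrable_mul_increment2 hF hB (tk0 k) (tk_lt k) mc2 c2M.

Let mcst (a : R) : measurable_wrt (F (tk k)) (fun _ => a).
Proof. by apply/(measurable_wrtP (sF k)). Qed.

Let C4 := 8 * K * Ms ^+ 4.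
Let C4M (w : T) : `|C4| <= C4.
Proof.
by rewrite ger0_norm// mulr_ge0 ?exprn_even_ge0// mulr_ge0.
Qed.

Let i4 := integrable_mul_increment4 hF hB (tk0 k) (tk_lt k) (@mcst C4) C4M.

Let ie0 : P.-integrable setT (EFin \o e0).
Proof. exact: bounded_integrable (@wrtT k _ me0) e0M. Qed.

Let ic2 : P.-integrable setT (EFin \o c2).
Proof. exact: bounded_integrable (wrt_measurable hF (tk0 k) mc2) c2M. Qed.

Let icst (a : R) : P.-integrable setT (EFin \o (fun _ => a)).
Proof. exact: finite_measure_integrable_cst. Qed.

Let mfY j : measurable_fun setT (fun w => f (Y j w)).
Proof. by apply: measurableT_comp => //; apply: (@wrtT j); exact: mY. Qed.

Let term w := ak k w * (f (Y k.+1 w) - f (Y k w)).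

Lemma integrable_descent_term : P.-integrable setT (EFin \o term).
Proof.
have mt : measurable_fun setT term.
  apply: measurable_funM; first exact: (@wrtT k _ (@mak k)).
  exact: measurable_funB.
have termM w : `|term w| <= 2 * L.
  apply: ak_norm => [|_]; first by rewrite mulr_ge0.
  by rewrite (le_trans (ler_normB _ _))// (le_trans (lerD (fL _) (fL _)))//; lra.
exact: bounded_integrable mt termM.
Qed.

(** In expectation the [c1] term vanishes and the squared increment in the [c2] term becomes dt, so
    [e0] and [c2] together form dt times the generator plus the 2 om error. Everything else is
    O(dt^2), the fourth moment contributing 8 K Ms^4 times 4 e^2 dt^2. *)
Lemma descent_step : \int[P]_w term w <=
  dt * (- c * fine (P [set w | alive k w]) + 2 * om * Ms ^+ 2
    + ((M2 / 2 + 2 * om) * Mb ^+ 2 + 8 * K * Mb ^+ 4 + 32 * K * Ms ^+ 4 * expR 2) * dt).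
Proof.
have i12 := integrableDr ie0 i1.
have i123 := integrableDr i12 i2.
have i1234 := integrableDr i123 i4.
have iall := integrableDr i1234 (icst C0).
apply: (@le_trans _ _ (\int[P]_w (e0 w + c1 w * D w + c2 w * D w ^+ 2
    + C4 * D w ^+ 4 + C0))).
  apply: (le_Rintegral measurableT integrable_descent_term iall) => w _.
  exact: term_le.
rewrite (RintegralD measurableT i1234 (icst C0)) (RintegralD measurableT i123 i4).
rewrite (RintegralD measurableT i12 i2) (RintegralD measurableT ie0 i1).
rewrite (Rintegral_mul_increment hF hB (tk0 k) (tk_lt k) mc1 c1M) addr0.
rewrite (Rintegral_mul_increment2 hF hB (tk0 k) (tk_lt k) mc2 c2M).
rewrite Rintegral_Pcst.
have d1 : tk k.+1 - tk k <= 1 by rewrite gridtS.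
have := Rintegral_mul_increment4 hF hB (tk0 k) (tk_lt k) (@mcst C4) C4M d1.
rewrite gridtS -/(D _) => E4.
(* Pointwise comparison: while alive, X is in [eta, N], so clipping is inactive and [gen] applies;
   afterwards the left side is 0. *)
have E02 : \int[P]_w e0 w + (\int[P]_w c2 w) * dt <=
    dt * (- c * fine (P [set w | alive k w]) + 2 * om * Ms ^+ 2).
  rewrite -(RintegralZr dt measurableT ic2).
  have ic2d : P.-integrable setT (EFin \o (fun w => c2 w * dt)).
    by under eq_fun do rewrite mulrC; exact: integrableZl_real.
  rewrite -(RintegralD measurableT ie0 ic2d) -Eak.
  have iac : P.-integrable setT (EFin \o (fun w => (- (c * dt)) * ak k w)).
    exact: integrableZl_real.
  have -> : dt * (- c * (\int[P]_w ak k w) + 2 * om * Ms ^+ 2) =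
      \int[P]_w ((- (c * dt)) * ak k w + dt * (2 * om * Ms ^+ 2)).
    rewrite (RintegralD measurableT iac (icst _)) Rintegral_Pcst.
    rewrite (RintegralZl (- (c * dt)) measurableT (@iak k)).
    by ring.
  apply: le_Rintegral => //.
  - exact: integrableDr ie0 ic2d.
  - exact: integrableDr iac (icst _).
  move=> w _; rewrite /e0 /c2 /ak; case: (boolP (alive k w)) => [al|_]; last first.
    rewrite !mul0r mulr0 !add0r; apply: mulr_ge0; first exact: ltW.
    by apply: mulr_ge0; [rewrite mulr_ge0// ltW|exact: sqr_ge0].
  have /and3P[x1 x2 x3] := alive_good al.
  have x12 : eta <= X (tk k) w <= N by rewrite x1.
  rewrite !mul1r mulr1 /be /s !clip_in//.
  have g := gen x12 x3.
  have s2 : om * sg (X (tk k) w) ^+ 2 <= om * Ms ^+ 2.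
    by rewrite ler_wpM2l ?(ltW om0)// sqr_le// sM.
  have := ler_wpM2l (ltW dt0) (lerD g (lerD s2 s2)).
  set y := Y k w; set x := X (tk k) w.
  have -> : dt * (f1 y * b x + f2 y / 2 * sg x ^+ 2 + (om * sg x ^+ 2 + om * sg x ^+ 2))
    = f1 y * (b x * dt) + (f2 y / 2 + 2 * om) * sg x ^+ 2 * dt by ring.
  by move=> /le_trans; apply; rewrite le_eqVlt; apply/orP; left; apply/eqP; ring.
have d4 : dt ^+ 4 <= dt ^+ 2.
  rewrite (_ : dt ^+ 4 = dt ^+ 2 * dt ^+ 2); last by rewrite -exprD.
  by rewrite ler_piMl ?sqr_ge0// exprn_ile1// ltW.
have C0le : C0 <= ((M2 / 2 + 2 * om) * Mb ^+ 2 + 8 * K * Mb ^+ 4) * dt ^+ 2.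
  rewrite /C0 [leRHS]mulrDl lerD2l ler_wpM2l// mulr_ge0 ?exprn_even_ge0//.
  by rewrite mulr_ge0.
have rhsE : dt * (- c * fine (P [set w | alive k w]) + 2 * om * Ms ^+ 2
    + ((M2 / 2 + 2 * om) * Mb ^+ 2 + 8 * K * Mb ^+ 4 + 32 * K * Ms ^+ 4 * expR 2) * dt)
  = dt * (- c * fine (P [set w | alive k w]) + 2 * om * Ms ^+ 2)
    + C4 * (4 * expR 2 * dt ^+ 2)
    + ((M2 / 2 + 2 * om) * Mb ^+ 2 + 8 * K * Mb ^+ 4) * dt ^+ 2.
  by rewrite /C4; ring.
by rewrite rhsE; apply: lerD => //; apply: lerD.
Qed.

End Step.

(** Summed over the cells, the alive increments telescope to f at a stopping index minus f at 0,
    which is at least - L. In the upper bound every alive probability is replaced by the last one,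
    the smallest. *)
Lemma descent_level (om K : R) : 0 < om -> 0 <= K -> dt <= 1 ->
  (forall y h, a0 <= y <= b0 -> f (y + h) <=
    f y + f1 y * h + f2 y / 2 * h ^+ 2 + om * h ^+ 2 + K * h ^+ 4) ->
  c * t * fine (P [set w | alive n.+1 w]) <= L + t * (2 * om * Ms ^+ 2
    + ((M2 / 2 + 2 * om) * Mb ^+ 2 + 8 * K * Mb ^+ 4 + 32 * K * Ms ^+ 4 * expR 2) * dt).
Proof.
move=> om0 K0 dt1 tay; set CK := _ + _ + 32 * K * _ * _.
pose term k w := ak k w * (f (Y k.+1 w) - f (Y k w)).
have iterm k : P.-integrable setT (EFin \o term k).
  exact: (@integrable_descent_term k).
have lower : - L <= \int[P]_w (\sum_(k < n.+1) term k w).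
  rewrite -[leLHS](Rintegral_Pcst P); apply: le_Rintegral => //.
  - exact: finite_measure_integrable_cst.
  - exact: (integrable_sumr (fun k (_ : (k < n.+1)%N) => iterm k)).
  move=> w _.
  have [tau [_ _ _ ->]] := @stopped_sum R (alive ^~ w) (fun k => f (Y k w)) n.+1
    (@alive_dec w).
  by have := fgeL (Y tau w); have := fle0 (Y 0 w); lra.
have upper : \int[P]_w (\sum_(k < n.+1) term k w) <= \sum_(k < n.+1)
    dt * (- c * fine (P [set w | alive n.+1 w]) + 2 * om * Ms ^+ 2 + CK * dt).
  rewrite (Rintegral_sumr (fun k (_ : (k < n.+1)%N) => iterm k)).
  apply: ler_sum => k _; apply: (le_trans (descent_step k om0 K0 dt1 tay)).
  rewrite ler_wpM2l ?(ltW dt0)// lerD2r lerD2r !mulNr lerN2 ler_wpM2l//.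
  apply: fine_prob_le; [exact: measurable_alive|exact: measurable_alive|].
  by move=> w; exact: alive_le (ltnW (ltn_ord k)).
have sumE (z : R) : \sum_(k < n.+1) dt * z = t * z.
  rewrite sumr_const card_ord -(mulr_natr (dt * z)) mulrAC.
  by rewrite divfK// pnatr_eq0.
move: (le_trans lower upper); rewrite sumE.
set p := fine _; set q := 2 * om * _; set z := CK * _.
by clearbody p q z; lra.
Qed.

End Level.

(** The error e is spent in thirds on the Taylor error om, on the probability that Y separates from
    X, and on the O(dt) remainder. As K depends on om, the mesh is chosen last. *)
Lemma lyapunov_descent :
  c * t * fine (P [set w | forall s, 0 <= s <= t -> eta <= X s w <= N]) <= L.
Proof.
have mR : measurable [set w | forall s, 0 <= s <= t -> eta <= X s w <= N].
  apply: (measurable_range_event hF (sde_adapted hX)); last exact: ltW.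
  by move=> w; exact: (sde_continuous hX).
apply/ler_addgt0Pr => e e0.
have ct0 : 0 <= c * t by rewrite mulr_ge0// ltW.
(* The 1 added to Ms^2, like those added to c t and to [CK] below, only keeps a denominator
   positive. *)
pose om := e / 3 / (2 * t * (Ms ^+ 2 + 1)).
have Mp : 0 < Ms ^+ 2 + 1 by rewrite ltr_pwDr// sqr_ge0.
have om0 : 0 < om by rewrite !divr_gt0// !mulr_gt0.
have omE : t * (2 * om * Ms ^+ 2) <= e / 3.
  have -> : t * (2 * om * Ms ^+ 2) = e / 3 * (Ms ^+ 2 / (Ms ^+ 2 + 1)).
    by rewrite /om; field; rewrite !gt_eqF.
  by rewrite ler_piMr ?divr_ge0 ?(ltW e0)// ler_pdivrMr// mul1r lerDl.
have [K K0 tay] := taylor om0.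
set CK := (M2 / 2 + 2 * om) * Mb ^+ 2 + 8 * K * Mb ^+ 4 + 32 * K * Ms ^+ 4 * expR 2.
have CK0 : 0 <= CK.
  rewrite /CK !addr_ge0//.
  - by rewrite mulr_ge0 ?sqr_ge0// addr_ge0 ?divr_ge0// mulr_ge0// ltW.
  - by rewrite !mulr_ge0 ?exprn_even_ge0.
  - by rewrite !mulr_ge0 ?exprn_even_ge0 ?expR_ge0.
pose kap := e / 3 / (c * t + 1).
have kap0 : 0 < kap by rewrite !divr_gt0// ltr_pwDr.
have [n1 Hn1] := euler_close hF hB cb csg hX t0 sM Ms0 gam0 kap0.
pose r := Num.min 1 (e / 3 / (t * (CK + 1))).
have r0 : 0 < r by rewrite lt_min ltr01 !divr_gt0// mulr_gt0// ltr_pwDr.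
have [n2 Hn2] := mesh_small t r0.
pose n := maxn n1 n2.
have := Hn2 n (leq_maxr _ _); rewrite le_min => /andP[dt1 dtr].
have [A [mA PA HA]] := Hn1 n (leq_maxl _ _).
have lev := descent_level om0 K0 dt1 tay.
(* Outside A, a path that stays in [eta, N] is close to its Euler sum at all grid times, hence alive
   at the end. *)
have PR : fine (P [set w | forall s, 0 <= s <= t -> eta <= X s w <= N]) <=
    kap + fine (P [set w | alive n n.+1 w]).
  apply: (@le_trans _ _ (fine (P (A `|` [set w | alive n n.+1 w])))).
    apply: fine_prob_le => //.
      by apply: measurableU => //; exact: measurable_alive.
    move=> w range; have [|nAw] := pselect (A w); [by left|right => /=].
    have good k : (k <= n.+1)%N -> [&& eta <= X (gridt t n.+1 k) w,
        X (gridt t n.+1 k) w <= N &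
        `|euler B b sg X t eta N n.+1 k w - X (gridt t n.+1 k) w| <= gam].
      move=> kn; have /andP[-> ->] := range _ (gridt_itv (ltW t0) (ltn0Sn n) kn).
      exact: HA.
    have alv m : (m <= n.+1)%N -> alive n m w.
      elim: m => [|m IH] mn; first exact: good.
      by apply/andP; split; [apply: IH; exact: ltnW|exact: good].
    exact: (alv n.+1 (leqnn _)).
  rewrite (le_trans (fine_probU P mA (measurable_alive _ _)))//; last by rewrite lerD2r.
have h1 := ler_wpM2l ct0 PR; rewrite mulrDr in h1.
have ctk : c * t * kap <= e / 3.
  rewrite /kap mulrCA ler_piMr ?divr_ge0 ?(ltW e0)//.
  by rewrite ler_pdivrMr ?ltr_pwDr// mul1r lerDl.
have CKt : t * (CK * (t / n.+1%:R)) <= e / 3.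
  apply: (@le_trans _ _ (t * ((CK + 1) * (t / n.+1%:R)))).
    by rewrite ler_wpM2l ?(ltW t0)// ler_wpM2r ?divr_ge0 ?(ltW t0)// lerDl.
  rewrite mulrA [_ * (t / _)]mulrC -ler_pdivlMr// mulr_gt0// ltr_pwDr//.
rewrite -/CK (mulrDr t) in lev; move: lev h1 ctk CKt omE.
set x1 := t * (CK * _); set x2 := t * (2 * om * _); clearbody x1 x2 => *; lra.
Qed.

End LyapunovDescent.

(** * Extinction *)

Section Extinction.
Context {R : realType}.
Variables (lambda mu alpha rho : R).
Hypotheses (hlambda : 0 < lambda) (hmu : 0 < mu) (halpha : 0 < alpha) (hrho : 0 < rho).

Let b (y : R) : R := (lambda - mu - alpha * y) * y.
Let sg (y : R) : R := rho * Num.sqrt ((lambda + mu + alpha * y) * y).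

Let cM (g h : R -> R) (y : R) : {for y, continuous g} -> {for y, continuous h} ->
  {for y, continuous (fun u => g u * h u)}.
Proof. by move=> cg ch; exact: continuousM. Qed.

Let cD (g h : R -> R) (y : R) : {for y, continuous g} -> {for y, continuous h} ->
  {for y, continuous (fun u => g u + h u)}.
Proof. by move=> cg ch; exact: continuousD. Qed.

Let cc (a y : R) : {for y, continuous (fun _ : R => a)}.
Proof. exact: cst_continuous. Qed.

Let ci (y : R) : {for y, continuous (fun u : R => u)}.
Proof. exact: cvg_id. Qed.

Let caff (p q y : R) : {for y, continuous (fun u => (p + q * u) * u)}.
Proof. by apply: cM => //; apply: cD => //; exact: cM. Qed.

Let cb : continuous b.
Proof.
have -> : b = fun u => (lambda - mu + - alpha * u) * u.
  by apply/funext => u; rewrite mulNr.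
by move=> y; exact: caff.
Qed.

Let csg : continuous sg.
Proof.
move=> y; apply: (@cM (fun=> rho) (fun u => Num.sqrt ((lambda + mu + alpha * u) * u))).
  exact: cc.
apply: (@continuous_comp _ _ _ (fun u : R => (lambda + mu + alpha * u) * u)).
  exact: caff.
exact: sqrt_continuous.
Qed.

Let sgE y : 0 <= y -> sg y ^+ 2 = rho ^+ 2 * ((lambda + mu + alpha * y) * y).
Proof.
move=> y0; rewrite exprMn sqr_sqrtr// mulr_ge0// addr_ge0 ?mulr_ge0 ?(ltW halpha)//.
by rewrite addr_ge0// ltW.
Qed.

Let measurable_clipped (f : R -> R) (a : R) : 0 < a ->
  (forall y, 0 < y -> {for y, continuous f}) ->
  measurable_fun setT (fun y : R => f (Num.max y a)).
Proof.
move=> a0 cf; apply: continuous_measurable_fun => y.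
apply: (@continuous_comp _ _ _ (fun u : R => Num.max u a) f).
  by apply: continuous_max; [exact: cvg_id|exact: cvg_cst].
by apply: cf; rewrite lt_max a0 orbT.
Qed.

Let measurable_lyap (k : R) : measurable_fun setT (lyap k).
Proof.
apply: continuous_measurable_fun => y.
suff cE : {for y, continuous (fun u : R => expR (k / (1 + Num.sqrt u)))}.
  exact: continuousN cE.
apply: (@continuous_comp _ _ _ (fun u : R => k / (1 + Num.sqrt u)) expR); last first.
  exact: continuous_expR.
apply: (@cM (fun=> k) (fun u => (1 + Num.sqrt u)^-1)); first exact: cc.
apply: (@continuousV _ _ (fun u : R => 1 + Num.sqrt u)).
  by rewrite gt_eqF// ltr_pwDl// sqrtr_ge0.
by apply: (@cD (fun=> 1) Num.sqrt); [exact: cc|exact: sqrt_continuous].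
Qed.

Section Process.
Context {d : measure_display} {T : measurableType d}.
Variables (P : probability T R) (F : R -> set (set T)) (B X : R -> T -> R).
Hypotheses (hF : filtration F) (hB : brownian_motion P F B).
Hypothesis hX : sde_solution P F B b sg X.

(** k and c are fixed before t, eta and N, which is why C depends on none of them. Half of c is
    given up for evaluating derivatives and coefficients at different points. *)
Lemma occupation_bound : exists2 C : R, 0 <= C & forall t eta N : R,
  0 < t -> 0 < eta -> eta <= N ->
  fine (P [set w | forall s, 0 <= s <= t -> eta <= X s w <= N]) <= C / t.
Proof.
have [k [c [k0 c0 gen]]] := lyap_generator hlambda hmu halpha hrho.
exists (expR k / (c / 2)) => [|t eta N t0 eta0 etaN].
  by rewrite divr_ge0 ?expR_ge0 ?divr_ge0// ltW.
have a0 : 0 < eta / 2 by rewrite divr_gt0.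
have wc (g : R -> R) (u v : R) : 0 < u ->
    (forall y, 0 < y -> {for y, continuous g}) -> {within `[u, v], continuous g}.
  move=> u0 cg; apply: continuous_in_subspaceT => y.
  by rewrite inE/= in_itv/= => /andP[uy _]; apply: cg; exact: lt_le_trans uy.
have ab : eta / 2 <= N + 1 by lra.
have [Mb Mb0 bM] := within_continuous_bounded etaN (wc b eta N eta0 (fun y _ => @cb y)).
have [Ms Ms0 sM] := within_continuous_bounded etaN (wc sg eta N eta0 (fun y _ => @csg y)).
have cl1 := @continuous_lyap1 R k; have cl2 := @continuous_lyap2 R k.
have [M1 M10 f1M] := within_continuous_bounded ab (wc _ _ _ a0 cl1).
have [M2 M20 f2M] := within_continuous_bounded ab (wc _ _ _ a0 cl2).
(* Moving the derivatives by at most e changes the generator by at most e (Mb + Ms^2 / 2), which the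
   choice of e brings below c / 2. *)
pose Q := Mb + Ms ^+ 2 / 2 + 1.
have Q0 : 0 < Q by rewrite ltr_pwDr// addr_ge0// divr_ge0// sqr_ge0.
pose e := c / 2 / Q.
have e0 : 0 < e by rewrite !divr_gt0.
have [r1 r10 u1] := within_continuous_uniformly (wc _ _ (N + 1) a0 cl1) e0.
have [r2 r20 u2] := within_continuous_uniformly (wc _ _ (N + 1) a0 cl2) e0.
(* r1 and r2 control the derivatives; eta / 2 and 1 keep y in [eta / 2, N + 1]. *)
pose gam := Num.min (Num.min r1 r2) (Num.min (eta / 2) 1).
have gam0 : 0 < gam by rewrite !lt_min r10 r20 a0 ltr01.
have gamP (z : R) : `|z| <= gam -> [/\ `|z| <= r1, `|z| <= r2, `|z| <= eta / 2 & `|z| <= 1].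
  by rewrite !le_min => /andP[/andP[-> ->] /andP[-> ->]].
have nbh x y : eta <= x <= N -> `|y - x| <= gam -> eta / 2 <= y <= N + 1.
  move=> /andP[H1 H2] /gamP[_ _]; rewrite !ler_norml => /andP[H3 _] /andP[_ H4].
  by apply/andP; split; lra.
have maxE y : eta / 2 <= y <= N + 1 -> Num.max y (eta / 2) = y.
  by move=> /andP[ay _]; rewrite max_l.
have k0' := ltW k0.
rewrite ler_pdivlMr// ler_pdivlMr ?divr_gt0// mulrC mulrA mulrAC.
(* Clipping the argument only serves to make the derivatives, singular at 0,
   measurable on the whole line. *)
apply: (@lyapunov_descent R d T P F B hF hB b sg X cb csg hX t eta N t0 Mb Ms Mb0 Ms0
  bM sM (lyap k) (fun y => lyap1 k (Num.max y (eta / 2)))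
  (fun y => lyap2 k (Num.max y (eta / 2))) (eta / 2) (N + 1) M1 M2 (expR k) gam).
- exact: measurable_lyap.
- exact: (measurable_clipped a0 cl1).
- exact: (measurable_clipped a0 cl2).
- exact: M10.
- exact: M20.
- exact: expR_ge0.
- by rewrite divr_ge0// ltW.
- exact: gam0.
- by move=> y yy; rewrite maxE// f1M.
- by move=> y yy; rewrite maxE// f2M.
- by move=> y; exact: lyap_le0.
- by move=> y; exact: lyap_ge.
- move=> om om0; have [K K0 HK] := lyap_taylor k0' a0 ab om0.
  by exists K => // y h yy; rewrite maxE//; exact: HK.
- exact: nbh.
move=> x y xx yx; rewrite maxE; last exact: nbh xx yx.
have [/andP[ex xN] yN] := (xx, nbh _ _ xx yx).
have x0 : 0 < x by exact: lt_le_trans eta0 ex.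
have xin : eta / 2 <= x <= N + 1 by apply: (nbh x x xx); rewrite subrr normr0 ltW.
have [z1 z2 _ _] := gamP _ yx.
have d1 : `|lyap1 k y - lyap1 k x| <= e by apply: u1; rewrite ?in_itv.
have d2 : `|lyap2 k y - lyap2 k x| <= e by apply: u2; rewrite ?in_itv.
have := gen x x0; rewrite -(sgE (ltW x0)) -/(b x) => G.
have h1 : (lyap1 k y - lyap1 k x) * b x <= e * Mb.
  by rewrite (le_trans (ler_norm _))// normrM ler_pM// bM.
have h2 : (lyap2 k y - lyap2 k x) / 2 * sg x ^+ 2 <= e / 2 * Ms ^+ 2.
  apply: (@le_trans _ _ (e / 2 * sg x ^+ 2)).
    rewrite ler_wpM2r ?sqr_ge0// ler_wpM2r//.
    exact: le_trans (ler_norm _) d2.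
  apply: ler_wpM2l; first by rewrite divr_ge0// ltW.
  by rewrite -[leLHS]real_normK ?num_real// lerXn2r ?nnegrE// sM.
have eQ : e * (Mb + Ms ^+ 2 / 2) <= c / 2.
  apply: (@le_trans _ _ (e * Q)); first by rewrite ler_wpM2l ?(ltW e0)// lerDl.
  by rewrite /e divfK// gt_eqF.
lra.
Qed.

Hypothesis hXge0 : forall (t : R) w, 0 <= t -> 0 <= X t w.
Hypothesis hXabs : forall (t : R) w, 0 <= t ->
  (hitting_time X 0 w <= t%:E)%E -> X t w = 0.

Let hit_le (s : R) w : 0 <= s -> X s w = 0 -> (hitting_time X 0 w <= s%:E)%E.
Proof. by move=> s0 Xs; apply: ereal_inf_lbound; exists s. Qed.

(** As 0 is absorbing, X_t > 0 forces the path to be positive on all of [0, t]; by compactness it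
    then stays in [1 / (m + 1), m + 1] for some m, where the uniform occupation bound applies. *)
Lemma survival_bound : exists2 C : R, 0 <= C & forall t : R, 0 < t ->
  fine (P [set w | 0 < X t w]) <= C / t.
Proof.
have [C C0 HC] := occupation_bound; exists C => // t t0.
have t0' := ltW t0.
have mX : measurable_fun setT (X t) by exact: (measurable_adapted hF (sde_adapted hX)).
have mpos : measurable [set w | 0 < X t w].
  by apply: measurable_true_set; exact: measurable_fun_ltr.
pose E m := [set w | forall s, 0 <= s <= t -> m.+1%:R^-1 <= X s w <= m.+1%:R].
have mE m : measurable (E m).
  apply: (measurable_range_event hF (sde_adapted hX)) => // w.
  exact: (sde_continuous hX).
(* Adding the paths already extinct at t makes these events exhaust the whole space. *)
have mEC m : measurable (E m `|` ~` [set w | 0 < X t w]).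
  by apply: measurableU => //; exact: measurableC.
apply/ler_addgt0Pr => kappa kappa0.
have [m|w|m Pm] := prob_exhaust P mEC _ _ kappa0.
- apply: setSU => w Ew s /Ew /andP[X1 X2]; apply/andP; split.
    by rewrite (le_trans _ X1)// lef_pV2 ?posrE// ler_nat.
  by rewrite (le_trans X2)// ler_nat.
- have [Xt|nXt] := pselect (0 < X t w); last by exists 0%N; right.
  have cX : {within `[0, t], continuous (X ^~ w)}.
    apply: (@within_path _ _ _ X) => w'; exact: (sde_continuous hX).
  have [s0 s0t Hmin] := EVT_min t0' cX.
  have [s1 s1t Hmax] := EVT_max t0' cX.
  have Xs0 : 0 < X s0 w.
    move: s0t; rewrite in_itv/= => /andP[s00 s0t].
    rewrite lt_neqAle hXge0// andbT eq_sym; apply/eqP => Xs.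
    have : X t w = 0.
      by apply: hXabs => //; apply: (le_trans (hit_le s00 Xs)); rewrite lee_fin.
    by move=> Xt0; rewrite Xt0 ltxx in Xt.
  pose m := maxn (Num.truncn (X s0 w)^-1) (Num.truncn (X s1 w)).
  exists m; left => s st.
  have sin : s \in `[0, t] by rewrite in_itv.
  apply/andP; split.
    apply: le_trans (Hmin s sin); rewrite invf_ple ?posrE//.
    rewrite (le_trans (ltW (truncnS_gt _)))// ler_nat ltnS leq_maxl//.
  apply: le_trans (Hmax s sin) _.
  by rewrite (le_trans (ltW (truncnS_gt _)))// ler_nat ltnS leq_maxr.
apply: (@le_trans _ _ (fine (P (E m `|` ~` (E m `|` ~` [set w | 0 < X t w]))))).
  apply: fine_prob_le => //; first by apply: measurableU => //; exact: measurableC.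
  move=> w Xw; have [Ew|nEw] := pselect (E m w); first by left.
  by right => -[//|]; exact.
apply: (le_trans (fine_probU P (mE m) (measurableC (mEC m)))); rewrite lerD//.
apply: HC => //.
by rewrite (le_trans (_ : _ <= 1))// ?invf_le1// ler1n.
Qed.

Lemma extinction_as : P [set w | (hitting_time X 0 w < +oo)%E] = 1%E.
Proof.
have [C C0 HC] := survival_bound.
set S := [set w | _].
have mpos (t : R) : 0 <= t -> measurable [set w | 0 < X t w].
  move=> t0; apply: measurable_true_set; apply: measurable_fun_ltr => //.
  exact: (measurable_adapted hF (sde_adapted hX)).
(* By absorption, extinction in finite time means extinction at some integer time; this also gives
   measurability. *)
have SE : S = \bigcup_n ~` [set w | 0 < X n%:R w].
  apply/seteqP; split => w.
    move=> /ereal_inf_lt[_ [s [s0 Xs] <-] _].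
    exists (Num.truncn s).+1 => //= /lt0r_neq0 /eqP; apply.
    apply: hXabs => //; apply: (le_trans (hit_le s0 Xs)).
    by rewrite lee_fin ltW// truncnS_gt.
  move=> [n _ /= /negP]; rewrite -leNgt => Xn.
  apply: (@le_lt_trans _ _ n%:R%:E); last exact: ltry.
  by apply: hit_le => //; apply/eqP; rewrite eq_le Xn hXge0.
have mS : measurable S.
  by rewrite SE; apply: bigcupT_measurable => n; apply: measurableC; exact: mpos.
have PSC : fine (P (~` S)) <= 0.
  apply/ler_addgt0Pr => e e0; rewrite add0r.
  (* An integer time beyond C / e, so that the survival probability is at most C / n <= e. *)
  pose n := (Num.truncn (C / e)).+1.
  have n0 : 0 < n%:R :> R by rewrite ltr0n.
  apply: (@le_trans _ _ (C / n%:R)).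
    apply: le_trans (HC _ n0); apply: fine_prob_le => //.
    - exact: measurableC.
    - exact: mpos.
    by move=> w; rewrite SE => nS; apply: contrapT => nX; apply: nS; exists n.
  by rewrite ler_pdivrMr// mulrC -ler_pdivrMr// ltW// truncnS_gt.
have PS0 : P (~` S) = 0%E.
  apply/eqP; rewrite eq_le measure_ge0 andbT.
  by rewrite -(fineK (fin_num_prob P (measurableC mS))) lee_fin.
by have := probability_setC P mS; rewrite PS0 => /esym/eqP;
  rewrite sube_eq ?add0e// => /eqP.
Qed.

End Process.
End Extinction.

Theorem lemma2p1 (R : realType) (lambda mu alpha rho : R)
    (hlambda : 0 < lambda) (hmu : 0 < mu) (halpha : 0 < alpha) (hrho : 0 < rho)
    (x : R) (hx : 0 <= x)
    (d : measure_display) (T : measurableType d) (P : probability T R)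
    (F : R -> set (set T)) (hF : filtration F)
    (B : R -> T -> R) (hB : brownian_motion P F B)
    (X : R -> T -> R)
    (hX : sde_solution P F B
            (fun y => (lambda - mu - alpha * y) * y)
            (fun y => rho * Num.sqrt ((lambda + mu + alpha * y) * y))
            X)
    (hXge0 : forall (t : R) w, 0 <= t -> 0 <= X t w)
    (hXabs : forall (t : R) w, 0 <= t -> (hitting_time X 0 w <= t%:E)%E -> X t w = 0)
    (hX0 : P [set w | X 0 w = x] = 1%E) :
  P [set w | (hitting_time X 0 w < +oo)%E] = 1%E.
Proof. exact: (extinction_as hlambda hmu halpha hrho hF hB hX hXge0 hXabs). Qed.
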